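(* Let $G$ be a finite group and let $X$ be a finite-dimensional $G$-CW complex which is acyclic (i.e. $X$ is nonempty and $\tilde H_*(X; \mathbb{Z}) = 0$). Then the orbit space $X/G$ is acyclic.
   Context: A $G$-CW complex is a $G$-space built by attaching equivariant cells $G/H \times D^n$ along maps $G/H \times S^{n-1} \to X_{n-1}$; equivalently (for discrete $G$) a CW complex with a cellular $G$-action such that an element fixing an open cell setwise fixes it pointwise. $X/G$ is the space of orbits with the quotient topology. *)

(* Defs.v *)
From HB Require Import structures.
From mathcomp Require Import all_boot all_order all_algebra all_fingroup.
From mathcomp Require Import all_classical all_reals topology.
From mathcomp Require Import subspace_topology matrix_topology.
From mathcomp Require Import Rstruct Rstruct_topology.
Set Implicit Arguments. Unset Strict Implicit. Unset Printing Implicit Defensive.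
Import Order.TTheory GRing.Theory Num.Theory.
Local Open Scope classical_set_scope.
Local Open Scope ring_scope.

Notation RR := Rdefinitions.R.

Definition stdsimplex (n : nat) : set 'rV[RR]_n.+1 :=
  [set x | (forall i, 0 <= x ord0 i) /\ \sum_i x ord0 i = 1].
Arguments stdsimplex n : clear implicits.

Definition face (n : nat) (j : 'I_n.+2) (x : 'rV[RR]_n.+1) : 'rV[RR]_n.+2 :=
  \row_k (if unlift j k is Some k' then x ord0 k' else 0).

(* a formal (finite) integer combination of maps Delta^n -> T;
   two maps are identified when they agree on the standard simplex *)
Definition chain (T : Type) (n : nat) := seq (int * ('rV[RR]_n.+1 -> T)).

Definition singular_chain (T : topologicalType) (n : nat) (c : chain T n) :=
  forall p, List.In p c -> {within stdsimplex n, continuous p.2}.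

Definition coef (T : Type) (n : nat) (c : chain T n) (s : 'rV[RR]_n.+1 -> T)
  : int :=
  \sum_(p <- c) (if `[< forall x, stdsimplex n x -> p.2 x = s x >]
                 then p.1 else 0).

Definition boundary (T : Type) (n : nat) (c : chain T n.+1) : chain T n :=
  flatten [seq [seq (((-1) ^+ nat_of_ord j : int) * p.1, p.2 \o @face n j)
               | j : 'I_n.+2 <- enum 'I_n.+2]
          | p <- c].

Definition augmentation (T : Type) (c : chain T 0) : int := \sum_(p <- c) p.1.

Definition acyclic (T : topologicalType) : Prop :=
  [/\ (exists x : T, True),
      (forall c : chain T 0, singular_chain c -> augmentation c = 0 ->
         exists d : chain T 1, singular_chain d /\
           forall s, coef (boundary d) s = coef c s) &
      (forall (n : nat) (c : chain T n.+1), singular_chain c ->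
         (forall s, coef (boundary c) s = 0) ->
         exists d : chain T n.+2, singular_chain d /\
           forall s, coef (boundary d) s = coef c s)].

Definition disk (n : nat) : set 'rV[RR]_n :=
  [set x | \sum_i x ord0 i ^+ 2 <= 1].
Definition open_disk (n : nat) : set 'rV[RR]_n :=
  [set x | \sum_i x ord0 i ^+ 2 < 1].
Definition sphere (n : nat) : set 'rV[RR]_n :=
  [set x | \sum_i x ord0 i ^+ 2 = 1].
Arguments disk n : clear implicits.
Arguments open_disk n : clear implicits.
Arguments sphere n : clear implicits.

Definition open_cell (T : Type) (n : nat) (phi : 'rV[RR]_n -> T) : set T :=
  phi @` open_disk n.

Definition is_CW (T : topologicalType) (I : Type) (dim : I -> nat)
    (phi : forall i, 'rV[RR]_(dim i) -> T) : Prop :=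
  [/\ hausdorff_space T /\
      (forall i, {within disk (dim i), continuous phi i}),
      (* and restrict to homeomorphisms from the open disk onto the open cell *)
      (forall i, {in open_disk (dim i) &, injective (phi i)} /\
         forall U : set 'rV[RR]_(dim i), open U ->
           exists V : set T, open V /\
             phi i @` (U `&` open_disk (dim i)) = V `&` open_cell (phi i)),
      ((forall x : T, exists i, open_cell (phi i) x) /\
       (forall i j x, open_cell (phi i) x -> open_cell (phi j) x -> i = j)),
      (forall i, exists (m : nat) (J : 'I_m -> I),
         (forall k, (dim (J k) < dim i)%N) /\
         phi i @` sphere (dim i) `<=` \bigcup_k open_cell (phi (J k))) &
      (forall A : set T,
         closed A <-> forall i, closed (disk (dim i) `&` phi i @^-1` A))].

Arguments is_CW {T I} dim phi.

Definition finite_dimensional (I : Type) (dim : I -> nat) : Prop :=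
  exists N, forall i, (dim i <= N)%N.

Definition is_continuous_action (gT : finGroupType) (T : topologicalType)
    (act : gT -> T -> T) : Prop :=
  [/\ (forall x, act 1%g x = x),
      (forall g h x, act (g * h)%g x = act g (act h x)) &
      (forall g, continuous (act g))].

Definition is_GCW (gT : finGroupType) (T : topologicalType)
    (act : gT -> T -> T) (I : Type) (dim : I -> nat)
    (phi : forall i, 'rV[RR]_(dim i) -> T) : Prop :=
  [/\ is_continuous_action act,
      is_CW dim phi,
      (forall g i, exists j, act g @` open_cell (phi i) = open_cell (phi j)) &
      (forall g i, act g @` open_cell (phi i) = open_cell (phi i) ->
         forall x, open_cell (phi i) x -> act g x = x)].

Arguments is_GCW {gT T} act {I} dim phi.

Definition is_orbit_space (gT : finGroupType) (T Y : topologicalType)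
    (act : gT -> T -> T) (p : T -> Y) : Prop :=
  [/\ (forall y : Y, exists x, p x = y),
      (forall x x', p x = p x' <-> exists g, act g x = x') &
      forall U : set Y, open U <-> open (p @^-1` U)].

(* Main.v *)
(* The cellular chain complex of [X] carries an action of [G] which permutes the
   cells, and the boundary of a cell fixed by [g] only involves cells fixed by [g].
   Smith theory shows that exactness passes to the quotient of such a bounded
   complex: for a generator [z] of Z/p acting over F_p put [tau = 1 - z]; then
   [tau^(p-1)] is the sum over the group, a chain killed by [tau^j] is a chain of
   fixed cells plus an element of the image of [tau^(p-j)], and descending
   induction on the degree applies.  Climbing a subgroup series gives the quotient
   by a p-group, and transfer to a Sylow subgroup the quotient by [G], over F_p.
   Over Z, transfer to the trivial subgroup bounds a multiple of each cycle, and
   the F_p case allows one to divide that multiple by its prime factors in turn.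

   Cellular and singular chains are compared without forming homology groups: by
   subdivision, excision and radial retraction, a singular chain of the k-skeleton
   with boundary in the (k-1)-skeleton is, up to boundaries and chains of the
   (k-1)-skeleton, a combination of characteristic chains, with unique
   coefficients.  Finite dimension bounds the complex and makes the filtration
   finite. *)
(* [freeg] comes first because its [lift] would otherwise shadow that of [fintype]. *)
From mathcomp.multinomials Require Import freeg.
Require Import Defs.
From HB Require Import structures.
From mathcomp Require Import all_boot all_order all_algebra all_fingroup all_solvable.
From mathcomp Require Import all_classical all_reals all_analysis.
From mathcomp Require Import Rstruct Rstruct_topology ring lra zify.
Set Implicit Arguments. Unset Strict Implicit. Unset Printing Implicit Defensive.
Import Order.TTheory GRing.Theory Num.Theory.
Import numFieldNormedType.Exports.
Local Open Scope classical_set_scope.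
Local Open Scope ring_scope.

(** * Free modules *)

(** The definition of a G-CW complex does not record that the cells of an orbit have equal
    dimension, which is a form of invariance of domain. Each orbit is therefore given the least
    dimension of its cells, and the characteristic map of a cell of that dimension is transported
    along the orbit; as stabilisers fix cells pointwise, the resulting maps are equivariant on the
    nose. The cellular boundary of a cell is chosen as a combination of cells that equals its
    singular boundary up to a boundary and a chain one filtration step lower. Such a combination is
    unique, and uniqueness alone yields that the boundary squares to zero, commutes with the group,
    preserves fixed cells (the construction can be carried out in the fixed point set) and is
    compatible with the orbit map. All chains are augmented, by an empty simplex and an empty cell,
    so that nonemptiness becomes exactness in degree 0 and spheres arise from the empty set by
    suspension. *)

Definition FM (R : nzRingType) (K : Type) := {freeg {classic K} / R}.
HB.instance Definition _ R K := GRing.Lmodule.on (FM R K).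

Section FreeModule.
Variable R : nzRingType.

Definition ub (K : Type) (k : K) : FM R K := @Freeg R {classic K} [:: (1, k)].
Definition cf (K : Type) (k : K) (c : FM R K) : R := @coeff R {classic K} k c.
Definition lin (K : Type) (M : lmodType R) (f : K -> M) : FM R K -> M :=
  @fglift R M {classic K} f.
Definition supp (K : Type) (P : K -> Prop) (c : FM R K) :=
  forall k, cf k c != 0 -> P k.

Section Cf.
Variables (K : Type).
Implicit Types (k : K) (c : FM R K).

Lemma cfD k c c' : cf k (c + c') = cf k c + cf k c'. Proof. exact: coeffD. Qed.
Lemma cfB k c c' : cf k (c - c') = cf k c - cf k c'. Proof. exact: coeffB. Qed.
Lemma cfN k c : cf k (- c) = - cf k c. Proof. exact: coeffN. Qed.
Lemma cf0 k : cf k 0 = 0. Proof. exact: coeff0. Qed.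
Lemma cfZ k a c : cf k (a *: c) = a * cf k c. Proof. exact: coeffZ. Qed.
Lemma cf_sum (I : Type) (r : seq I) (P : pred I) k (F : I -> FM R K) :
  cf k (\sum_(i <- r | P i) F i) = \sum_(i <- r | P i) cf k (F i).
Proof.
apply: (big_morph (cf k)); [exact: cfD | exact: cf0].
Qed.
Lemma cf_ub k k' : cf k (ub k') = `[< k' = k >]%:R.
Proof.
rewrite /cf /ub coeffU mul1r.
by case: asboolP => [->|h]; [rewrite eqxx|case: eqP].
Qed.
Lemma cf_ext c c' : (forall k, cf k c = cf k c') -> c = c'.
Proof. by move=> h; apply/eqP/freeg_eqP. Qed.

Lemma FM_sum c : c = \sum_(z <- freeg.dom c) cf z c *: @ub K z.
Proof.
rewrite -[LHS]freeg_sumE; apply: eq_bigr => z _; apply: cf_ext => k.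
by rewrite cfZ cf_ub /cf coeffU; case: asboolP => [->|h]; [rewrite eqxx|case: eqP].
Qed.

(** The induction runs along the support of [c] itself, so only generators satisfying [P] are ever
    added; in an arbitrary presentation of [c] other generators could occur and cancel. *)
Lemma supp_ind (P : K -> Prop) (Q : FM R K -> Prop) : Q 0 ->
  (forall a k c, P k -> Q c -> Q (a *: ub k + c)) -> forall c, supp P c -> Q c.
Proof.
move=> Q0 QS c Pc; rewrite (FM_sum c) big_seq.
apply: (big_rec Q) => //.
move=> k x; rewrite (mem_dom c) => hk; apply: QS; exact: Pc.
Qed.

Lemma supp_all c : supp (fun=> True) c. Proof. by []. Qed.

Lemma supp0 (P : K -> Prop) : supp P 0.
Proof. by move=> k; rewrite cf0 eqxx. Qed.
Lemma suppD (P : K -> Prop) c c' : supp P c -> supp P c' -> supp P (c + c').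
Proof.
move=> h h' k; rewrite cfD; have [e|/h //] := eqVneq (cf k c) 0.
by rewrite e add0r; apply: h'.
Qed.
Lemma suppN (P : K -> Prop) c : supp P c -> supp P (- c).
Proof. by move=> h k; rewrite cfN oppr_eq0; apply: h. Qed.
Lemma suppB (P : K -> Prop) c c' : supp P c -> supp P c' -> supp P (c - c').
Proof. by move=> h h'; apply: suppD => //; apply: suppN. Qed.
Lemma suppZ (P : K -> Prop) a c : supp P c -> supp P (a *: c).
Proof.
move=> h k; rewrite cfZ; have [e|/h //] := eqVneq (cf k c) 0.
by rewrite e mulr0 eqxx.
Qed.
Lemma supp_ub (P : K -> Prop) k : P k -> supp P (ub k).
Proof.
by move=> h k'; rewrite cf_ub; case: asboolP => [<- //|_]; rewrite eqxx.
Qed.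
Lemma supp_sum (P : K -> Prop) (I : Type) (r : seq I) (S : pred I) (F : I -> FM R K) :
  (forall i, S i -> supp P (F i)) -> supp P (\sum_(i <- r | S i) F i).
Proof. by move=> h; elim/big_ind: _ => //; [exact: supp0|exact: suppD]. Qed.
Lemma supp_sub (P Q : K -> Prop) c : (forall k, P k -> Q k) -> supp P c -> supp Q c.
Proof. by move=> h h' k /h' /h. Qed.
Lemma supp_False c : supp (fun=> False) c -> c = 0.
Proof.
move=> h; apply: cf_ext => k; rewrite cf0; apply/eqP/negPn/negP => /h //.
Qed.
Lemma suppI (P Q : K -> Prop) c : supp P c -> supp Q c -> supp (fun k => P k /\ Q k) c.
Proof. by move=> h h' k hk; split; [exact: h|exact: h']. Qed.
Lemma cf_supp (P : K -> Prop) c k : supp P c -> ~ P k -> cf k c = 0.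
Proof. by move=> h h'; apply/eqP/negPn/negP => /h. Qed.
Lemma scale_ub_eq0 a k : a *: ub k = 0 -> a = 0.
Proof. by move=> /(congr1 (cf k)); rewrite cfZ cf_ub asboolT // mulr1 cf0. Qed.
End Cf.

Section Lin.
Variables (K : Type) (M : lmodType R).
Implicit Types (f : K -> M).

Lemma lin_ub f k : lin f (ub k) = f k.
Proof. by rewrite /lin /ub liftU scale1r. Qed.

Lemma lin_is_zmod f : zmod_morphism (lin f).
Proof. exact: (@lift_is_additive R {classic K} M f). Qed.
HB.instance Definition _ f :=
  GRing.isZmodMorphism.Build (FM R K) M (lin f) (@lin_is_zmod f).

Lemma lin_is_scalable f : scalable (lin f).
Proof.
move=> a c; move: a.
have e b k : lin f (b *: ub k) = b *: f k.
  have -> : b *: ub k = @Freeg R {classic K} [:: (b, k)].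
    by apply: cf_ext => k'; rewrite cfZ /ub /cf !coeffU mul1r.
  by rewrite /lin liftU.
move: c (@supp_all K c); apply: supp_ind => [|b k c _ IH] a.
  by rewrite scaler0 raddf0 scaler0.
by rewrite scalerDr scalerA !raddfD /= IH !e scalerA.
Qed.
HB.instance Definition _ f :=
  GRing.isScalable.Build R (FM R K) M *:%R (lin f) (@lin_is_scalable f).

Lemma eq_supp (P : K -> Prop) (g g' : {linear FM R K -> M}) c :
  (forall k, P k -> g (ub k) = g' (ub k)) -> supp P c -> g c = g' c.
Proof.
move=> h; move: c; apply: supp_ind => [|a k c Pk IH]; first by rewrite !raddf0.
by rewrite !linearD !linearZ /= h // IH.
Qed.

Lemma eq_FM (g g' : {linear FM R K -> M}) :
  (forall k, g (ub k) = g' (ub k)) -> g =1 g'.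
Proof. by move=> h c; apply: (@eq_supp (fun=> True)). Qed.

Lemma supp_lin_ind (P : K -> Prop) (Q : M -> Prop) (g : {linear FM R K -> M}) c :
  Q 0 -> (forall a x y, Q x -> Q y -> Q (a *: x + y)) ->
  (forall k, P k -> Q (g (ub k))) -> supp P c -> Q (g c).
Proof.
move=> Q0 QS h; move: c; apply: supp_ind => [|a k c Pk IH]; first by rewrite raddf0.
by rewrite linearD linearZ /=; apply: QS => //; apply: h.
Qed.
End Lin.

Lemma supp_lin (K K' : Type) (P : K -> Prop) (Q : K' -> Prop)
    (g : {linear FM R K -> FM R K'}) c :
  (forall k, P k -> supp Q (g (ub k))) -> supp P c -> supp Q (g c).
Proof.
apply: supp_lin_ind; first exact: supp0.
by move=> a x y hx hy; apply: suppD => //; apply: suppZ.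
Qed.

Definition mapf (K K' : Type) (f : K -> K') : FM R K -> FM R K' :=
  lin (fun k => ub (f k)).
HB.instance Definition _ K K' (f : K -> K') := GRing.Linear.on (mapf f).

Lemma mapf_ub (K K' : Type) (f : K -> K') k : mapf f (ub k) = ub (f k).
Proof. exact: lin_ub. Qed.

Lemma mapf_comp (K K' K'' : Type) (f : K -> K') (g : K' -> K'') c :
  mapf g (mapf f c) = mapf (g \o f) c.
Proof.
apply: (@eq_FM _ _ (mapf g \o mapf f) (mapf (g \o f))) => k /=.
by rewrite !mapf_ub.
Qed.

Lemma mapf_id (K : Type) (f : K -> K) (P : K -> Prop) c :
  (forall k, P k -> f k = k) -> supp P c -> mapf f c = c.
Proof.
move=> h; apply: (@eq_supp _ _ P (mapf f) idfun) => k /h /=.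
by rewrite mapf_ub => ->.
Qed.

Lemma supp_mapf (K K' : Type) (f : K -> K') (P : K -> Prop) (Q : K' -> Prop) c :
  (forall k, P k -> Q (f k)) -> supp P c -> supp Q (mapf f c).
Proof.
move=> h; apply: (@supp_lin _ _ P _ (mapf f)) => k /h hk /=; rewrite mapf_ub; exact: supp_ub.
Qed.

Definition restr (K : Type) (P : K -> Prop) : FM R K -> FM R K :=
  lin (fun k => if `[< P k >] then ub k else 0).
HB.instance Definition _ K (P : K -> Prop) := GRing.Linear.on (restr P).

Lemma cf_restr (K : Type) (P : K -> Prop) c k :
  cf k (restr P c) = if `[< P k >] then cf k c else 0.
Proof.
move: c (@supp_all _ c); apply: supp_ind => [|a k' c _ IH].
  by rewrite raddf0 cf0 if_same.
rewrite linearD linearZ /= !cfD !cfZ IH /restr lin_ub cf_ub.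
case: (asboolP (k' = k)) => [->|nk]; case: (asboolP (P _)) => hk;
  rewrite ?cf0 ?cf_ub ?mulr0 ?add0r ?addr0 //; case: asboolP => //= ?;
  rewrite ?mulr0 ?add0r ?cf0 //; by case: asboolP => //= hh; rewrite ?mulr0 ?add0r.
Qed.

Lemma supp_restrl (K : Type) (P : K -> Prop) c : supp P (restr P c).
Proof. by move=> k; rewrite cf_restr; case: asboolP => // _; rewrite eqxx. Qed.

Lemma supp_restrr (K : Type) (P Q : K -> Prop) c : supp Q c -> supp Q (restr P c).
Proof. by move=> h k; rewrite cf_restr; case: asboolP => [_ /h|_]; rewrite ?eqxx. Qed.

Lemma supp_restrC (K : Type) (P Q : K -> Prop) c : supp Q c ->
  supp (fun k => ~ P k /\ Q k) (c - restr P c).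
Proof.
by move=> h k; rewrite cfB cf_restr; case: asboolP => [Pk|nP]; rewrite ?subrr ?eqxx ?subr0 // => /h.
Qed.

Lemma restr_id (K : Type) (P : K -> Prop) c : supp P c -> restr P c = c.
Proof.
move=> h; apply: cf_ext => k; rewrite cf_restr; case: asboolP => // nP.
by rewrite (cf_supp h nP).
Qed.

Lemma cf_mapf (K K' : Type) (f : K -> K') (k : K) c : injective f ->
  cf (f k) (mapf f c) = cf k c.
Proof.
move=> fI; move: c (@supp_all _ c); apply: supp_ind => [|a k' c _ IH].
  by rewrite raddf0 !cf0.
rewrite linearD linearZ /= !cfD !cfZ mapf_ub !cf_ub IH; congr (_ * (nat_of_bool _)%:R + _).
by apply/asboolP/asboolP => [/fI|->].
Qed.
End FreeModule.
Arguments ub {R K} k.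
Arguments mapf {R K K'} f.

Notation C_ K := (FM int K).

(** * Singular chains *)

Section Lists.
Variable E : Type.
Implicit Types (x : E) (l : seq E) (c : C_ (seq E)).

Definition consl x : C_ (seq E) -> C_ (seq E) := mapf (cons x).
HB.instance Definition _ x := GRing.Linear.on (consl x).

(** The recursive form gives the cone formula [dl_cons] at once, and this formula drives the later
    computations; the alternating sum is recovered in [dlbE]. A list of one vertex has boundary [ub
    [::]], so the augmentation is built in. *)
Fixpoint dlb l : C_ (seq E) := if l is x :: l' then ub l' - consl x (dlb l') else 0.
Definition dl : C_ (seq E) -> C_ (seq E) := lin dlb.
HB.instance Definition _ := GRing.Linear.on dl.

Definition LP (C : set E) m l := size l = m /\ forall x, List.In x l -> C x.

Lemma dl_ub l : dl (ub l) = dlb l. Proof. exact: lin_ub. Qed.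
Lemma dl_cons x c : dl (consl x c) = c - consl x (dl c).
Proof.
apply: (@eq_FM _ _ _ (dl \o consl x) (idfun \- (consl x \o dl))) => l /=.
by rewrite /consl mapf_ub !dl_ub.
Qed.

Lemma dldl c : dl (dl c) = 0.
Proof.
apply: (@eq_FM _ _ _ (dl \o dl) \0) => l /=.
rewrite dl_ub; elim: l => [|x l IH] /=; first by rewrite raddf0.
by rewrite raddfB /= dl_ub dl_cons IH raddf0 subr0 subrr.
Qed.

Lemma supp_consl (C : set E) m x c : C x -> supp (LP C m) c ->
  supp (LP C m.+1) (consl x c).
Proof.
move=> Cx; apply: supp_mapf => l [sl hl]; split; first by rewrite /= sl.
by move=> y /= [<- //|/hl].
Qed.

Lemma supp_dlb (C : set E) m l : LP C m.+1 l -> supp (LP C m) (dlb l).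
Proof.
elim: l m => [|x l IH] m [] // [sl] hl /=.
apply: suppB; first by apply: supp_ub; split=> // y hy; apply: hl; right.
case: m sl => [|m] sl.
  by rewrite (size0nil sl) /= raddf0; exact: supp0.
apply: supp_consl; first by apply: hl; left.
by apply: IH; split=> // y hy; apply: hl; right.
Qed.

End Lists.
Arguments dl {E}.

Definition mapl (E E' : Type) (g : E -> E') : C_ (seq E) -> C_ (seq E') := mapf (map g).
HB.instance Definition _ E E' (g : E -> E') := GRing.Linear.on (mapl g).

Lemma mapl_ub (E E' : Type) (g : E -> E') l : mapl g (ub l) = ub (map g l).
Proof. exact: mapf_ub. Qed.

Lemma mapl_consl (E E' : Type) (g : E -> E') x c :
  mapl g (consl x c) = consl (g x) (mapl g c).
Proof. by rewrite /mapl /consl !mapf_comp. Qed.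

Lemma dl_mapl (E E' : Type) (g : E -> E') c : dl (mapl g c) = mapl g (dl c).
Proof.
apply: (@eq_FM _ _ _ (dl \o mapl g) (mapl g \o dl)) => l /=.
rewrite mapl_ub !dl_ub; elim: l => [|x l IH] /=; first by rewrite raddf0.
by rewrite raddfB /= mapl_ub IH mapl_consl.
Qed.

Lemma In_nth (K : Type) (x0 : K) l i : (i < size l)%N -> List.In (nth x0 l i) l.
Proof. by elim: l i => // x l IH [|i] hi /=; [left|right; apply: IH]. Qed.

Section Convex.
Variable E : lmodType RR.
Implicit Types (C : set E).

Definition cvx C := forall x y (t : RR), C x -> C y -> 0 <= t <= 1 ->
  C ((1 - t) *: x + t *: y).

Lemma cvx_sum C : cvx C -> forall n (w : 'I_n -> RR) (v : 'I_n -> E),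
  (forall i, 0 <= w i) -> \sum_i w i = 1 -> (forall i, C (v i)) ->
  C (\sum_i w i *: v i).
Proof.
move=> cC; elim=> [|n IH] w v w0 w1 Cv.
  by move: w1; rewrite big_ord0 => /eqP; rewrite eq_sym oner_eq0.
rewrite big_ord_recl /=.
have hw : 0 <= \sum_(i < n) w (lift ord0 i) by apply: sumr_ge0.
move: w1; rewrite big_ord_recl /= => w1.
have [e|ne] := eqVneq (\sum_(i < n) w (lift ord0 i)) 0.
  rewrite big1 ?addr0 => [|i _].
    by move: w1; rewrite e addr0 => ->; rewrite scale1r.
  have /psumr_eq0P h : forall j : 'I_n, true -> 0 <= w (lift ord0 j) by [].
  by rewrite (h e i) ?scale0r.
set s := \sum_(i < n) _ in w1 ne hw *.
have -> : \sum_(i < n) w (lift ord0 i) *: v (lift ord0 i) =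
    s *: \sum_(i < n) (w (lift ord0 i) / s) *: v (lift ord0 i).
  rewrite scaler_sumr; apply: eq_bigr => i _.
  by rewrite scalerA mulrCA divff ?mulr1.
have -> : w ord0 = 1 - s by rewrite -w1 addrK.
apply: cC => //.
- apply: IH => // [i|]; first by rewrite divr_ge0.
  by rewrite -mulr_suml divff.
- by rewrite hw /= -w1 lerDr w0.
Qed.

End Convex.

Section Affine.
Variable E : lmodType RR.
Implicit Types (l : seq E).

Definition aff l n (x : 'rV[RR]_n) : E := \sum_(i < n) x ord0 i *: nth 0 l i.

Lemma aff_is_linear l n : linear (@aff l n).
Proof.
move=> a x y; rewrite /aff scaler_sumr -big_split; apply: eq_bigr => i _ /=.
by rewrite !mxE scalerDl scalerA.
Qed.
HB.instance Definition _ l n := GRing.isLinear.Build RR 'rV[RR]_n E *:%R (@aff l n) (@aff_is_linear l n).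

Lemma aff_cvx (C : set E) l n (x : 'rV[RR]_n.+1) : cvx C -> LP C n.+1 l ->
  stdsimplex n x -> C (aff l x).
Proof.
move=> cC [sl hl] [x0 x1]; apply: cvx_sum => // i; apply: hl.
by apply: In_nth; rewrite sl.
Qed.

End Affine.

(** Continuity relative to [A] of a total function, unfolded into neighbourhoods of the ambient
    space, so that restriction, composition and products need no subspace topology. *)
Definition contOn (X Y : topologicalType) (A : set X) (f : X -> Y) :=
  forall x, A x -> forall U : set Y, nbhs (f x) U -> nbhs x (fun y => A y -> U (f y)).

Section ContOn.
Variables X Y Z : topologicalType.
Implicit Types (A : set X).

Lemma contOnP A (f : X -> Y) : {within A, continuous f} <-> contOn A f.
Proof. by rewrite subspace_continuousP. Qed.

Lemma contOn_comp A (B : set Y) (f : X -> Y) (g : Y -> Z) :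
  contOn A f -> contOn B g -> (forall x, A x -> B (f x)) -> contOn A (g \o f).
Proof.
move=> cf cg AB x Ax U /(cg _ (AB _ Ax)) /(cf _ Ax).
by apply: filterS => y hy Ay; apply: hy => //; apply: AB.
Qed.

Lemma contOn_sub A (B : set X) (f : X -> Y) :
  A `<=` B -> contOn B f -> contOn A f.
Proof.
by move=> AB cf x Ax U /(cf _ (AB _ Ax)); apply: filterS => y hy /AB /hy.
Qed.

Lemma contOn_eq A (f g : X -> Y) :
  (forall x, A x -> f x = g x) -> contOn A f -> contOn A g.
Proof.
move=> fg cf x Ax U; rewrite -fg // => /(cf _ Ax).
by apply: filterS => y hy Ay; rewrite -fg //; apply: hy.
Qed.

Lemma contOnT A (f : X -> Y) : continuous f -> contOn A f.
Proof.
move=> cf x _ U /(cf x) h; have : nbhs x (f @^-1` U) by [].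
by apply: filterS => y.
Qed.

Lemma contOn_pair A (f : X -> Y) (g : X -> Z) :
  contOn A f -> contOn A g -> contOn A (fun x => (f x, g x)).
Proof.
move=> cf cg x Ax U [[P Q] /= [/(cf _ Ax) hP /(cg _ Ax) hQ] PQ].
by apply: filterS (filterI hP hQ) => y [hy hy'] Ay; apply: PQ; split; [exact: hy|exact: hy'].
Qed.

Lemma contOn_slice A (B : set Y) (f : X * Y -> Z) t :
  B t -> contOn (A `*` B) f -> contOn A (fun x => f (x, t)).
Proof.
move=> Bt cf x Ax U /(cf (x, t) (conj Ax Bt)) [[P Q] /= [hP hQ] PQ].
apply: filterS hP => y Py Ay; apply: (PQ (y, t)) => //; split=> //.
exact: nbhs_singleton hQ.
Qed.

End ContOn.

(* [Emp] is the empty simplex: chains are augmented, and homology is reduced.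
   Degrees count vertices ([nv]), so they exceed the dimension by one.  Singular
   simplices are required to factor through the retraction [rn], so that maps
   which agree on the standard simplex are equal. *)
Inductive simp (T : Type) := Emp | Sx n (s : 'rV[RR]_n.+1 -> T).
Arguments Emp {T}.

Section StdSimplex.
Variable n : nat.
Local Notation V := 'rV[RR]_n.+1.

Definition vtx (i : 'I_n.+1) : V := delta_mx ord0 i.
(** This is not continuous in general; it only normalises values outside the simplex, and singular
    simplices are required to be continuous on the simplex alone. *)
Definition rn (x : V) : V := if `[< stdsimplex n x >] then x else vtx ord0.
Definition std : seq V := [seq vtx i | i <- enum 'I_n.+1].

Lemma vtx_std i : stdsimplex n (vtx i).
Proof.
split=> [j|]; first by rewrite mxE eqxx /=; case: eqP.
rewrite (bigD1 i) //= big1 ?addr0 ?mxE ?eqxx // => j ji.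
by rewrite mxE eqxx /= (negbTE ji).
Qed.

Lemma rn_std x : stdsimplex n (rn x).
Proof. by rewrite /rn; case: asboolP => // _; exact: vtx_std. Qed.

Lemma rn_id x : stdsimplex n x -> rn x = x.
Proof. by rewrite /rn; case: asboolP. Qed.

Lemma size_std : size std = n.+1. Proof. by rewrite size_map size_enum_ord. Qed.

Lemma nth_std (i : 'I_n.+1) : nth 0 std i = vtx i.
Proof. by rewrite (nth_map ord0) ?size_enum_ord // nth_ord_enum. Qed.

Lemma LP_std : LP (stdsimplex n) n.+1 std.
Proof.
split; first exact: size_std.
by move=> x /List.in_map_iff [i [<- _]]; exact: vtx_std.
Qed.

Lemma cvx_std : cvx (stdsimplex n).
Proof.
move=> x y t [x0 x1] [y0 y1] /andP[t0 t1]; split=> [i|].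
  by rewrite !mxE addr_ge0 // mulr_ge0 ?subr_ge0.
under eq_bigr do rewrite !mxE.
by rewrite big_split -!mulr_sumr /= x1 y1 !mulr1 subrK.
Qed.

Lemma aff_std (x : V) : aff std x = x.
Proof.
apply/rowP => j; rewrite summxE (bigD1 j) //= big1 => [|i ij].
  by rewrite addr0 nth_std !mxE !eqxx mulr1.
by rewrite nth_std !mxE eqxx /= eq_sym (negbTE ij) mulr0.
Qed.

Lemma aff_vtx (E : lmodType RR) (l : seq E) i : aff l (vtx i) = nth 0 l i.
Proof.
rewrite /aff (bigD1 i) //= big1 => [|j ji]; first by rewrite addr0 !mxE !eqxx scale1r.
by rewrite !mxE eqxx /= (negbTE ji) scale0r.
Qed.

Lemma map_aff_std (E : lmodType RR) (l : seq E) : size l = n.+1 ->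
  map (aff l (n := n.+1)) std = l.
Proof.
move=> sl; apply: (@eq_from_nth _ 0); rewrite size_map size_std // => i hi.
rewrite (nth_map 0) ?size_std //.
by rewrite (nth_std (Ordinal hi)) aff_vtx.
Qed.

End StdSimplex.

Lemma aff_map (E E' : lmodType RR) (g : {linear E -> E'}) l n (z : 'rV[RR]_n) :
  size l = n -> g (aff l z) = aff (map g l) z.
Proof.
move=> sl; rewrite /aff linear_sum; apply: eq_bigr => i _.
by rewrite linearZ_LR (nth_map 0) // sl.
Qed.

Lemma continuous_sum (X : topologicalType) (E : normedModType RR) (I : Type)
    (r : seq I) (F : I -> X -> E) : (forall i, continuous (F i)) ->
  continuous (fun x => \sum_(i <- r) F i x).
Proof.
move=> cF; elim: r => [|i r IH].
  rewrite (_ : (fun x => _) = fun=> 0); first by move=> x; exact: cvg_cst.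
  by apply/funext => y; rewrite big_nil.
rewrite (_ : (fun x => _) = fun y => F i y + \sum_(i <- r) F i y); last first.
  by apply/funext => y; rewrite big_cons.
by move=> x; apply: cvgD; [exact: cF|exact: IH].
Qed.

Lemma aff_continuous (E : normedModType RR) (l : seq E) n :
  continuous (fun x : 'rV[RR]_n => aff l x).
Proof.
apply: continuous_sum => i x; apply: (@cvgZr_tmp _ _ _ (nbhs x)).
exact: coord_continuous.
Qed.

Section Simpl.
Variable T : Type.

Definition nv (s : simp T) := match s with Emp => 0%N | Sx n _ => n.+1 end.

(** The affine simplex with vertex list [l], followed by [f]. Boundary, prism and subdivision are
    all defined on vertex lists and reach singular chains through such simplices. *)
Definition simpl (E : lmodType RR) (f : E -> T) (l : seq E) : simp T :=
  match l with
  | [::] => Emp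
  | x :: l' => Sx (fun y : 'rV_(size l').+1 => f (aff (x :: l') (rn y)))
  end.

Lemma simplE (E : lmodType RR) (f : E -> T) l n : size l = n.+1 ->
  simpl f l = Sx (fun y : 'rV_n.+1 => f (aff l (rn y))).
Proof. by case: l => // x l' [<-]. Qed.

Definition pushl (E : lmodType RR) (f : E -> T) : C_ (seq E) -> C_ (simp T) :=
  mapf (simpl f).
HB.instance Definition _ E f := GRing.Linear.on (@pushl E f).

Lemma pushl_ub (E : lmodType RR) (f : E -> T) l : pushl f (ub l) = ub (simpl f l).
Proof. exact: mapf_ub. Qed.

Lemma simpl_comp (E E' : lmodType RR) (g : {linear E -> E'}) (f : E' -> T)
    (f' : E -> T) (C : set E) m l : cvx C -> (forall x, C x -> f' x = f (g x)) ->
  LP C m l -> simpl f' l = simpl f (map g l).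
Proof.
move=> cC ff' Cl; have sl : size l = m by case: Cl.
case: m => [|m] in Cl sl *; first by rewrite (size0nil sl).
rewrite (simplE _ sl) (@simplE _ _ _ m) ?size_map //; congr Sx.
apply/funext => y; rewrite -aff_map // ff' //.
by apply: aff_cvx Cl _ => //; exact: rn_std.
Qed.

Lemma pushl_comp (E E' : lmodType RR) (g : {linear E -> E'}) (f : E' -> T)
    (f' : E -> T) (C : set E) m c : cvx C -> (forall x, C x -> f' x = f (g x)) ->
  supp (LP C m) c -> pushl f' c = pushl f (mapl g c).
Proof.
move=> cC ff'; apply: (@eq_supp _ _ _ _ (pushl f') (pushl f \o mapl g)) => l /= Cl.
by rewrite !pushl_ub mapl_ub pushl_ub (simpl_comp cC ff' Cl).
Qed.

Definition bd (s : simp T) : C_ (simp T) :=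
  match s with Emp => 0 | Sx n s' => pushl s' (dlb (std n)) end.
Definition d : C_ (simp T) -> C_ (simp T) := lin bd.
HB.instance Definition _ := GRing.Linear.on d.

Lemma d_ub s : d (ub s) = bd s. Proof. exact: lin_ub. Qed.

(** [l] is the image of the standard vertices under the affine map [aff l], and the boundary of
    lists is natural in the vertices. *)
Lemma d_simpl (E : lmodType RR) (f : E -> T) l : bd (simpl f l) = pushl f (dlb l).
Proof.
case sl : (size l) => [|n]; first by rewrite (size0nil sl) raddf0.
rewrite (simplE f sl) /=.
rewrite (@pushl_comp _ _ (aff l (n := n.+1)) f _ (stdsimplex n) n) //.
- by rewrite -[dlb (std n)]dl_ub -dl_mapl mapl_ub map_aff_std // dl_ub.
- exact: cvx_std.
- by move=> x hx; rewrite rn_id.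
- exact: supp_dlb (LP_std n).
Qed.

Lemma d_pushl (E : lmodType RR) (f : E -> T) c : d (pushl f c) = pushl f (dl c).
Proof.
apply: (@eq_FM _ _ _ (d \o pushl f) (pushl f \o dl)) => l /=.
by rewrite pushl_ub d_ub dl_ub d_simpl.
Qed.

Lemma dd c : d (d c) = 0.
Proof.
apply: (@eq_FM _ _ _ (d \o d) \0) => -[|n s] /=; rewrite d_ub ?raddf0 //=.
by rewrite d_pushl -dl_ub dldl raddf0.
Qed.

End Simpl.
Arguments d {T}.

Definition simps (T T' : Type) (g : T -> T') (s : simp T) : simp T' :=
  match s with Emp => Emp | Sx n s' => simpl (g \o s') (std n) end.
Definition pushs (T T' : Type) (g : T -> T') : C_ (simp T) -> C_ (simp T') :=
  mapf (simps g).
HB.instance Definition _ T T' (g : T -> T') := GRing.Linear.on (pushs g).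

Lemma pushs_ub (T T' : Type) (g : T -> T') s : pushs g (ub s) = ub (simps g s).
Proof. exact: mapf_ub. Qed.

Lemma simps_Sx (T T' : Type) (g : T -> T') n (s : 'rV_n.+1 -> T) :
  simps g (Sx s) = Sx (fun x => g (s (rn x))).
Proof.
by rewrite /= (simplE _ (size_std n)); congr Sx; apply/funext => x; rewrite aff_std.
Qed.

Lemma simps_simpl (T T' : Type) (g : T -> T') (E : lmodType RR) (f : E -> T) l :
  simps g (simpl f l) = simpl (g \o f) l.
Proof.
case sl : (size l) => [|n]; first by rewrite (size0nil sl).
rewrite (simplE _ sl) simps_Sx (simplE _ sl); congr Sx; apply/funext => x /=.
by rewrite (rn_id (rn_std _)).
Qed.

Lemma pushs_pushl (T T' : Type) (g : T -> T') (E : lmodType RR) (f : E -> T) c :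
  pushs g (pushl f c) = pushl (g \o f) c.
Proof.
apply: (@eq_FM _ _ _ (pushs g \o pushl f) (pushl (g \o f))) => l /=.
by rewrite !pushl_ub pushs_ub simps_simpl.
Qed.

Lemma d_pushs (T T' : Type) (g : T -> T') c : d (pushs g c) = pushs g (d c).
Proof.
apply: (@eq_FM _ _ _ (d \o pushs g) (pushs g \o d)) => s /=.
rewrite pushs_ub !d_ub; case: s => [|n s]; first by rewrite raddf0.
by rewrite d_simpl /= pushs_pushl.
Qed.

Lemma pushs_comp (T T' T'' : Type) (g : T -> T') (g' : T' -> T'') c :
  pushs g' (pushs g c) = pushs (g' \o g) c.
Proof.
rewrite /pushs mapf_comp; congr (mapf _ c); apply/funext => -[|n s] //.
by rewrite /comp !simps_Sx; congr Sx; apply/funext => x /=; rewrite (rn_id (rn_std _)).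
Qed.

Ltac chain := apply: cf_ext => ?; rewrite !(cfB, cfD, cfN, cfZ, cf0); ring.

Section Good.
Variable T : topologicalType.
Implicit Types (A B : set T) (c : C_ (simp T)).

(** The empty simplex lies in every set, [set0] included. Hence the empty set has nonzero reduced
    homology in degree 0, as befits the sphere of dimension -1. *)
Definition sg A (s : simp T) : Prop := match s with
  | Emp => True
  | Sx n s' => [/\ s' = s' \o @rn n, contOn (stdsimplex n) s' &
                   forall x, stdsimplex n x -> A (s' x)]
  end.
Definition SG A m s := sg A s /\ nv s = m.

Lemma SG_aff (E : normedModType RR) (C : set E) (f : E -> T) A l n :
  cvx C -> contOn C f -> LP C n.+1 l -> (forall y, stdsimplex n y -> A (f (aff l y))) ->
  SG A n.+1 (simpl f l).
Proof.
move=> cC cf Cl fA; rewrite (simplE f Cl.1); split=> //; split.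
- by apply/funext => y /=; rewrite (rn_id (rn_std _)).
- apply: (@contOn_eq _ _ _ (f \o (fun y : 'rV_n.+1 => aff l y))).
    by move=> x hx /=; rewrite rn_id.
  apply: contOn_comp cf _; first exact/contOnT/aff_continuous.
  by move=> x hx; apply: aff_cvx Cl _.
- by move=> x hx; exact/fA/rn_std.
Qed.

Lemma SG_simpl (E : normedModType RR) (C : set E) (f : E -> T) A l m :
  cvx C -> contOn C f -> (forall x, C x -> A (f x)) -> LP C m l ->
  SG A m (simpl f l).
Proof.
move=> cC cf fA; case: m => [|n] Cl; first by rewrite (size0nil Cl.1).
by apply: (SG_aff cC cf Cl) => y hy; apply: fA; exact: aff_cvx Cl hy.
Qed.

Lemma supp_pushl (E : normedModType RR) (C : set E) (f : E -> T) A (c : C_ (seq E)) m :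
  cvx C -> contOn C f -> (forall x, C x -> A (f x)) -> supp (LP C m) c ->
  supp (SG A m) (pushl f c).
Proof. by move=> cC cf fA; apply: supp_mapf => l; apply: SG_simpl. Qed.

Lemma supp_d A m c : supp (SG A m.+1) c -> supp (SG A m) (d c).
Proof.
apply: supp_lin => -[|n s] [[h1 h2 h3] // [<-]] /=; rewrite d_ub /=.
apply: (@supp_pushl _ (stdsimplex n)) => //; first exact: cvx_std.
exact: supp_dlb (LP_std n).
Qed.

Lemma supp_SG A B m c : A `<=` B -> supp (SG A m) c -> supp (SG B m) c.
Proof.
by move=> AB; apply: supp_sub => -[|n s] [] // [h1 h2 h3] h; split=> //; split=> // x /h3 /AB.
Qed.

End Good.

Section GoodPush.
Variables T T' : topologicalType.
Implicit Types (A : set T) (B : set T').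

Lemma supp_pushs A B (g : T -> T') m c : contOn A g -> (forall x, A x -> B (g x)) ->
  supp (SG A m) c -> supp (SG B m) (pushs g c).
Proof.
move=> cg gB; apply: supp_mapf => -[|n s] [] //= [h1 h2 h3] <-.
apply: (@SG_simpl _ _ (stdsimplex n)); [exact: cvx_std| | |exact: LP_std].
- exact: contOn_comp h2 cg h3.
- by move=> x /h3 /gB.
Qed.

Lemma pushs_ext A (g g' : T -> T') m c : (forall x, A x -> g x = g' x) ->
  supp (SG A m) c -> pushs g c = pushs g' c.
Proof.
move=> gg'; apply: (@eq_supp _ _ _ _ (pushs g) (pushs g')) => -[|n s] [h _];
  rewrite /= !pushs_ub //; case: h => h1 h2 h3; congr ub.
rewrite !simps_Sx; congr Sx; apply/funext => x; apply: gg'; apply: h3.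
exact: rn_std.
Qed.
End GoodPush.

Lemma pushs_id (T : topologicalType) (A : set T) (g : T -> T) m c :
  (forall x, A x -> g x = x) -> supp (SG A m) c -> pushs g c = c.
Proof.
move=> gA; apply: mapf_id => -[|n s] [] // [h1 h2 h3] _.
rewrite simps_Sx; congr Sx; apply/funext => x; rewrite gA; last exact/h3/rn_std.
by rewrite [in RHS]h1.
Qed.

(** * Prism operator *)

Section Prism.

(** [RR^o] is the real line as a module over itself, so a prism consists again of lists of points of
    a module and the affine calculus applies to it. *)
Definition atR (E : Type) (t : RR) (x : E) : E * RR^o := (x, t).

(* The alternating sum of the [(x_0,0) .. (x_i,0) (x_i,1) .. (x_n,1)]. *)
Fixpoint prb (E : Type) (l : seq E) : C_ (seq (E * RR^o)) :=
  if l is x :: l' then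
    ub (atR 0 x :: atR 1 x :: map (atR 1) l') - consl (atR 0 x) (prb l')
  else 0.
Definition pr (E : Type) : C_ (seq E) -> C_ (seq (E * RR^o)) := lin (@prb E).
HB.instance Definition _ E := GRing.Linear.on (@pr E).
Arguments pr {E}.

Lemma pr_ub (E : Type) (l : seq E) : pr (ub l) = prb l. Proof. exact: lin_ub. Qed.

Lemma pr_consl (E : Type) (x : E) c :
  pr (consl x c) = consl (atR 0 x) (consl (atR 1 x) (mapl (atR 1) c)) -
    consl (atR 0 x) (pr c).
Proof.
apply: (@eq_FM _ _ _ (pr \o consl x) ((consl (atR 0 x) \o (consl (atR 1 x) \o mapl (atR 1))) \-
  (consl (atR 0 x) \o pr))) => l /=.
by rewrite /consl /mapl !mapf_ub !pr_ub.
Qed.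

Lemma dl_pr (E : Type) (c : C_ (seq E)) :
  dl (pr c) = mapl (atR 1) c - mapl (atR 0) c - pr (dl c).
Proof.
apply: (@eq_FM _ _ _ (dl \o pr) ((mapl (atR 1) \- mapl (atR 0)) \- (pr \o dl))) => l /=.
rewrite pr_ub !dl_ub !mapl_ub; elim: l => [|x l IH] /=.
  by rewrite !raddf0; chain.
rewrite !raddfB /= !dl_ub /= dl_cons IH pr_ub pr_consl /= !raddfB /= -!dl_ub.
rewrite -!dl_mapl !mapl_ub /consl !mapf_ub /= !dl_ub -/(consl _).
chain.
Qed.

Definition gR (E E' : Type) (g : E -> E') (z : E * RR^o) : E' * RR^o := (g z.1, z.2).

Lemma gR_is_linear (E E' : lmodType RR) (g : {linear E -> E'}) : linear (gR g).
Proof. by move=> a x y; rewrite /gR /= linearP. Qed.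
HB.instance Definition _ (E E' : lmodType RR) (g : {linear E -> E'}) :=
  GRing.isLinear.Build RR (E * RR^o)%type (E' * RR^o)%type *:%R (gR g) (gR_is_linear g).

Lemma pr_mapl (E E' : Type) (g : E -> E') c : mapl (gR g) (pr c) = pr (mapl g c).
Proof.
apply: (@eq_FM _ _ _ (mapl (gR g) \o pr) (pr \o mapl g)) => l /=.
rewrite mapl_ub !pr_ub; elim: l => [|x l IH] /=; first by rewrite raddf0.
rewrite raddfB /= mapl_ub mapl_consl IH /=; congr (ub (_ :: _ :: _) - _).
by rewrite -!map_comp.
Qed.

Definition I01 : set RR^o := [set t | 0 <= t <= 1].

Lemma cvx_I01 : cvx I01.
Proof.
rewrite /I01 => x y t /= /andP[x0 x1] /andP[y0 y1] /andP[t0 t1].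
by apply/andP; rewrite /GRing.scale /=; split; nra.
Qed.

Lemma cvx_setX (E E' : lmodType RR) (A : set E) (B : set E') :
  cvx A -> cvx B -> cvx (A `*` B : set (E * E')%type).
Proof.
move=> cA cB [x x'] [y y'] t [/= Ax Bx] [/= Ay By] ht; split => /=.
  exact: (cA x y t).
exact: (cB x' y' t).
Qed.

Lemma supp_prb (E : Type) (C : set E) m l : LP C m l ->
  supp (LP (C `*` I01) m.+1) (prb l).
Proof.
have I0 : I01 0 by rewrite /I01 /= lexx ler01.
have I1 : I01 1 by rewrite /I01 /= lexx ler01.
elim: l m => [|x l IH] m [<-] Cl /=; first exact: supp0.
have Cx : C x by apply: Cl; left.
apply: suppB.
  apply: supp_ub; split; first by rewrite /= size_map.
  move=> y /= [<-//|[<-//|/List.in_map_iff [z [<- hz]]]].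
  by split=> //=; apply: Cl; right.
apply: supp_consl; first by split.
by apply: IH; split=> // y hy; apply: Cl; right.
Qed.

Variables (T T' : Type) (h : T -> RR -> T').

Definition bpr (s : simp T) : C_ (simp T') := match s with
  | Emp => 0
  | Sx n s' => pushl (fun z : ('rV[RR]_n.+1 * RR^o)%type => h (s' z.1) z.2) (prb (std n))
  end.
Definition prism : C_ (simp T) -> C_ (simp T') := lin bpr.
HB.instance Definition _ := GRing.Linear.on prism.

Lemma prism_ub s : prism (ub s) = bpr s. Proof. exact: lin_ub. Qed.

Lemma bpr_simpl (E : lmodType RR) (f : E -> T) l :
  bpr (simpl f l) = pushl (fun z : (E * RR^o)%type => h (f z.1) z.2) (prb l).
Proof.
case sl : (size l) => [|n]; first by rewrite (size0nil sl) raddf0.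
rewrite (simplE f sl) /=.
rewrite (@pushl_comp _ _ _ (gR (aff l (n := n.+1))) (fun z => h (f z.1) z.2) _
   (stdsimplex n `*` I01) n.+2) //.
- by rewrite -[prb (std n)]pr_ub pr_mapl mapl_ub map_aff_std // pr_ub.
- apply: cvx_setX; [exact: cvx_std|exact: cvx_I01].
- by move=> x [hx _]; rewrite rn_id.
- exact: supp_prb (LP_std n).
Qed.

Lemma prism_pushl (E : lmodType RR) (f : E -> T) c :
  prism (pushl f c) = pushl (fun z : (E * RR^o)%type => h (f z.1) z.2) (pr c).
Proof.
apply: (@eq_FM _ _ _ (prism \o pushl f) (pushl _ \o pr)) => l /=.
by rewrite pushl_ub prism_ub pr_ub bpr_simpl.
Qed.

Lemma simpl_atR (E : lmodType RR) (H : E * RR^o -> T') t l :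
  simpl H (map (atR t) l) = simpl (fun x => H (x, t)) l.
Proof.
case sl : (size l) => [|n]; first by rewrite (size0nil sl).
rewrite (simplE _ sl) (@simplE _ _ _ _ n) ?size_map //; congr Sx.
apply/funext => y; congr H.
have [y0 y1] := rn_std y; move: (rn y) y0 y1 => z z0 z1.
(* The weights sum to 1, so an affine combination of points at height [t] is at height [t]. *)
rewrite -[t in RHS]mul1r -z1 mulr_suml [LHS]surjective_pairing; congr pair.
  rewrite /aff (big_morph fst (id1 := 0) (op1 := +%R)) //; apply: eq_bigr => i _.
  by rewrite (nth_map 0) ?sl.
rewrite /aff (big_morph snd (id1 := 0) (op1 := +%R)) //; apply: eq_bigr => i _.
by rewrite (nth_map 0) ?sl.
Qed.

Lemma d_prism c :
  d (prism c) = pushs (h^~ 1) c - pushs (h^~ 0) c - prism (d c).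
Proof.
apply: (@eq_FM _ _ _ (d \o prism) ((pushs (h^~ 1) \- pushs (h^~ 0)) \- (prism \o d))) => s /=.
rewrite prism_ub !pushs_ub d_ub; case: s => [|n s]; first by rewrite !raddf0; chain.
rewrite /= d_pushl prism_pushl -[prb (std n)]pr_ub dl_pr !raddfB /= !mapl_ub !pushl_ub.
by rewrite !simpl_atR dl_ub.
Qed.

End Prism.

Lemma supp_prism (T T' : topologicalType) (A : set T) (B : set T') (h : T -> RR -> T') m c :
  contOn (A `*` I01) (fun z : (T * RR^o)%type => h z.1 z.2) ->
  (forall x t, A x -> I01 t -> B (h x t)) ->
  supp (SG A m) c -> supp (SG B m.+1) (prism h c).
Proof.
move=> ch hB; apply: supp_lin => -[|n s] []; rewrite /= prism_ub.
  by move=> _ _; exact: supp0.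
move=> [h1 h2 h3] <-.
apply: (@supp_pushl _ _ (stdsimplex n `*` I01)).
- apply: cvx_setX; [exact: cvx_std|exact: cvx_I01].
- apply: (@contOn_comp _ _ _ _ (A `*` I01) (fun z => (s z.1, z.2)) (fun z => h z.1 z.2)) => //.
    apply: contOn_pair; last by apply: contOnT => z; exact: cvg_snd.
    apply: (@contOn_comp _ _ _ _ (stdsimplex n) fst s) => //.
      by apply: contOnT => z; exact: cvg_fst.
    by case=> x t [].
  by case=> x t [/= hx ht]; split=> //=; apply: h3.
- by move=> [x t] [/= hx ht]; apply: hB => //; apply: h3.
- exact: supp_prb (LP_std n).
Qed.

(** Degree 0 is included: the empty simplex must be a boundary, which forces [A] to be nonempty. *)
Definition acyc (T : topologicalType) (A : set T) := forall m c,
  supp (SG A m) c -> d c = 0 -> exists2 e, supp (SG A m.+1) e & d e = c.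

Section Contract.
Variable T : topologicalType.

Definition csimp (p : T) m : simp T :=
  if m is n.+1 then Sx (fun _ : 'rV[RR]_n.+1 => p) else Emp.

Arguments csimp : simpl never.

Lemma simpl_cst (E : lmodType RR) (p : T) (l : seq E) :
  simpl (fun=> p) l = csimp p (size l).
Proof. by case: l. Qed.

(** All faces have the same length and their signs alternate, so only the parity of their number
    survives. *)
Lemma size_dlb (E : Type) (l : seq E) :
  mapf size (dlb l) = (if odd (size l) then ub (size l).-1 else 0 : C_ nat).
Proof.
elim: l => [|x l IH] /=; first by rewrite raddf0.
rewrite raddfB /= mapf_ub /consl mapf_comp.
have -> : mapf (size \o cons x) (dlb l) = mapf succn (mapf size (dlb l)).
  by rewrite mapf_comp.
rewrite IH; case: l {IH} => [|y l] /=; first by rewrite raddf0 subr0.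
by case: (odd _) => /=; rewrite ?raddf0 ?addr0 ?mapf_ub ?subrr.
Qed.

Lemma d_csimp (p : T) m : d (ub (csimp p m)) = if odd m then ub (csimp p m.-1) else 0.
Proof.
rewrite d_ub; case: m => [|n] //=.
have e (c : C_ (seq 'rV[RR]_n.+1)) : pushl (fun=> p) c = mapf (csimp p) (mapf size c).
  rewrite mapf_comp /pushl; congr (mapf _ c).
  by apply/funext => l; exact: simpl_cst.
rewrite e size_dlb size_std /=.
by case: (odd n) => /=; rewrite ?raddf0 // mapf_ub.
Qed.

Lemma pushs_cst (A : set T) (p : T) m c : supp (SG A m) c ->
  exists a, pushs (fun=> p) c = a *: ub (csimp p m).
Proof.
move: c; apply: supp_ind => [|a s c [sA <-] [b IH]].
  by exists 0; rewrite raddf0 scale0r.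
exists (a + b); rewrite linearD linearZ /= IH scalerDl pushs_ub; congr (_ *: ub _ + _).
by case: s {sA IH} => // n s; rewrite simps_Sx.
Qed.

Lemma SG_csimp (A : set T) (p : T) m : A p -> SG A m (csimp p m).
Proof.
case: m => [|m] Ap; split=> //; split=> //.
by move=> x _ U Up; apply: filterE => y _; exact: nbhs_singleton.
Qed.

(** The prism on the contraction bounds [c] up to a multiple of the constant simplex with [m]
    vertices. For odd [m] that simplex is not a cycle, so the multiple is 0; for even [m] it is the
    boundary of the constant simplex with one more vertex. *)
Lemma contract (A : set T) (h : T -> RR -> T) (p : T) :
  contOn (A `*` I01) (fun z : (T * RR^o)%type => h z.1 z.2) ->
  (forall x t, A x -> I01 t -> A (h x t)) ->
  (forall x, A x -> h x 0 = x) -> (forall x, A x -> h x 1 = p) -> A p -> acyc A.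
Proof.
move=> ch hA h0 h1 Ap m c cA dc.
have eA := supp_prism ch hA cA.
have de : d (prism h c) = pushs (fun=> p) c - c.
  rewrite d_prism dc raddf0 subr0 (pushs_id h0 cA); congr (_ - _).
  exact: pushs_ext h1 cA.
have [a ea] := pushs_cst p cA; rewrite ea in de.
have da : d (a *: ub (csimp p m)) = 0 by rewrite -ea d_pushs dc raddf0.
have [om|em] := boolP (odd m).
  exists (- prism h c).
    exact: suppN eA.
  rewrite raddfN /= de; move: da; rewrite linearZ /= d_csimp om => da.
  by rewrite (scale_ub_eq0 da) scale0r; chain.
exists (a *: ub (csimp p m.+1) - prism h c).
  by apply: suppB eA; apply: suppZ; apply: supp_ub; exact: SG_csimp.
rewrite raddfB /= de linearZ /= d_csimp /= em; chain.
Qed.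

End Contract.

(** * Barycentric subdivision and excision *)

Section Barycentric.
Variable E : lmodType RR.
Implicit Types (l : seq E).

Definition bar l : E := (size l)%:R^-1 *: \sum_(x <- l) x.

(** The recursive calls are on faces of [l], which occur inside a chain and are no structural
    subterms; a counter, set to the length in [sdb], carries the recursion. *)
Fixpoint sdn n l : C_ (seq E) :=
  if n is n'.+1 then consl (bar l) (lin (sdn n') (dlb l)) else ub l.
Definition sdb l := sdn (size l) l.
Definition sd : C_ (seq E) -> C_ (seq E) := lin sdb.
HB.instance Definition _ := GRing.Linear.on sd.

(** The cone from the barycentre over [l] minus the homotopy already built on its boundary; with
    this choice [dl_td] comes out of the cone formula. *)
Fixpoint tdn n l : C_ (seq E) :=
  if n is n'.+1 then consl (bar l) (ub l - lin (tdn n') (dlb l)) else 0.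
Definition tdb l := tdn (size l) l.
Definition td : C_ (seq E) -> C_ (seq E) := lin tdb.
HB.instance Definition _ := GRing.Linear.on td.

Lemma sd_ub l : sd (ub l) = sdb l. Proof. exact: lin_ub. Qed.
Lemma td_ub l : td (ub l) = tdb l. Proof. exact: lin_ub. Qed.

Lemma LP_dlb n l : size l = n.+1 -> supp (LP (fun x => List.In x l) n) (dlb l).
Proof. by move=> sl; apply: supp_dlb. Qed.

Lemma sdbS n l : size l = n.+1 -> sdb l = consl (bar l) (sd (dlb l)).
Proof.
move=> sl; rewrite /sdb sl /=; congr consl.
apply: (@eq_supp _ _ _ _ (lin (sdn n)) sd _ _ (LP_dlb sl)) => l' [sl' _] /=.
by rewrite lin_ub sd_ub /sdb sl'.
Qed.

Lemma tdbS n l : size l = n.+1 -> tdb l = consl (bar l) (ub l - td (dlb l)).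
Proof.
move=> sl; rewrite /tdb sl /=; congr (consl _ (_ - _)).
apply: (@eq_supp _ _ _ _ (lin (tdn n)) td _ _ (LP_dlb sl)) => l' [sl' _] /=.
by rewrite lin_ub td_ub /tdb sl'.
Qed.

Lemma dl_sd c : dl (sd c) = sd (dl c).
Proof.
apply: (@eq_FM _ _ _ (dl \o sd) (sd \o dl)) => l /=.
have [n] := ubnP (size l); elim: n l => // n IH l hl.
rewrite sd_ub dl_ub; case sl: (size l) => [|m].
  by rewrite (size0nil sl) /sdb /= dl_ub raddf0.
rewrite (sdbS sl) dl_cons.
(* By induction on the faces the subdivided boundary is a cycle, so the second term of the cone
   formula vanishes. *)
have -> : dl (sd (dlb l)) = 0; last by rewrite raddf0 subr0.
have -> : dl (sd (dlb l)) = sd (dl (dlb l)).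
  apply: (@eq_supp _ _ _ _ (dl \o sd) (sd \o dl) _ _ (LP_dlb sl)) => l' [sl' _] /=.
  by apply: IH; rewrite sl'; move: hl; rewrite sl.
by rewrite -dl_ub dldl raddf0.
Qed.

Lemma dl_td c : dl (td c) = c - sd c - td (dl c).
Proof.
apply: (@eq_FM _ _ _ (dl \o td) ((idfun \- sd) \- (td \o dl))) => l /=.
have [n] := ubnP (size l); elim: n l => // n IH l hl.
rewrite td_ub sd_ub dl_ub; case sl: (size l) => [|m].
  by rewrite (size0nil sl) /tdb /sdb /= !raddf0; chain.
rewrite (sdbS sl) (tdbS sl) dl_cons raddfB /= dl_ub.
have -> : dl (td (dlb l)) = dlb l - sd (dlb l) - td (dl (dlb l)).
  apply: (@eq_supp _ _ _ _ (dl \o td) ((idfun \- sd) \- (td \o dl)) _ _ (LP_dlb sl)) => l' [sl' _] /=.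
  by apply: IH; rewrite sl'; move: hl; rewrite sl.
have -> : dl (dlb l) = 0 by rewrite -dl_ub dldl.
rewrite raddf0.
have -> : dlb l - (dlb l - sd (dlb l) - 0) = sd (dlb l) by chain.
by chain.
Qed.

Lemma bar_cvx (C : set E) m l : cvx C -> LP C m.+1 l -> C (bar l).
Proof.
move=> cC [sl Cl]; rewrite /bar sl (big_nth 0) sl big_mkord scaler_sumr.
apply: (cvx_sum cC (w := fun=> m.+1%:R^-1)).
- by move=> i; rewrite invr_ge0.
- by rewrite sumr_const card_ord -(mulr_natr m.+1%:R^-1) mulVf ?pnatr_eq0.
- by move=> i; apply: Cl; apply: In_nth; rewrite sl.
Qed.

Lemma supp_sdb (C : set E) m l : cvx C -> LP C m l -> supp (LP C m) (sdb l).
Proof.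
move=> cC; elim: m l => [|m IH] l Cl.
  by rewrite (size0nil Cl.1); apply: supp_ub.
rewrite (sdbS Cl.1); apply: supp_consl; first exact: bar_cvx Cl.
by apply: (@supp_lin _ _ _ (LP C m) _ sd) (supp_dlb Cl) => l' /IH; rewrite /= sd_ub.
Qed.

Lemma supp_tdb (C : set E) m l : cvx C -> LP C m l -> supp (LP C m.+1) (tdb l).
Proof.
move=> cC; elim: m l => [|m IH] l Cl.
  by rewrite (size0nil Cl.1); exact: supp0.
rewrite (tdbS Cl.1); apply: supp_consl; first exact: bar_cvx Cl.
apply: suppB; first exact: supp_ub.
by apply: (@supp_lin _ _ _ (LP C m) _ td) (supp_dlb Cl) => l' /IH; rewrite /= td_ub.
Qed.

End Barycentric.
Arguments sd {E}. Arguments td {E}.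

Lemma bar_map (E E' : lmodType RR) (g : {linear E -> E'}) l : g (bar l) = bar (map g l).
Proof. by rewrite /bar linearZ /= raddf_sum size_map big_map. Qed.

Lemma mapl_sd (E E' : lmodType RR) (g : {linear E -> E'}) c :
  mapl g (sd c) = sd (mapl g c).
Proof.
apply: (@eq_FM _ _ _ (mapl g \o sd) (sd \o mapl g)) => l /=.
have [n] := ubnP (size l); elim: n l => // n IH l hl.
rewrite mapl_ub !sd_ub; case sl: (size l) => [|m].
  by rewrite (size0nil sl) /sdb /= mapl_ub.
rewrite (sdbS sl) (@sdbS _ m) ?size_map // mapl_consl bar_map; congr consl.
rewrite -[dlb (map g l)]dl_ub -mapl_ub dl_mapl dl_ub.
apply: (@eq_supp _ _ _ _ (mapl g \o sd) (sd \o mapl g) _ _ (LP_dlb sl)) => l' [sl' _] /=.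
by apply: IH; rewrite sl'; move: hl; rewrite sl.
Qed.

Lemma mapl_td (E E' : lmodType RR) (g : {linear E -> E'}) c :
  mapl g (td c) = td (mapl g c).
Proof.
apply: (@eq_FM _ _ _ (mapl g \o td) (td \o mapl g)) => l /=.
have [n] := ubnP (size l); elim: n l => // n IH l hl.
rewrite mapl_ub !td_ub; case sl: (size l) => [|m].
  by rewrite (size0nil sl) /tdb /= raddf0.
rewrite (tdbS sl) (@tdbS _ m) ?size_map // mapl_consl bar_map; congr consl.
rewrite raddfB /= mapl_ub -[dlb (map g l)]dl_ub -mapl_ub dl_mapl dl_ub; congr (_ - _).
apply: (@eq_supp _ _ _ _ (mapl g \o td) (td \o mapl g) _ _ (LP_dlb sl)) => l' [sl' _] /=.
by apply: IH; rewrite sl'; move: hl; rewrite sl.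
Qed.

Lemma In_nthE (K : Type) (x0 : K) l x : List.In x l -> exists2 i, (i < size l)%N & nth x0 l i = x.
Proof.
elim: l => //= y l IH [->|/IH [i hi e]]; first by exists 0%N.
by exists i.+1.
Qed.

Section Mesh.
Variable E : normedModType RR.
Implicit Types (l : seq E).

Definition mesh (r : RR) l := forall x y, List.In x l -> List.In y l -> `|x - y| <= r.

(** The factor by which barycentric subdivision reduces the mesh in dimension at most [N]. The bound
    [N] is kept fixed while the induction in [mesh_sdb] descends to faces. *)
Definition shrink (N : nat) : RR := N%:R / N.+1%:R.

Lemma shrink_ge0 N : 0 <= shrink N. Proof. by rewrite /shrink divr_ge0. Qed.

Lemma cvx_ball (x : E) r : cvx [set y | `|x - y| <= r].
Proof.
move=> y z t /= hy hz /andP[t0 t1].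
have -> : x - ((1 - t) *: y + t *: z) = (1 - t) *: (x - y) + t *: (x - z).
  by rewrite !scalerBr addrACA -scalerDl subrK scale1r opprD.
apply: le_trans (ler_normD _ _) _; rewrite !normrZ ger0_norm ?subr_ge0 // ger0_norm //.
by nra.
Qed.

(** [bar l - x] is the average of the [n.+1] differences between vertices and [x], one of which is
    zero; whence [n] over [n.+1]. *)
Lemma bar_dist N n l r x : 0 <= r -> (n <= N)%N -> size l = n.+1 -> mesh r l ->
  List.In x l -> `|bar l - x| <= shrink N * r.
Proof.
move=> r0 nN sl hl xl.
have [i hi ix] := In_nthE 0 xl; rewrite sl in hi.
have -> : bar l - x = n.+1%:R^-1 *: \sum_(j < n.+1) (nth 0 l j - x).
  rewrite sumrB scalerBr sumr_const card_ord /bar sl (big_nth 0) sl big_mkord.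
  by congr (_ - _); rewrite -[x *+ _]scaler_nat scalerA mulVf ?pnatr_eq0 // scale1r.
rewrite normrZ ger0_norm ?invr_ge0 //.
have h : `|\sum_(j < n.+1) (nth 0 l j - x)| <= n%:R * r.
  apply: le_trans (ler_norm_sum _ _ _) _.
  rewrite (bigD1 (Ordinal hi)) //= ix subrr normr0 add0r.
  apply: le_trans (ler_sum (G := fun=> r) _ _) _.
    by move=> j _; apply: hl => //; apply: In_nth; rewrite sl.
  by rewrite sumr_const cardC1 card_ord mulr_natl.
apply: le_trans (ler_wpM2l _ h) _; first by rewrite invr_ge0.
rewrite mulrA; apply: ler_wpM2r => //.
rewrite /shrink mulrC ler_pdivrMr ?ltr0n // mulrAC ler_pdivlMr ?ltr0n //.
by rewrite -!natrM ler_nat; nia.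
Qed.

Lemma mesh_sdb N m l r : 0 <= r -> (m <= N.+1)%N -> size l = m -> mesh r l ->
  supp (mesh (shrink N * r)) (sdb l).
Proof.
move=> r0; elim: m l => [|n IH] l mN sl hl.
  by rewrite (size0nil sl); apply: supp_ub.
rewrite (sdbS sl).
pose C := [set y | `|bar l - y| <= shrink N * r].
(* This ball is convex and contains the vertices of [l], so it contains those of the subdivided
   faces; it bounds the edges that end in the barycentre. *)
have hC : LP C n.+1 l by split=> // y yl; exact: (@bar_dist N n l r y).
have h1 : supp (LP C n) (sd (dlb l)).
  apply: (@supp_lin _ _ _ (LP C n) _ sd) (supp_dlb hC) => l' hl' /=; rewrite sd_ub.
  exact: supp_sdb (@cvx_ball _ _) hl'.
have h2 : supp (mesh (shrink N * r)) (sd (dlb l)).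
  apply: (@supp_lin _ _ _ _ _ sd) (LP_dlb sl) => l' [sl' hl'] /=; rewrite sd_ub.
  apply: IH => //; first exact: ltnW.
  by move=> x y /hl' xl /hl' yl; apply: hl.
move: (suppI h1 h2); apply: supp_mapf => l' [[_ hl'] ml'] x y /= [<-|xl'] [<-|yl'].
- by rewrite subrr normr0 mulr_ge0 ?shrink_ge0.
- exact: hl'.
- by rewrite distrC; apply: hl'.
- exact: ml'.
Qed.

Lemma iter_sd (C : set E) N k l r : cvx C -> 0 <= r -> LP C N.+1 l -> mesh r l ->
  supp (fun l' => LP C N.+1 l' /\ mesh (shrink N ^+ k * r) l') (iter k sd (ub l)).
Proof.
move=> cC r0 Cl hl; elim: k => [|k IH] /=.
  by rewrite expr0 mul1r; apply: supp_ub.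
apply: (@supp_lin _ _ _ _ _ sd) IH => l' [Cl' hl'] /=; rewrite sd_ub.
apply: suppI; first exact: supp_sdb Cl'.
rewrite exprS -mulrA; apply: (@mesh_sdb _ N.+1) => //; last by case: Cl'.
by rewrite mulr_ge0 ?exprn_ge0 ?shrink_ge0.
Qed.

Lemma iter_sd_small (C : set E) N l (e : RR) : cvx C -> LP C N.+1 l -> 0 < e ->
  exists k, supp (fun l' => LP C N.+1 l' /\ mesh e l') (iter k sd (ub l)).
Proof.
move=> cC Cl e0.
have [M M0 hM] : exists2 M : RR, 0 <= M & forall y, List.In y l -> `|y| <= M.
  elim: (l) => [|z l' [M M0 IH]]; first by exists 0.
  exists (Num.max M `|z|); first by rewrite le_max M0.
  by move=> y /= [<-|/IH h]; rewrite le_max ?lexx ?orbT // h.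
have hr : mesh (M + M) l.
  move=> x y hx hy; apply: le_trans (ler_normB _ _) _.
  by apply: lerD; apply: hM.
have r0 : 0 <= M + M by rewrite addr_ge0.
have hs : `|shrink N| < 1.
  rewrite ger0_norm ?shrink_ge0 // /shrink ltr_pdivrMr ?ltr0n // mul1r ltr_nat //.
have /cvgr0Pnorm_lt /(_ _ e0) [k _ hk] := cvg_geometric (M + M) hs.
exists k; move: (iter_sd (k := k) cC r0 Cl hr); apply: supp_sub => l' [? h]; split=> // x y hx hy.
apply: le_trans (h _ _ hx hy) _; move: (hk k (leqnn k)); rewrite /geometric /=.
rewrite ger0_norm; first by rewrite mulrC => /ltW.
by rewrite mulr_ge0 ?exprn_ge0 ?shrink_ge0.
Qed.
End Mesh.

Section Lebesgue.
Variable T : topologicalType.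

Lemma std_compact n : compact (stdsimplex n).
Proof.
have cS : closed (stdsimplex n).
  have -> : stdsimplex n = (\bigcap_(i in [set: 'I_n.+1])
       [set x : 'rV[RR]_n.+1 | 0 <= x ord0 i]) `&` [set x | aff (nseq n.+1 (1 : RR^o)) x = 1].
    have e (x : 'rV[RR]_n.+1) : aff (nseq n.+1 (1 : RR^o)) x = \sum_i x ord0 i :> RR.
      apply: eq_bigr => i _; have -> : nth 0 (nseq n.+1 (1 : RR^o)) i = 1.
        by rewrite nth_nseq ltn_ord.
      by rewrite /GRing.scale /= mulr1.
    apply/seteqP; split=> x [h0 h1]; split; rewrite /= ?e //.
    - by move=> i _; exact: h0.
    - by move=> i; exact: (h0 i I).
    - by rewrite -e.
  apply: closedI.
    apply: closed_bigI => i _.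
    apply: (@closed_comp _ _ (fun x : 'rV[RR]_n.+1 => x ord0 i) [set y | 0 <= y]).
      by move=> x _; exact: coord_continuous.
    exact: closed_ge.
  apply: (@closed_comp _ _ (fun x : 'rV[RR]_n.+1 => aff (nseq n.+1 (1 : RR^o)) x) [set y | y = 1]).
    by move=> x _; exact: aff_continuous.
  exact: closed_eq.
apply: (subclosed_compact cS (@rV_compact _ n.+1 (fun=> `[(0 : RR), 1]%classic) _)).
  by move=> _; exact: segment_compact.
move=> x [x0 x1] j; rewrite /= in_itv /= x0 /= -x1 (bigD1 j) //= lerDl.
exact: sumr_ge0.
Qed.

(** The Lebesgue number of the cover of the simplex by the preimages of the complements of [A] and
    [B]: a set of diameter at most [e] meets at most one of the two preimages of [A] and [B]. *)
Lemma lebesgue n (s : 'rV[RR]_n.+1 -> T) (A B : set T) : closed A -> closed B ->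
  contOn (stdsimplex n) s -> (forall x, stdsimplex n x -> A (s x) -> B (s x) -> False) ->
  exists2 e : RR, 0 < e & forall x y, stdsimplex n x -> stdsimplex n y ->
    `|x - y| <= e -> A (s x) -> B (s y) -> False.
Proof.
move=> cA cB cs hAB.
have far (D : set T) x : closed D -> stdsimplex n x -> ~ D (s x) ->
    nbhs x [set y | stdsimplex n y -> ~ D (s y)].
  move=> cD hx nD; apply: (cs _ hx (~` D)); apply: open_nbhs_nbhs; split=> //.
  exact: closed_openC.
have /compact_near_coveringP/near_covering_withinP := @std_compact n.
move=> /(_ _ (0^'+ : set_system RR) (fun e x => forall y, stdsimplex n y ->
    `|x - y| <= e -> A (s x) -> B (s y) -> False) _) [].
  move=> x hx; have [Ax|nAx] := pselect (A (s x)); last first.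
    have h := far A x cA hx nAx.
    exists ([set y | stdsimplex n y -> ~ A (s y)], setT) => /=.
      by split=> //; exact: filterT.
    by move=> [y e] /= [hy _] Dy z _ _ Ay _; exact: hy.
  have nB : ~ B (s x) by move=> Bx; exact: (hAB x).
  have /nbhs_ballP [e /= e0 he] := far B x cB hx nB.
  (* One half is spent on the distance from [x] to [y], the other on that from [y] to [z]. *)
  exists (ball x (e / 2), [set t | t < e / 2]) => /=.
    split; first by apply: nbhsx_ballx; rewrite divr_gt0.
    by apply: nbhs_right_lt; rewrite divr_gt0.
  move=> [y t] /= [hy ht] Dy z Dz yz _; apply: he => //.
  apply: (@ball_splitr _ _ y); first exact: ball_sym.
  rewrite -ball_normE /= ; exact: le_lt_trans yz ht.
move=> e e0 he; exists (e / 2); first by rewrite divr_gt0.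
move=> x y hx hy xy; apply: (he (e / 2)) => //=; last by rewrite divr_gt0.
by rewrite sub0r normrN ger0_norm ?divr_ge0 ?ltW // ltr_pdivrMr // mulr_natr mulr2n ltrDl.
Qed.
End Lebesgue.

Section Subdivision.
Variable T : Type.
Implicit Types (c : C_ (simp T)).

Definition Sdb (s : simp T) : C_ (simp T) :=
  match s with Emp => ub Emp | Sx n s' => pushl s' (sdb (std n)) end.
Definition Sd : C_ (simp T) -> C_ (simp T) := lin Sdb.
HB.instance Definition _ := GRing.Linear.on Sd.
Definition Tdb (s : simp T) : C_ (simp T) :=
  match s with Emp => 0 | Sx n s' => pushl s' (tdb (std n)) end.
Definition Td : C_ (simp T) -> C_ (simp T) := lin Tdb.
HB.instance Definition _ := GRing.Linear.on Td.

Lemma Sd_ub s : Sd (ub s) = Sdb s. Proof. exact: lin_ub. Qed.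
Lemma Td_ub s : Td (ub s) = Tdb s. Proof. exact: lin_ub. Qed.

Lemma Sd_pushl (E : lmodType RR) (f : E -> T) (c : C_ (seq E)) : Sd (pushl f c) = pushl f (sd c).
Proof.
apply: (@eq_FM _ _ _ (Sd \o pushl f) (pushl f \o sd)) => l /=.
rewrite pushl_ub Sd_ub sd_ub; case sl : (size l) => [|n].
  by rewrite (size0nil sl) /sdb /= pushl_ub.
rewrite (simplE f sl) /=.
rewrite (@pushl_comp _ _ _ (aff l (n := n.+1)) f _ (stdsimplex n) n.+1) //.
- by rewrite -[sdb (std n)]sd_ub mapl_sd mapl_ub map_aff_std // sd_ub.
- exact: cvx_std.
- by move=> x hx; rewrite rn_id.
- by apply: supp_sdb (LP_std n); exact: cvx_std.
Qed.

Lemma Td_pushl (E : lmodType RR) (f : E -> T) (c : C_ (seq E)) : Td (pushl f c) = pushl f (td c).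
Proof.
apply: (@eq_FM _ _ _ (Td \o pushl f) (pushl f \o td)) => l /=.
rewrite pushl_ub Td_ub td_ub; case sl : (size l) => [|n].
  by rewrite (size0nil sl) /tdb /= raddf0.
rewrite (simplE f sl) /=.
rewrite (@pushl_comp _ _ _ (aff l (n := n.+1)) f _ (stdsimplex n) n.+2) //.
- by rewrite -[tdb (std n)]td_ub mapl_td mapl_ub map_aff_std // td_ub.
- exact: cvx_std.
- by move=> x hx; rewrite rn_id.
- by apply: supp_tdb (LP_std n); exact: cvx_std.
Qed.

Lemma d_Sd c : d (Sd c) = Sd (d c).
Proof.
apply: (@eq_FM _ _ _ (d \o Sd) (Sd \o d)) => s /=; rewrite Sd_ub d_ub.
case: s => [|n s] /=; first by rewrite d_ub raddf0.
by rewrite d_pushl Sd_pushl -sd_ub dl_sd dl_ub.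
Qed.

End Subdivision.
Arguments Sd {T}. Arguments Td {T}.

Section Small.
Variable T : topologicalType.
Implicit Types (X A B : set T) (c : C_ (simp T)).

Lemma sg_ub X n (s : 'rV[RR]_n.+1 -> T) : sg X (Sx s) -> ub (Sx s) = pushl s (ub (std n)) :> C_ _.
Proof.
case=> h _ _; rewrite pushl_ub (simplE _ (size_std n)) /=; congr (ub (Sx _)).
by rewrite [LHS]h; apply/funext => x /=; rewrite aff_std.
Qed.

(** Unlike [d_Sd] this needs normalised simplices: [c] itself occurs on the right, and [Sx s] is the
    affine simplex on the standard vertices only if [s] factors through [rn]. *)
Lemma d_Td X m c : supp (SG X m) c -> d (Td c) = c - Sd c - Td (d c).
Proof.
apply: (@eq_supp _ _ _ _ (d \o Td) ((idfun \- Sd) \- (Td \o d))) => s [hs _] /=.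
rewrite Td_ub Sd_ub d_ub; case: s hs => [|n s] hs; first by rewrite /= !raddf0; chain.
rewrite (sg_ub hs) /= d_pushl Td_pushl -[tdb _]td_ub dl_td !raddfB /=.
by rewrite sd_ub dl_ub.
Qed.

Lemma supp_Sd X m c : supp (SG X m) c -> supp (SG X m) (Sd c).
Proof.
apply: supp_lin => -[|n s] []; rewrite /= Sd_ub.
  by move=> _ <-; exact: supp_ub.
move=> [h1 h2 h3] <- /=; apply: (@supp_pushl _ _ (stdsimplex n)) => //; first exact: cvx_std.
by apply: supp_sdb (LP_std n); exact: cvx_std.
Qed.

Lemma supp_Td X m c : supp (SG X m) c -> supp (SG X m.+1) (Td c).
Proof.
apply: supp_lin => -[|n s] []; rewrite /= Td_ub.
  by move=> _ _; exact: supp0.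
move=> [h1 h2 h3] <- /=; apply: (@supp_pushl _ _ (stdsimplex n)) => //; first exact: cvx_std.
by apply: supp_tdb (LP_std n); exact: cvx_std.
Qed.

(** The homotopies of successive subdivisions telescope to one from the identity to the [k]-fold
    subdivision, see [d_Tk]. *)
Definition Tk k c := \sum_(i < k) Td (iter i Sd c).

Lemma supp_Sdk X m k c : supp (SG X m) c -> supp (SG X m) (iter k Sd c).
Proof. by move=> h; elim: k => //= k; exact: supp_Sd. Qed.

Lemma supp_Tk X m k c : supp (SG X m) c -> supp (SG X m.+1) (Tk k c).
Proof. by move=> h; apply: supp_sum => i _; apply/supp_Td/supp_Sdk. Qed.

Lemma d_Sdk k c : d (iter k Sd c) = iter k Sd (d c).
Proof. by elim: k => //= k IH; rewrite d_Sd IH. Qed.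

Lemma d_Tk X m k c : supp (SG X m) c ->
  d (Tk k c) = c - iter k Sd c - Tk k (d c).
Proof.
move=> h; elim: k => [|k IH]; first by rewrite /Tk !big_ord0 raddf0 /=; chain.
move: IH; rewrite /Tk !big_ord_recr /= raddfD /= => ->.
by rewrite (d_Td (supp_Sdk (k := k) h)) d_Sdk; chain.
Qed.

Lemma Sdk0 k : iter k Sd (0 : C_ (simp T)) = 0.
Proof. by elim: k => //= k ->; rewrite raddf0. Qed.
Lemma SdkD k c c' : iter k Sd (c + c') = iter k Sd c + iter k Sd c'.
Proof. by elim: k => //= k ->; rewrite raddfD. Qed.
Lemma SdkN k c : iter k Sd (- c) = - iter k Sd c.
Proof. by elim: k => //= k ->; rewrite raddfN. Qed.
Lemma SdkZ k a c : iter k Sd (a *: c) = a *: iter k Sd c.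
Proof. by elim: k => //= k ->; rewrite linearZ. Qed.

Definition small X A B m s := SG (X `\` A) m s \/ SG (X `\` B) m s.

Lemma supp_small_Sdk X A B m k c :
  supp (small X A B m) c -> supp (small X A B m) (iter k Sd c).
Proof.
move=> h; elim: k => //= k; apply: supp_lin => s [hs|hs] /=.
  apply: (@supp_sub _ _ (SG (X `\` A) m)); first by left.
  by apply: supp_Sd; apply: supp_ub.
apply: (@supp_sub _ _ (SG (X `\` B) m)); first by right.
by apply: supp_Sd; apply: supp_ub.
Qed.

Lemma Sdk_pushl (E : lmodType RR) (f : E -> T) k (c : C_ (seq E)) :
  iter k Sd (pushl f c) = pushl f (iter k sd c).
Proof. by elim: k => //= k ->; rewrite Sd_pushl. Qed.

Lemma supp_small X A B m c : closed A -> closed B ->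
  (forall x, X x -> A x -> B x -> False) -> supp (SG X m) c ->
  exists k, supp (small X A B m) (iter k Sd c).
Proof.
move=> cA cB hAB; move: c; apply: supp_ind => [|a s c hs [k IH]].
  by exists 0%N; exact: supp0.
have [k' hk'] : exists k, supp (small X A B m) (iter k Sd (ub s)).
  clear k IH; case: s hs => [|n s] [hs <-].
    by exists 0%N; apply: supp_ub; left; split.
  have [h1 h2 h3] := hs.
  have [e e0 he] := lebesgue cA cB h2 (fun x hx => hAB _ (h3 x hx)).
  have [k hk] := iter_sd_small (@cvx_std n) (LP_std n) e0.
  exists k; rewrite (sg_ub hs) Sdk_pushl; move: hk; apply: supp_mapf => l [Cl ml].
  (* The diameter of an affine simplex is attained at vertices: balls being convex, first one point
     and then the other is replaced by vertices. *)
  have near x y : stdsimplex n x -> stdsimplex n y -> `|aff l x - aff l y| <= e.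
    move=> hx hy.
    apply: (aff_cvx (C := [set z | `|aff l x - z| <= e]) _ _ hy).
      exact: cvx_ball.
    split=> [|z zl /=]; first by case: Cl.
    rewrite distrC.
    apply: (aff_cvx (C := [set w | `|z - w| <= e]) _ _ hx).
      exact: cvx_ball.
    by split=> [|w wl /=]; [case: Cl|apply: ml].
  have lh y : stdsimplex n y -> stdsimplex n (aff l y).
    by move=> hy; apply: aff_cvx Cl hy; exact: cvx_std.
  (* A simplex that meets [A] anywhere misses [B] entirely, by the choice of [e]. *)
  have [[x hx Ax]|nA] := pselect (exists2 x, stdsimplex n x & A (s (aff l x))).
    right; apply: (SG_aff (@cvx_std n) h2 Cl) => y hy; split; first exact/h3/lh.
    by apply: (he _ _ _ _ (near _ _ hx hy)) => //; exact: lh.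
  left; apply: (SG_aff (@cvx_std n) h2 Cl) => y hy; split; first exact/h3/lh.
  by move=> Ay; apply: nA; exists y.
(* Smallness survives further subdivision, so one exponent serves both parts. *)
exists (k + k')%N; rewrite SdkD SdkZ; apply: suppD.
  by apply: suppZ; rewrite iterD; exact: supp_small_Sdk.
by rewrite addnC iterD; exact: supp_small_Sdk.
Qed.

Lemma excision X A B m c : closed A -> closed B ->
  (forall x, X x -> A x -> B x -> False) -> supp (SG X m) c ->
  exists k c1 c2, [/\ iter k Sd c = c1 + c2, supp (SG (X `\` A) m) c1 &
    supp (SG (X `\` B) m) c2].
Proof.
move=> cA cB hAB hc; have [k hk] := supp_small cA cB hAB hc.
exists k, (restr (SG (X `\` A) m) (iter k Sd c)),
  (iter k Sd c - restr (SG (X `\` A) m) (iter k Sd c)); split.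
- by rewrite addrC subrK.
- exact: supp_restrl.
- by move: (@supp_restrC _ _ (SG (X `\` A) m) _ _ hk); apply: supp_sub => s [h []].
Qed.

End Small.

(** * Homology of spheres and disks *)

Section MayerVietoris.
Variable T : topologicalType.
Implicit Types (X A B : set T).

Lemma SG_meet A B W m (c : C_ (simp T)) : (forall x, A x -> B x -> W x) ->
  supp (SG A m) c -> supp (SG B m) c -> supp (SG W m) c.
Proof.
move=> h hA hB; move: (suppI hA hB); apply: supp_sub => -[|n s] [[s1 n1] [s2 _]] //.
case: s1 s2 => ? ? h1 [? ? h2]; split=> //; split=> // x hx.
by apply: h; [apply: h1|apply: h2].
Qed.

(* [A] has the reduced homology of the [(n-1)]-sphere, with fundamental class [z]. *)
Record hsph A n (z : C_ (simp T)) : Prop := Hsph {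
  hsph_supp : supp (SG A n) z;
  hsph_d : d z = 0;
  hsph_gen : forall m c, supp (SG A m) c -> d c = 0 -> exists a u,
    [/\ supp (SG A m.+1) u, c = a *: z + d u & m <> n -> a = 0];
  hsph_free : forall a u, supp (SG A n.+1) u -> a *: z = d u -> a = 0 }.

(** A suspension: [X] is covered by two acyclic, relatively open pieces that meet in [W]. The new
    class is the difference of the fillings of [z] in the two pieces, and the boundary of one half
    of a subdivided cycle plays the connecting map. *)
Lemma mayer_vietoris X A B W n z : closed A -> closed B ->
  (forall x, X x -> A x -> B x -> False) ->
  (forall x, W x <-> [/\ X x, ~ A x & ~ B x]) ->
  acyc (X `\` A) -> acyc (X `\` B) -> hsph W n z ->
  exists z', hsph X n.+1 z'.
Proof.
move=> cA cB hAB hW aA aB [zW dz gen free].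
have WA : W `<=` X `\` A by move=> x /hW [].
have WB : W `<=` X `\` B by move=> x /hW [].
have meetW m (c : C_ (simp T)) : supp (SG (X `\` A) m) c -> supp (SG (X `\` B) m) c ->
    supp (SG W m) c.
  by apply: SG_meet => x [Xx nA] [_ nB]; apply/hW.
have AX m (c : C_ (simp T)) : supp (SG (X `\` A) m) c -> supp (SG X m) c.
  by apply: supp_SG => x [].
have BX m (c : C_ (simp T)) : supp (SG (X `\` B) m) c -> supp (SG X m) c.
  by apply: supp_SG => x [].
have [y1 y1A dy1] := aA _ _ (supp_SG WA zW) dz.
have [y2 y2B dy2] := aB _ _ (supp_SG WB zW) dz.
exists (y1 - y2); split.
- by apply: suppB; [apply: AX|apply: BX].
- by rewrite raddfB /= dy1 dy2 subrr.
- move=> [|m] c hc dc.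
    have hc' : supp (SG (X `\` A) 0) c.
      by move: hc; apply: supp_sub => -[|k s] [].
    have [e he de] := aA _ _ hc' dc.
    by exists 0, e; split=> //; [apply: AX|rewrite scale0r add0r].
  have [k [c1 [c2 [ec h1 h2]]]] := excision cA cB hAB hc.
  have dc12 : d c1 = - d c2.
    by apply/eqP; rewrite -addr_eq0 -raddfD /= -ec d_Sdk dc Sdk0.
  have dc1W : supp (SG W m) (d c1).
    by apply: meetW; [exact: supp_d h1|rewrite dc12; apply: suppN; exact: supp_d h2].
  have [a [u [uW eu ha]]] := gen _ _ dc1W (dd _).
  (* Outside degree [n] the coefficient is 0, so [a *: y] may be regarded as a chain of any
     degree. *)
  have sc m' (y : C_ (simp T)) Y : supp (SG Y n.+1) y -> m' = m -> supp (SG Y m'.+1) (a *: y).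
    move=> hy ->; have [mn|/ha ->] := pselect (m = n); last by rewrite scale0r; exact: supp0.
    by apply: suppZ; rewrite mn.
  (* Subtracting [a *: y1] and the bounding chain [u] turns [c1] into a cycle of its acyclic piece;
     [c2] is treated with the opposite signs. *)
  have [w1 w1A dw1] : exists2 e, supp (SG (X `\` A) m.+2) e & d e = c1 - a *: y1 - u.
    apply: aA; first by apply: suppB; [apply: suppB => //; apply: sc|exact: supp_SG WA uW].
    by rewrite !raddfB /= linearZ /= dy1 eu; chain.
  have [w2 w2B dw2] : exists2 e, supp (SG (X `\` B) m.+2) e & d e = c2 + a *: y2 + u.
    apply: aB; first by apply: suppD; [apply: suppD => //; apply: sc|exact: supp_SG WB uW].
    rewrite !raddfD /= linearZ /= dy2 -[d c2]opprK -dc12 eu; chain.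
  exists a, (w1 + w2 + Tk k c); split.
  - apply: suppD; last exact: supp_Tk.
    by apply: suppD; [apply: AX|apply: BX].
  - rewrite !raddfD /= dw1 dw2 (d_Tk k hc) dc ec.
    have -> : Tk k (0 : C_ (simp T)) = 0.
      by rewrite /Tk big1 // => i _; rewrite Sdk0 raddf0.
    by chain.
  - by move=> mn; apply: ha => e; apply: mn; rewrite e.
- move=> a u hu eu.
  have [k [u1 [u2 [ek h1 h2]]]] := excision cA cB hAB hu.
  have e1 : a *: (iter k Sd y1 - iter k Sd y2) = d u1 + d u2.
    have <- : iter k Sd (d u) = d u1 + d u2 by rewrite -d_Sdk ek raddfD.
    rewrite -eu SdkZ; congr (_ *: _).
    by rewrite SdkD SdkN.
  (* By [e1] this chain lies in both pieces, hence in [W], and its boundary is the [k]-fold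
     subdivision of [a *: z]; adding [a *: Tk k z] undoes the subdivision. *)
  pose f := a *: iter k Sd y1 - d u1.
  have ef : f = a *: iter k Sd y2 + d u2.
    by rewrite /f; apply/eqP; rewrite subr_eq -addrA [d u2 + _]addrC -e1; apply/eqP; chain.
  have fW : supp (SG W n.+1) f.
    apply: meetW; first by apply: suppB; [apply: suppZ; exact: supp_Sdk|exact: supp_d].
    by rewrite ef; apply: suppD; [apply: suppZ; exact: supp_Sdk|exact: supp_d].
  apply: (free a (f + a *: Tk k z)); first by apply: suppD => //; apply: suppZ; exact: supp_Tk.
  have edT : d (a *: Tk k z) = a *: d (Tk k z) by rewrite linearZ.
  have edS : d (a *: iter k Sd y1) = a *: iter k Sd z by rewrite linearZ /= d_Sdk dy1.
  rewrite raddfD /= edT (d_Tk k zW) dz /f raddfB /= edS dd.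
  have -> : Tk k (0 : C_ (simp T)) = 0.
    by rewrite /Tk big1 // => i _; rewrite Sdk0 raddf0.
  by chain.
Qed.

Lemma SG_set0 m (c : C_ (simp T)) : supp (SG set0 m) c ->
  exists2 a, c = a *: ub Emp & m <> 0%N -> a = 0.
Proof.
move: c; apply: supp_ind => [|a s c [hs sm] [b -> hb]].
  by exists 0; rewrite ?scale0r.
case: s hs sm => [_ m0|n s [_ _ h] _]; last by case: (h _ (vtx_std ord0)).
by exists (a + b); [rewrite scalerDl|rewrite -m0].
Qed.

(** The start of the suspensions: the only simplex of the empty set is the empty one. *)
Lemma hsph0 : hsph set0 0 (ub Emp : C_ (simp T)).
Proof.
split.
- exact: supp_ub.
- by rewrite d_ub.
- move=> m c /SG_set0 [a ea ha] _; exists a, 0; rewrite raddf0 addr0; split=> //.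
  exact: supp0.
- move=> a u hu; have [b -> hb] := SG_set0 hu.
  by rewrite hb // scale0r raddf0 => e; exact: scale_ub_eq0 e.
Qed.

End MayerVietoris.

Lemma lerp_continuous (E : normedModType RR) (p : E) :
  continuous (fun z : (E * RR^o)%type => (1 - z.2) *: z.1 + z.2 *: p).
Proof.
move=> z; apply: cvgD; apply: (@cvgZ _ _ _ (nbhs z)).
- apply: cvgB; [exact: cvg_cst|exact: cvg_snd].
- exact: cvg_fst.
- exact: cvg_snd.
- exact: cvg_cst.
Qed.

Lemma acyc_star (E : normedModType RR) (A : set E) (p : E) : A p ->
  (forall x t, A x -> 0 <= t <= 1 -> A ((1 - t) *: x + t *: p)) -> acyc A.
Proof.
move=> Ap h; apply: (@contract _ A (fun x t => (1 - t) *: x + t *: p) p) => //.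
- exact: contOnT (@lerp_continuous _ p).
- by move=> x _; rewrite subr0 scale1r scale0r addr0.
- by move=> x _; rewrite subrr scale1r scale0r add0r.
Qed.

Section Sphere.
Variables (n : nat) (K : set 'rV[RR]_n) (r : RR).
Hypotheses (cK : cvx K) (r0 : 0 < r).
Hypothesis Kv : forall (j : 'I_n) (b : bool), K (((-1) ^+ b * r) *: delta_mx ord0 j).

Definition punct j : set 'rV[RR]_n :=
  [set x | K x /\ exists2 i : 'I_n, (i < j)%N & x ord0 i != 0].

(* [punct j.+1] is covered by two star-shaped open sets, according to the sign of
   the coordinate [j], whose intersection is [punct j]. *)
Lemma hsph_punct j : (j <= n)%N -> exists z, hsph (punct j) j z.
Proof.
elim: j => [|j IH] jn.
  have -> : punct 0 = set0 by rewrite -subset0 => x [_ [i]].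
  by eexists; exact: hsph0.
have [z hz] := IH (ltnW jn).
pose o := Ordinal jn.
pose A (b : bool) : set 'rV[RR]_n :=
  [set x | (forall i : 'I_n, (i < j)%N -> x ord0 i = 0) /\ (-1) ^+ b * x ord0 o <= 0].
have clA b : closed (A b).
  have -> : A b = (\bigcap_(i in [set i : 'I_n | (i < j)%N])
        [set x : 'rV[RR]_n | x ord0 i = 0]) `&`
      [set x : 'rV[RR]_n | (-1) ^+ b * x ord0 o <= 0].
    by apply/seteqP; split=> x [h1 h2]; split=> // i hi; exact: h1.
  apply: closedI.
    apply: closed_bigI => i _.
    apply: (@closed_comp _ _ (fun x : 'rV[RR]_n => x ord0 i) [set y | y = 0]).
      by move=> x _; exact: coord_continuous.
    exact: closed_eq.
  apply: (@closed_comp _ _ (fun x : 'rV[RR]_n => (-1) ^+ b * x ord0 o) [set y | y <= 0]).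
    move=> x _; apply: (@cvgM _ _ (nbhs x)); first exact: cvg_cst.
    exact: coord_continuous.
  exact: closed_le.
have UE b x : (punct j.+1 `\` A b) x <->
    K x /\ ((exists2 i : 'I_n, (i < j)%N & x ord0 i != 0) \/ 0 < (-1) ^+ b * x ord0 o).
  split.
    move=> [[Kx [i ij xi]] nA]; split=> //.
    have [h|h] := pselect (exists2 i : 'I_n, (i < j)%N & x ord0 i != 0); first by left.
    right; rewrite ltNge; apply/negP => h'; apply: nA; split=> // i' hi'.
    by apply/eqP/negPn/negP => ni; apply: h; exists i'.
  move=> [Kx h]; split.
    split=> //; case: h => [[i ij xi]|h]; first by exists i => //; exact: ltnW.
    by exists o => //=; apply: contraTneq h => ->; rewrite mulr0 ltxx.
  move=> [h1 h2]; case: h => [[i ij /eqP xi]|]; first by apply: xi; exact: h1.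
  by rewrite ltNge h2.
have acU b : acyc (punct j.+1 `\` A b).
  (* The star centre lies on the axis [o], on the side of the piece. Moving towards it scales the
     earlier coordinates by [1 - t], so they stay nonzero before time 1, and at time 1 the
     coordinate [o] has the right sign. *)
  apply: (@acyc_star _ _ (((-1) ^+ b * r) *: delta_mx ord0 o)).
    by apply/UE; split=> //; right; rewrite !mxE !eqxx mulr1 mulrA -expr2 sqrr_sign mul1r.
  move=> x t /UE [Kx h] ht; apply/UE; split; first exact: cK.
  have [t0 t1] := andP ht.
  have ej : (-1) ^+ b * ((1 - t) *: x + t *: (((-1) ^+ b * r) *: delta_mx ord0 o)) ord0 o =
      (1 - t) * ((-1) ^+ b * x ord0 o) + t * r.
    rewrite !mxE !eqxx mulr1 mulrDr mulrCA; congr (_ + _).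
    by rewrite mulrCA (mulrA _ _ r) -expr2 sqrr_sign mul1r.
  rewrite ej; case: h => [[i ij xi]|h]; last first.
    right; have [->|t1'] := eqVneq t 1; first by rewrite subrr mul0r add0r mul1r.
    by apply: ltr_wpDr; [rewrite mulr_ge0 // ltW|rewrite mulr_gt0 // subr_gt0 lt_neqAle t1'].
  have [->|t1'] := eqVneq t 1; first by right; rewrite subrr mul0r add0r mul1r.
  left; exists i => //; rewrite !mxE eqxx /=.
  have -> : (i == o) = false by apply/eqP => e; move: ij; rewrite e /= ltnn.
  by rewrite !mulr0 addr0 mulf_neq0 // subr_eq0 eq_sym.
apply: (mayer_vietoris (clA false) (clA true) _ _ (acU false) (acU true) hz).
- move=> x [Kx [i ij /eqP xi]] [h1 h2] [_ h3].
  move: ij; rewrite ltnS leq_eqVlt => /orP[/eqP e|/h1 //].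
  apply: xi; have -> : i = o by apply/val_inj.
  by move: h2 h3; rewrite expr0 mul1r expr1 mulN1r oppr_le0 => h2 h3; apply/le_anti/andP.
- move=> x; split.
    move=> [Kx [i ij xi]]; split.
    + by split=> //; exists i => //; exact: ltnW.
    + by move=> [/(_ i ij) e]; move: xi; rewrite e eqxx.
    + by move=> [/(_ i ij) e]; move: xi; rewrite e eqxx.
  move=> [hx nA nB].
  have /UE [Kx [//|h1]] : (punct j.+1 `\` A false) x by [].
  have /UE [_ [//|h2]] : (punct j.+1 `\` A true) x by [].
  by move: h1 h2; rewrite expr0 mul1r expr1 mulN1r oppr_gt0 => h1 /(lt_trans h1); rewrite ltxx.
Qed.

End Sphere.

Section Ball.
Variables (n : nat) (K : set 'rV[RR]_n).

(* [w] generates the relative homology of [K] modulo [K] minus the origin. *)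
Record hball (w : C_ (simp 'rV[RR]_n)) : Prop := Hball {
  hball_supp : supp (SG K n.+1) w;
  hball_d : supp (SG (K `\ 0) n) (d w);
  hball_gen : forall m c, supp (SG K m.+1) c -> supp (SG (K `\ 0) m) (d c) ->
    exists a u v, [/\ c = a *: w + d u + v, supp (SG K m.+2) u,
      supp (SG (K `\ 0) m.+1) v & m <> n -> a = 0];
  hball_free : forall a u v, supp (SG K n.+2) u -> supp (SG (K `\ 0) n.+1) v ->
    a *: w = d u + v -> a = 0 }.

(** The long exact sequence of the pair: [K] is acyclic, so a filling [w] of the spherical class of
    [K] minus the origin generates the relative homology, and relations are tested on boundaries. *)
Lemma ball_homology (r : RR) : cvx K -> K 0 -> 0 < r ->
  (forall (j : 'I_n) (b : bool), K (((-1) ^+ b * r) *: delta_mx ord0 j)) ->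
  exists w, hball w.
Proof.
move=> cK K0 r0 Kv.
have [z] := hsph_punct cK r0 Kv (leqnn n).
have -> : punct K n = K `\ 0.
  apply/seteqP; split=> x [Kx h]; split=> //.
    by case: h => i _ /eqP h e; apply: h; rewrite e mxE.
  apply: contrapT => h'; apply: h; apply/rowP => i; rewrite mxE.
  by apply/eqP/negPn/negP => xi; apply: h'; exists i.
move=> [zK dz gen free].
have KK : K `\ 0 `<=` K by move=> x [].
have acK : acyc K by apply: (acyc_star K0) => x t Kx ht; exact: cK.
have [w wK dw] := acK _ _ (supp_SG KK zK) dz.
exists w; split=> //.
- by rewrite dw.
- move=> m c hc hdc; have [a [u [uK eu ha]]] := gen _ _ hdc (dd _).
  have sw : supp (SG K m.+1) (a *: w).
    have [->|/ha ->] := pselect (m = n); first exact: suppZ.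
    by rewrite scale0r; exact: supp0.
  have [e eK de] : exists2 e, supp (SG K m.+2) e & d e = c - a *: w - u.
    apply: acK; first by apply: suppB; [exact: suppB|exact: supp_SG KK uK].
    by rewrite !raddfB /= linearZ /= dw eu; chain.
  by exists a, e, u; split=> //; rewrite de; chain.
- move=> a u v hu hv /(congr1 d); rewrite linearZ /= dw raddfD /= dd add0r.
  exact: free.
Qed.

End Ball.

Section Disk.
Variable k : nat.
Local Notation V := 'rV[RR]_k.
Implicit Types x y : V.

Definition sqn x : RR := \sum_i x ord0 i ^+ 2.
Definition en x : RR := Num.sqrt (sqn x).

Lemma sqn_ge0 x : 0 <= sqn x. Proof. by apply: sumr_ge0 => i _; exact: sqr_ge0. Qed.

Lemma sqn_eq0 x : sqn x = 0 -> x = 0.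
Proof.
move=> h; have /psumr_eq0P h' : forall i : 'I_k, true -> 0 <= x ord0 i ^+ 2.
  by move=> i _; exact: sqr_ge0.
by apply/rowP => i; rewrite mxE; have /eqP := h' h i isT; rewrite sqrf_eq0 => /eqP.
Qed.

Lemma sqn0 : sqn 0 = 0.
Proof. by rewrite /sqn big1 // => i _; rewrite mxE expr0n. Qed.

Lemma sqnZ (a : RR) x : sqn (a *: x) = a ^+ 2 * sqn x.
Proof. by rewrite /sqn mulr_sumr; apply: eq_bigr => i _; rewrite mxE exprMn. Qed.

Lemma en_gt0 x : x <> 0 -> 0 < en x.
Proof.
move=> h; rewrite sqrtr_gt0 lt_neqAle sqn_ge0 andbT eq_sym; apply/eqP.
by move=> /sqn_eq0.
Qed.

Lemma en_sq x : en x ^+ 2 = sqn x. Proof. by rewrite sqr_sqrtr // sqn_ge0. Qed.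

Lemma sqn_continuous : continuous sqn.
Proof.
apply: (@continuous_sum _ RR^o) => i x.
have h : continuous (fun y : V => y ord0 i) by move=> y; exact: coord_continuous.
rewrite (_ : (fun y : V => y ord0 i ^+ 2) = fun y : V => y ord0 i * y ord0 i).
  by apply: (@cvgM _ _ (nbhs x)); exact: h.
by apply/funext => y; rewrite expr2.
Qed.

Lemma en_continuous : continuous en.
Proof.
move=> x; apply: (@continuous_comp _ _ _ sqn Num.sqrt); first exact: sqn_continuous.
exact: sqrt_continuous.
Qed.

Lemma diskE x : disk k x <-> sqn x <= 1. Proof. by []. Qed.
Lemma closed_disk : closed (disk k).
Proof.
apply: (@closed_comp _ _ sqn [set y | y <= 1]); last exact: closed_le.
by move=> x _; exact: sqn_continuous.
Qed.
Lemma compact_disk : compact (disk k).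
Proof.
apply: (subclosed_compact closed_disk (@rV_compact _ k (fun=> `[(-1 : RR), 1]%classic) _)).
  by move=> _; exact: segment_compact.
move=> x /= hx j; rewrite /= in_itv /=.
have h : x ord0 j ^+ 2 <= 1.
  by apply: le_trans hx; rewrite (bigD1 j) //= lerDl sumr_ge0 // => i _; exact: sqr_ge0.
by apply/andP; split; nra.
Qed.

Lemma disk_cases x : disk k x -> open_disk k x \/ sphere k x.
Proof. by rewrite /disk /= le_eqVlt => /orP[/eqP h|h]; [right|left]. Qed.
Lemma open_disk_sub : open_disk k `<=` disk k. Proof. by move=> x /ltW. Qed.
Lemma sphere_sub : sphere k `<=` disk k. Proof. by move=> x; rewrite /disk /= => ->. Qed.
Lemma open_disk0 : open_disk k 0.
Proof. by rewrite /open_disk /= -/(sqn 0) sqn0 ltr01. Qed.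
Lemma open_open_disk : open (open_disk k).
Proof.
apply: (@open_comp _ _ sqn [set y | y < 1]); last exact: open_lt.
by move=> x _; exact: sqn_continuous.
Qed.

Lemma sqn_cvx x y (t : RR) : 0 <= t <= 1 ->
  sqn ((1 - t) *: x + t *: y) <= (1 - t) * sqn x + t * sqn y.
Proof.
move=> /andP[t0 t1]; rewrite /sqn !mulr_sumr -big_split /=; apply: ler_sum => i _.
rewrite !mxE; set a := x _ _; set b := y _ _.
rewrite -subr_ge0 (_ : _ - _ = t * (1 - t) * (a - b) ^+ 2); last by ring.
by rewrite mulr_ge0 ?sqr_ge0 // mulr_ge0 // subr_ge0.
Qed.

Lemma cvx_open_disk : cvx (open_disk k).
Proof.
move=> x y t hx hy ht; apply: le_lt_trans (sqn_cvx x y ht) _.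
have [t0 t1] := andP ht; have [->|t1'] := eqVneq t 1.
  by rewrite subrr mul0r add0r mul1r.
apply: (@lt_le_trans _ _ ((1 - t) + t)); last by rewrite subrK.
apply: ltr_leD.
  by rewrite gtr_pMr ?subr_gt0 // lt_neqAle t1'.
by rewrite ler_piMr // ltW.
Qed.

(** The homotopy, away from the origin, from the identity to normalisation; it does not move points
    of the sphere. *)
Definition rad (x : V) (t : RR) : V := ((1 - t) + t / en x) *: x.

Lemma rad0 x : rad x 0 = x. Proof. by rewrite /rad subr0 mul0r addr0 scale1r. Qed.

Lemma en_sphere x : sphere k x -> en x = 1.
Proof. by move=> h; rewrite /en /sqn h sqrtr1. Qed.

Lemma rad_sphere x t : sphere k x -> rad x t = x.
Proof. by move=> /en_sphere h; rewrite /rad h divr1 subrK scale1r. Qed.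

Lemma en_rad x t : x <> 0 -> 0 <= t <= 1 -> en (rad x t) = (1 - t) * en x + t.
Proof.
move=> x0 /andP[t0 t1]; have e0 := en_gt0 x0; rewrite /rad {1}/en sqnZ sqrtrM ?sqr_ge0 //.
rewrite sqrtr_sqr -/(en x) ger0_norm.
  by rewrite mulrDl divfK ?gt_eqF.
by rewrite addr_ge0 ?subr_ge0 // divr_ge0 // ltW.
Qed.

Lemma en_disk x : disk k x <-> en x <= 1.
Proof.
rewrite diskE -en_sq; have h : 0 <= en x by rewrite sqrtr_ge0.
by rewrite expr_le1.
Qed.

Lemma rad_neq0 x t : x <> 0 -> 0 <= t <= 1 -> rad x t <> 0.
Proof.
move=> x0 ht; have [t0 t1] := andP ht; have e0 := en_gt0 x0.
have h : 0 < en (rad x t).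
  rewrite en_rad //; have [->|t1'] := eqVneq t 1; first by rewrite subrr mul0r add0r.
  by apply: ltr_wpDr => //; rewrite mulr_gt0 // subr_gt0 lt_neqAle t1'.
by move=> e; move: h; rewrite e /en sqn0 sqrtr0 ltxx.
Qed.

Lemma rad_disk x t : disk k x -> x <> 0 -> 0 <= t <= 1 -> disk k (rad x t).
Proof.
move=> /en_disk hx x0 ht; have [t0 t1] := andP ht; apply/en_disk; rewrite en_rad //.
by have e0 := en_gt0 x0; nra.
Qed.

Lemma rad1_sphere x : x <> 0 -> sphere k (rad x 1).
Proof.
move=> x0; rewrite /sphere /= -/(sqn _) -en_sq en_rad ?ler01 ?lexx //.
by rewrite subrr mul0r add0r expr1n.
Qed.

Lemma rad_contOn : contOn ([set x : V | x <> 0] `*` (setT : set RR^o))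
  (fun z : (V * RR^o)%type => rad z.1 z.2).
Proof.
move=> [x t] [/= x0 _]; have e0 := en_gt0 x0.
have h : (fun z : (V * RR^o)%type => rad z.1 z.2) @ nbhs (x, t) --> rad x t.
  apply: (@cvgZ _ _ _ (nbhs (x, t))); last exact: cvg_fst.
  apply: cvgD; first by apply: cvgB; [exact: cvg_cst|exact: cvg_snd].
  apply: (@cvgM _ _ (nbhs (x, t))); first exact: cvg_snd.
  apply: (@cvgV _ _ (nbhs (x, t))); first by rewrite gt_eqF.
  apply: (@cvg_comp _ _ _ (fun z : (V * RR^o)%type => z.1) en (nbhs (x, t)) (nbhs x)).
    exact: cvg_fst.
  exact: en_continuous.
move=> U /h h'; have : nbhs (x, t) ((fun z : (V * RR^o)%type => rad z.1 z.2) @^-1` U) by [].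
by apply: filterS => z.
Qed.

(** Two representatives of one relative class are needed. [w] stays in the open disk, where
    characteristic maps are injective, and detects coefficients; [z] has its boundary on the sphere,
    which goes to the lower skeleton. They differ by [y], the trace of pushing [d w] radially
    outwards, which avoids the origin. *)
Lemma disk_class : exists (z w y : C_ (simp V)),
  [/\ z = w + y, hball (open_disk k) w,
      supp (SG (disk k) k.+1) z /\ supp (SG (sphere k) k) (d z) &
      supp (SG (disk k `\ 0) k.+1) y].
Proof.
have [w hw] : exists w, hball (open_disk k) w.
  apply: (@ball_homology k _ (1 / 2)); first exact: cvx_open_disk.
  - exact: open_disk0.
  - by rewrite divr_gt0.
  - move=> j b; rewrite /open_disk /= -/(sqn _) sqnZ exprMn sqrr_sign mul1r.
    have -> : sqn (delta_mx ord0 j) = 1.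
      rewrite /sqn (bigD1 j) //= big1 => [|i ij]; rewrite mxE eqxx ?eqxx /= ?expr1n ?addr0 //.
      by rewrite (negbTE ij) expr0n.
    by lra.
pose y := prism rad (d w).
have dwD : supp (SG (disk k `\ 0) k) (d w).
  by apply: supp_SG (hball_d hw) => x [/open_disk_sub].
have rc : contOn ((disk k `\ 0) `*` I01) (fun z : (V * RR^o)%type => rad z.1 z.2).
  by apply: contOn_sub rad_contOn => -[x t] [[]].
have yD : supp (SG (disk k `\ 0) k.+1) y.
  apply: supp_prism rc _ dwD => x t [hx x0] ht.
  by split; [exact: rad_disk|exact: rad_neq0].
exists (w + y), w, y; split=> //; split.
  apply: suppD; first exact: supp_SG open_disk_sub (hball_supp hw).
  by apply: supp_SG yD => x [].
have e0 : pushs (rad^~ 0) (d w) = d w.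
  by apply: (pushs_id _ dwD) => x _; exact: rad0.
rewrite raddfD /= d_prism dd raddf0 e0.
have -> : d w + (pushs (rad^~ 1) (d w) - d w - 0) = pushs (rad^~ 1) (d w) by chain.
apply: supp_pushs dwD; last by move=> x [_ x0]; exact: rad1_sphere.
apply: (contOn_slice (B := I01) (f := fun z : (V * RR^o)%type => rad z.1 z.2)) rc.
by rewrite /I01 /= ler01 lexx.
Qed.

End Disk.

(** * Attaching cells *)

(* [Z] is obtained from [Z'] by attaching the [k]-cells [phi i], [i] in [J]. *)
Record attach (T : topologicalType) (k : nat) (I : Type) (Z' Z : set T) (J : set I)
    (phi : I -> 'rV[RR]_k -> T) : Prop := Attach {
  att_sub : Z' `<=` Z;
  att_cl' : closed Z';
  att_cont : forall i, J i -> contOn (disk k) (phi i);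
  att_disk : forall i x, J i -> disk k x -> Z (phi i x);
  att_sphere : forall i x, J i -> sphere k x -> Z' (phi i x);
  att_open : forall i x, J i -> open_disk k x -> ~ Z' (phi i x);
  att_inj : forall i j x y, J i -> J j -> open_disk k x -> open_disk k y ->
    phi i x = phi j y -> i = j /\ x = y;
  att_cover : forall z, Z z -> Z' z \/
    exists i x, [/\ J i, open_disk k x & z = phi i x];
  att_closed : forall U, U `<=` Z -> closed (U `&` Z') ->
    (forall i, J i -> closed (disk k `&` phi i @^-1` U)) -> closed U }.

Lemma contOn_closed (X Y : topologicalType) (A : set X) (B : set Y) (f : X -> Y) :
  closed A -> closed B -> contOn A f -> closed (A `&` f @^-1` B).
Proof.
move=> cA cB cf x hx.
have Ax : A x by apply: cA => U /hx [y [[Ay _] Uy]]; exists y.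
split=> //; apply: contrapT => nB.
have : nbhs (f x) (~` B) by apply: open_nbhs_nbhs; split; [exact: closed_openC|].
by move=> /(cf x Ax) /hx [y [[Ay By] /(_ Ay)]].
Qed.

Section Attach.
Variables (T : topologicalType) (k : nat) (I : Type) (Z' Z : set T) (J : set I).
Variable phi : I -> 'rV[RR]_k -> T.
Hypothesis at_ : attach Z' Z J phi.
Local Notation V := 'rV[RR]_k.

Let cell i : set T := [set z | exists2 x, open_disk k x & z = phi i x].
Let ctr : set T := [set z | exists2 i, J i & z = phi i 0].
(** [E] and [N] are the complements in [Z] of the closed sets [Z'] and [ctr], which are disjoint, so
    excision applies to them. [E] is the disjoint union of the open cells, and [N] deforms into
    [Z']. *)
Let E := Z `\` Z'.
Let N := Z `\` ctr.

Lemma cellE i z : J i -> cell i z -> E z.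
Proof.
move=> Ji [x hx ->]; split; last exact: (att_open at_).
by apply: (att_disk at_) => //; exact: open_disk_sub.
Qed.

Lemma E_cell z : E z -> exists2 i, J i & cell i z.
Proof. by move=> [/(att_cover at_) [//|[i [x [Ji hx ->]]]] _]; exists i => //; exists x. Qed.

Lemma cell_inj i j z : J i -> J j -> cell i z -> cell j z -> i = j.
Proof.
move=> Ji Jj [x hx ->] [y hy e]; by have [] := att_inj at_ Ji Jj hx hy e.
Qed.

Lemma ctrE z : ctr z -> E z.
Proof. by move=> [i Ji ->]; apply: (@cellE i) => //; exists 0 => //; exact: open_disk0. Qed.

Lemma Z'N : Z' `<=` N.
Proof. by move=> z hz; split; [exact: (att_sub at_)|move=> /ctrE []]. Qed.

(** In the weak topology a union of open subsets of open cells is open relative to [Z]. The closed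
    complement is the form that [att_closed] can test: it contains [Z'], and its preimage in each
    disk is the disk minus an open set. *)
Lemma closed_union (S : set I) (W : I -> set V) :
  (forall i, J i -> S i -> open (W i)) ->
  closed (Z `\` [set z | exists i x, [/\ J i, S i, open_disk k x & W i x /\ z = phi i x]]).
Proof.
move=> oW; apply: (att_closed at_).
- by move=> z [].
- rewrite (_ : _ `&` _ = Z'); first exact: (att_cl' at_).
  apply/seteqP; split=> z; first by case.
  move=> hz; split=> //; split; first exact: (att_sub at_).
  by move=> [i [x [Ji _ hx [_ e]]]]; apply: (att_open at_ Ji hx); rewrite -e.
- move=> i Ji; have [Si|nS] := pselect (S i).
    rewrite (_ : _ `&` _ = disk k `&` ~` (W i `&` open_disk k)).
      apply: closedI; first exact: closed_disk.
      by apply/open_closedC/openI; [exact: oW|exact: open_open_disk].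
    apply/seteqP; split=> x [hx hx']; split=> //.
      by move=> [Wx ox]; case: hx' => _; apply; exists i, x.
    split; first exact: (att_disk at_).
    move=> [j [y [Jj Sj hy [Wy e]]]]; apply: hx'.
    have oy := hy; case: (disk_cases hx) => ox.
      by have [ij xy] := att_inj at_ Ji Jj ox hy e; subst; split.
    by case: (att_open at_ Jj hy); rewrite -e; exact: (att_sphere at_ Ji ox).
  rewrite (_ : _ `&` _ = disk k); first exact: closed_disk.
  apply/seteqP; split=> x; first by case.
  move=> hx; split=> //; split; first exact: (att_disk at_).
  move=> [j [y [Jj Sj hy [Wy e]]]]; case: (disk_cases hx) => ox.
    by have [ij xy] := att_inj at_ Ji Jj ox hy e; subst.
  by case: (att_open at_ Jj hy); rewrite -e; exact: (att_sphere at_ Ji ox).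
Qed.

Lemma closed_ctr : closed ctr.
Proof.
apply: (att_closed at_).
- by move=> z /ctrE [].
- rewrite (_ : _ `&` _ = set0); first exact: closed0.
  by rewrite -subset0 => z [/ctrE []].
- move=> i Ji; rewrite (_ : _ `&` _ = [set 0]).
    by apply: accessible_closed_set1; apply: hausdorff_accessible; exact: norm_hausdorff.
  apply/seteqP; split=> x.
    move=> [hx [j Jj e]]; case: (disk_cases hx) => ox.
      by have [_ ->] := att_inj at_ Ji Jj ox (@open_disk0 k) e.
    by case: (att_open at_ Jj (@open_disk0 k)); rewrite -e; exact: (att_sphere at_ Ji ox).
  move=> ->; split; first by apply: open_disk_sub; exact: open_disk0.
  by exists i.
Qed.

Lemma nbhs_cell i (W : set V) x : J i -> open W -> W x -> open_disk k x ->
  nbhs (phi i x) [set z | Z z -> exists y, [/\ W y, open_disk k y & z = phi i y]].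
Proof.
move=> Ji oW Wx hx.
have cl := @closed_union [set i] (fun=> W) (fun _ _ _ => oW).
apply: (@filterS _ _ _ (~` (Z `\` [set z | exists j y, [/\ J j, [set i] j, open_disk k y & W y /\ z = phi j y]]))).
  move=> z hz Zz; apply: contrapT => h; apply: hz; split=> // -[j [y [_ -> hy [Wy e]]]].
  by apply: h; exists y.
apply: open_nbhs_nbhs; split; first exact: closed_openC cl.
by move=> [_]; apply; exists i, x.
Qed.

(** The inverse of the characteristic maps on all open cells at once; its continuity on [E] rests on
    [nbhs_cell], that is, on the cells being open in [Z]. *)
Definition cpt (z : T) : V := xget 0 [set x | open_disk k x /\ exists2 i, J i & z = phi i x].

Lemma cptE i x : J i -> open_disk k x -> cpt (phi i x) = x.
Proof.
move=> Ji hx; rewrite /cpt; case: xgetP => [y _ [hy [j Jj e]]|/(_ x) h].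
  by have [_ ->] := att_inj at_ Ji Jj hx hy e.
by case: h; split=> //; exists i.
Qed.

Lemma phi_cpt i z : J i -> cell i z -> phi i (cpt z) = z.
Proof. by move=> Ji [x hx ->]; rewrite cptE. Qed.

Lemma cpt_open i z : J i -> cell i z -> open_disk k (cpt z).
Proof. by move=> Ji [x hx ->]; rewrite cptE. Qed.

Lemma cpt_contOn : contOn E cpt.
Proof.
move=> z /[dup] Ez /E_cell [i Ji [x hx ex]] U; rewrite ex cptE // nbhsE => -[W [oW Wx] WU].
have := nbhs_cell Ji oW Wx hx; apply: filterS => z' h [Zz' _].
by have [y [Wy hy ->]] := h Zz'; rewrite cptE //; exact: WU.
Qed.

(** Connectedness of the simplex, through [lebesgue]: [S1] and [S2] are closed and cut [E] into the
    cell [i] and the other cells. The segment from [x0] to [x] is walked in [M.+1] steps of length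
    at most [e], none of which can leave the cell. *)
Lemma E_clopen i n (s : 'rV[RR]_n.+1 -> T) x0 x : J i -> contOn (stdsimplex n) s ->
  (forall x, stdsimplex n x -> E (s x)) -> stdsimplex n x0 -> stdsimplex n x ->
  cell i (s x0) -> cell i (s x).
Proof.
move=> Ji cs sE hx0 hx ci0.
pose S1 := Z `\` [set z | exists j y, [/\ J j, j <> i, open_disk k y & setT y /\ z = phi j y]].
pose S2 := Z `\` [set z | exists j y, [/\ J j, j = i, open_disk k y & setT y /\ z = phi j y]].
have c1 : closed S1 by apply: (@closed_union [set j | j <> i] (fun=> setT)) => *; exact: openT.
have c2 : closed S2 by apply: (@closed_union [set j | j = i] (fun=> setT)) => *; exact: openT.
have h1 z : E z -> S1 z -> cell i z.
  move=> /[dup] Ez /E_cell [j Jj [y hy ey]] [_ nS]; have [<-|ji] := pselect (j = i).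
    by exists y.
  by case: nS; exists j, y.
have h2 z : cell i z -> S1 z.
  move=> ci; have [Zz _] := cellE Ji ci; split=> // -[j [y [Jj ji hy [_ ey]]]].
  by apply: ji; apply: (@cell_inj _ _ z) => //; exists y.
have h3 z : E z -> ~ cell i z -> S2 z.
  by move=> [Zz _] nc; split=> // -[j [y [Jj ji hy [_ ey]]]]; apply: nc; exists y; rewrite -?ji.
have h4 z : E z -> S1 z -> S2 z -> False.
  by move=> Ez /(h1 _ Ez) [y hy ey] [_]; apply; exists i, y.
have [e e0 he] := lebesgue c1 c2 cs (fun x hx => h4 _ (sE x hx)).
have [M hM] : exists M : nat, `|x - x0| <= M.+1%:R * e.
  have := archi_boundP (x := `|x - x0| / e) (divr_ge0 (normr_ge0 _) (ltW e0)).
  move=> h; exists (Num.bound (`|x - x0| / e)).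
  rewrite -ler_pdivrMr //; apply: le_trans (ltW h) _; rewrite ler_nat; exact: leqnSn.
pose p (m : nat) := (1 - m%:R / M.+1%:R) *: x0 + (m%:R / M.+1%:R) *: x.
have hp m : (m <= M.+1)%N -> stdsimplex n (p m).
  move=> hm; apply: cvx_std => //; rewrite divr_ge0 //= ler_pdivrMr ?ltr0n // mul1r ler_nat //.
have : cell i (s (p M.+1)).
  have : (M.+1 <= M.+1)%N by [].
  move: {-2}M.+1 => m; elim: m => [_|m IH hm].
    by rewrite /p mul0r subr0 scale1r scale0r addr0.
  have ci := IH (ltnW hm); apply: contrapT => nc.
  apply: (he (p m) (p m.+1)) (h2 _ ci) (h3 _ _ nc) => //; [exact/hp/ltnW|exact: hp| |exact/sE/hp].
  have -> : p m - p m.+1 = (M.+1%:R^-1) *: (x0 - x).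
    rewrite /p -[m.+1]addn1 natrD mulrDl mul1r; apply/rowP => j; rewrite !mxE; ring.
  rewrite normrZ ger0_norm ?invr_ge0 // distrC mulrC ler_pdivrMr ?ltr0n // mulrC.
  exact: hM.
by rewrite /p divff ?pnatr_eq0 // subrr scale0r add0r scale1r.
Qed.

Lemma SG_cell m s : SG E m.+1 s -> exists2 i, J i & SG (cell i) m.+1 s.
Proof.
case: s => [|n s] [] // [h1 h2 h3] nm.
have [i Ji ci] := E_cell (h3 _ (vtx_std ord0)); exists i => //; split=> //; split=> // x hx.
exact: (E_clopen Ji h2 h3 (vtx_std ord0) hx ci).
Qed.

(* Pushes [Z] minus the centres of its cells radially into [Z']; away from the open
   cells, and in particular on [Z'], [xget] returns its default [z]. *)
Definition hrad (z : T) (t : RR) : T :=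
  xget z [set y | exists i x, [/\ J i, open_disk k x, z = phi i x & y = phi i (rad x t)]].

Lemma hrad_Z' z t : Z' z -> hrad z t = z.
Proof.
move=> hz; rewrite /hrad; case: xgetP => // y _ [i [x [Ji hx e _]]].
by case: (att_open at_ Ji hx); rewrite -e.
Qed.

Lemma hrad_phi i x t : J i -> disk k x -> hrad (phi i x) t = phi i (rad x t).
Proof.
move=> Ji /disk_cases [hx|hx]; last first.
  by rewrite rad_sphere // hrad_Z' //; exact: (att_sphere at_).
rewrite /hrad; case: xgetP => [y _ [j [x' [Jj hx' e ->]]]|/(_ (phi i (rad x t))) h].
  by have [<- <-] := att_inj at_ Ji Jj hx hx' e.
by case: h; exists i, x.
Qed.

Lemma NE z : N z -> Z' z \/ exists i x, [/\ J i, open_disk k x, x <> 0 & z = phi i x].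
Proof.
move=> [/(att_cover at_) [hz|[i [x [Ji hx e]]]] nc]; [by left|right].
by exists i, x; split=> // x0; apply: nc; exists i => //; rewrite e x0.
Qed.

Lemma phi_N i x : J i -> disk k x -> x <> 0 -> N (phi i x).
Proof.
move=> Ji hx x0; split; first exact: (att_disk at_).
move=> [j Jj e]; case: (disk_cases hx) => ox.
  by have [_ e0] := att_inj at_ Ji Jj ox (@open_disk0 k) e; apply: x0.
by case: (att_open at_ Jj (@open_disk0 k)); rewrite -e; exact: (att_sphere at_ Ji ox).
Qed.

Lemma hrad_N z t : N z -> I01 t -> N (hrad z t).
Proof.
move=> Nz ht; case: (NE Nz) => [hz|[i [x [Ji hx x0 ->]]]]; first by rewrite hrad_Z'.
have dx := open_disk_sub hx; rewrite hrad_phi //.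
by apply: phi_N => //; [exact: rad_disk|exact: rad_neq0].
Qed.

Lemma hrad0 z : N z -> hrad z 0 = z.
Proof.
move=> Nz; case: (NE Nz) => [hz|[i [x [Ji hx x0 ->]]]]; first by rewrite hrad_Z'.
by rewrite hrad_phi ?rad0 //; exact: open_disk_sub.
Qed.

Lemma hrad1 z : N z -> Z' (hrad z 1).
Proof.
move=> Nz; case: (NE Nz) => [hz|[i [x [Ji hx x0 ->]]]]; first by rewrite hrad_Z'.
rewrite hrad_phi //; last exact: open_disk_sub.
by apply: (att_sphere at_) => //; exact: rad1_sphere.
Qed.

(** The tube lemma: by compactness of [I01], that the whole radial path of a point stays in [U] is
    an open condition. The origin, where [rad] need not be continuous, is counted among the bad
    points. *)
Lemma closed_bad (U : set T) i : open U -> J i ->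
  closed (disk k `&` [set x | x = 0 \/ exists2 t, I01 t & ~ U (phi i (rad x t))]).
Proof.
move=> oU Ji x hx.
have dx : disk k x by apply: (@closed_disk k) => W /hx [y [[hy _] Wy]]; exists y.
split=> //; apply: contrapT => /not_orP [x0 nt].
have cI : compact I01.
  rewrite (_ : I01 = `[(0 : RR), 1]%classic); first exact: segment_compact.
  by apply/seteqP; split=> t; rewrite /I01 /= in_itv.
have nx0 : nbhs x [set y | y <> 0].
  apply: open_nbhs_nbhs; split=> //; apply: closed_openC.
  by apply: accessible_closed_set1; apply: hausdorff_accessible; exact: norm_hausdorff.
have /compact_near_coveringP/near_covering_withinP/(_ _ (nbhs x)
    (fun y t => disk k y -> y <> 0 -> U (phi i (rad y t))) _) := cI.
have pre : forall t, I01 t -> \forall t' \near t & y \near nbhs x,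
    I01 t' -> disk k y -> y <> 0 -> U (phi i (rad y t')).
  move=> t ht.
  have Ut : U (phi i (rad x t)) by apply: contrapT => nU; apply: nt; exists t.
  have dr := rad_disk dx x0 ht.
  have nU : nbhs (phi i (rad x t)) U by apply: open_nbhs_nbhs.
  have h1 := att_cont at_ Ji dr nU.
  have [[A B] /= [hA hB] AB] := @rad_contOn k (x, t) (conj x0 Logic.I) _ h1.
  exists (B, A) => //= -[t' y] [/= Bt Ay] ht' dy y0.
  apply: (AB (y, t')) => //; exact: rad_disk.
move=> /(_ pre) hnear.
have [y [[dy [y0|[t ht nU]]] [hy y0']]] := hx _ (filterI hnear nx0).
  exact: y0'.
by apply: nU; apply: hy.
Qed.

Lemma hrad_contOn : contOn (N `*` I01) (fun z : (T * RR^o)%type => hrad z.1 z.2).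
Proof.
move=> [z t] [/= Nz ht] U hU.
case: (NE Nz) => [hz|[i [x [Ji hx x0 ez]]]]; last first.
  have ciz : cell i z by exists x.
  have cont : contOn ((cell i `&` N) `*` I01) (fun z : (T * RR^o)%type => phi i (rad (cpt z.1) z.2)).
    apply: (@contOn_comp _ _ _ _ (disk k) (fun z : (T * RR^o)%type => rad (cpt z.1) z.2) (phi i)).
    - apply: (@contOn_comp _ _ _ _ ([set x : V | x <> 0] `*` (setT : set RR^o))
        (fun z : (T * RR^o)%type => (cpt z.1, z.2)) (fun z => rad z.1 z.2)).
      + apply: contOn_pair; last by apply: contOnT => w; exact: cvg_snd.
        apply: (@contOn_comp _ _ _ _ E fst cpt).
        * by apply: contOnT => w; exact: cvg_fst.
        * exact: cpt_contOn.
        * by move=> [w t'] [[ci _] _]; exact: cellE ci.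
      + exact: rad_contOn.
      + move=> [w t'] [/= [ci [_ nc]] _]; split=> //= e; apply: nc; exists i => //.
        by rewrite -e phi_cpt.
    - exact: (att_cont at_).
    - move=> [w t'] [/= [ci [_ nc]] ht']; apply: rad_disk => //.
        by apply: open_disk_sub; exact: cpt_open ci.
      by move=> e; apply: nc; exists i => //; rewrite -e phi_cpt.
  have e1 : hrad z t = phi i (rad (cpt z) t).
    by rewrite {1}ez hrad_phi ?ez ?cptE //; exact: open_disk_sub.
  rewrite e1 in hU.
  have h1 := cont (z, t) (conj (conj ciz Nz) ht) U hU.
  have h2 : nbhs (z, t) [set w : (T * RR^o)%type | Z w.1 -> cell i w.1].
    exists ([set w | Z w -> cell i w], setT) => /=; last by move=> w [].
    split; last exact: filterT.
    rewrite ez; have := nbhs_cell Ji openT Logic.I hx; apply: filterS => w h /h [y [_ hy ->]].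
    by exists y.
  apply: filterS (filterI h1 h2) => -[w t'] [/= g1 g2] [/= Nw ht'].
  have ci := g2 Nw.1; rewrite -(phi_cpt Ji ci) hrad_phi //; first exact: g1.
  by apply: open_disk_sub; exact: cpt_open ci.
rewrite /= hrad_Z' // nbhsE in hU; have [G [oG Gz] GU] := hU.
(* At a point of [Z'] continuity is tested in the weak topology, cell by cell. The condition is
   imposed on the whole path, so that a neighbourhood in [T] alone suffices and no weak topology on
   the product with [I01] enters. *)
pose bad := Z `\` [set w | N w /\ forall t, I01 t -> G (hrad w t)].
have cb : closed bad.
  apply: (att_closed at_).
  - by move=> w [].
  - rewrite (_ : _ `&` _ = Z' `&` ~` G).
      by apply: closedI; [exact: (att_cl' at_)|exact: open_closedC].
    apply/seteqP; split=> w.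
      move=> [[Zw h] hw]; split=> // Ow; apply: h; split; first exact: Z'N.
      by move=> t' _; rewrite hrad_Z'.
    move=> [hw nO]; split=> //; split; first exact: (att_sub at_).
    by move=> [_ /(_ t ht)]; rewrite hrad_Z'.
  - move=> i Ji; rewrite (_ : _ `&` _ = disk k `&` [set x | x = 0 \/
        exists2 t, I01 t & ~ G (phi i (rad x t))]); first exact: closed_bad.
    apply/seteqP; split=> x [hx h]; split=> //.
      apply: contrapT => /not_orP [x0 nt]; case: h => _; apply; split; first exact: phi_N.
      move=> t' ht'; apply: contrapT => nO; apply: nt; exists t' => //.
      by rewrite -hrad_phi.
    split; first exact: (att_disk at_).
    move=> [[_ nc] hO]; case: h => [x0|[t' ht' nO]].
      by apply: nc; exists i => //; rewrite x0.
    by apply: nO; rewrite -hrad_phi //; exact: hO.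
have nb : nbhs z (~` bad).
  apply: open_nbhs_nbhs; split; first exact: closed_openC.
  by move=> [_]; apply; split=> // t' _; rewrite hrad_Z'.
exists (~` bad, setT) => /=; first by split=> //; exact: filterT.
move=> [w t'] [/= nbad _] [/= Nw ht']; apply: GU; apply: contrapT => nO; apply: nbad.
by split; [case: Nw|move=> [_ /(_ t' ht')]].
Qed.

End Attach.

(** Nonempty simplices of disjoint sets are distinct and cannot cancel. The empty simplex lies in
    both sets, but it also lies in [R]. *)
Lemma SG_split (T : topologicalType) (P Q R : set T) m (x y : C_ (simp T)) :
  (forall z, P z -> Q z -> False) -> supp (SG P m) x -> supp (SG Q m) y ->
  supp (SG R m) (x + y) -> supp (SG R m) x.
Proof.
move=> PQ hx hy hxy s hs; have := hx s hs; case: s hs => [|n s] hs [sP sm]; first by split.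
apply: hxy; rewrite cfD (_ : cf _ y = 0) ?addr0 //.
apply/eqP/negPn/negP => /hy [[_ _ h] _]; case: sP => _ _ h'.
exact: (PQ _ (h' _ (vtx_std ord0)) (h _ (vtx_std ord0))).
Qed.

(** * Chains relative to the attached cells *)

Section Cells.
Variables (T : topologicalType) (k : nat) (I : Type) (phi : I -> 'rV[RR]_k -> T).
Implicit Types (w : C_ (simp 'rV[RR]_k)).

Definition cells w : C_ I -> C_ (simp T) := lin (fun i => pushs (phi i) w).
HB.instance Definition _ w := GRing.Linear.on (cells w).

Lemma cells_ub w i : cells w (ub i) = pushs (phi i) w. Proof. exact: lin_ub. Qed.

Lemma cellsD w w' a : cells (w + w') a = cells w a + cells w' a.
Proof.
apply: (@eq_FM _ _ _ (cells (w + w')) (cells w \+ cells w')) => i /=.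
by rewrite !cells_ub raddfD.
Qed.

Lemma d_cells w a : d (cells w a) = cells (d w) a.
Proof.
apply: (@eq_FM _ _ _ (d \o cells w) (cells (d w))) => i /=.
by rewrite !cells_ub d_pushs.
Qed.

Lemma supp_cells (J : set I) (B : set 'rV[RR]_k) (A : set T) m w a :
  (forall i, J i -> contOn B (phi i)) -> (forall i x, J i -> B x -> A (phi i x)) ->
  supp (SG B m) w -> supp J a -> supp (SG A m) (cells w a).
Proof.
move=> cB BA hw; apply: supp_lin => i Ji /=; rewrite cells_ub.
by apply: supp_pushs hw; [exact: cB|move=> x; exact: BA].
Qed.
End Cells.

Section Core.
Variables (T : topologicalType) (k : nat) (I : Type) (Z' Z : set T) (J : set I).
Variable phi : I -> 'rV[RR]_k -> T.
Hypothesis at_ : attach Z' Z J phi.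
Variable w : C_ (simp 'rV[RR]_k).
Hypothesis hw : hball (open_disk k) w.
Local Notation V := 'rV[RR]_k.

Let cell i : set T := [set z | exists2 x, open_disk k x & z = phi i x].
Let ctr : set T := [set z | exists2 i, J i & z = phi i 0].
Let E := Z `\` Z'.
Let N := Z `\` ctr.

Implicit Types (c : C_ (simp T)).

Lemma phi_contOn i : J i -> contOn (open_disk k) (phi i).
Proof. by move=> Ji; apply: contOn_sub (att_cont at_ Ji); exact: open_disk_sub. Qed.

Lemma phi_punct i x : J i -> (open_disk k `\ 0) x -> N (phi i x).
Proof. by move=> Ji [/open_disk_sub hx x0]; exact: (phi_N at_ Ji hx x0). Qed.

Lemma push_cpt i m c : J i -> supp (SG (cell i) m) c ->
  supp (SG (open_disk k) m) (pushs (cpt J phi) c) /\ pushs (phi i) (pushs (cpt J phi) c) = c.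
Proof.
move=> Ji hc; split.
  apply: supp_pushs hc; last by move=> z; exact: (cpt_open at_).
  by apply: contOn_sub (cpt_contOn at_) => z; exact: (cellE at_).
rewrite pushs_comp; apply: (pushs_id _ hc) => z; exact: (phi_cpt at_).
Qed.

Lemma push_cpt_punct i m c : J i -> supp (SG (cell i) m) c -> supp (SG N m) c ->
  supp (SG (open_disk k `\ 0) m) (pushs (cpt J phi) c).
Proof.
move=> Ji hc hN.
have hcN : supp (SG (cell i `&` N) m) c by apply: SG_meet hc hN => z; split.
apply: supp_pushs hcN.
  by apply: contOn_sub (cpt_contOn at_) => z [ci _]; exact: (cellE at_ Ji ci).
move=> z [ci [_ nc]]; split; first exact: (cpt_open at_ Ji ci).
by move=> e; apply: nc; exists i => //; rewrite -e (phi_cpt at_).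
Qed.

Lemma cell_gen i m c : J i -> supp (SG (cell i) m.+1) c -> supp (SG N m) (d c) ->
  exists a u v, [/\ c = a *: pushs (phi i) w + d u + v, supp (SG Z m.+2) u,
    supp (SG N m.+1) v & m <> k -> a = 0].
Proof.
move=> Ji hc hdc; have [h1 h2] := push_cpt Ji hc.
have h3 : supp (SG (open_disk k `\ 0) m) (d (pushs (cpt J phi) c)).
  by rewrite d_pushs; apply: (push_cpt_punct Ji) => //; exact: supp_d.
have [a [u [v [e hu hv ha]]]] := hball_gen hw h1 h3.
exists a, (pushs (phi i) u), (pushs (phi i) v); split=> //.
- by rewrite d_pushs -h2 e !raddfD /= linearZ.
- apply: supp_pushs hu; first exact: phi_contOn.
  by move=> x /open_disk_sub; exact: (att_disk at_).
- apply: supp_pushs hv; last by move=> x; exact: phi_punct.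
  by apply: contOn_sub (phi_contOn Ji) => x [].
Qed.

(** A chain involves finitely many cells even if [J] is infinite; the list is the induction variable
    of [cells_gen]. *)
Lemma supp_cell_list m c : supp (SG E m.+1) c ->
  exists F : seq I, supp (fun s => exists i, [/\ List.In i F, J i & SG (cell i) m.+1 s]) c.
Proof.
move: c; apply: supp_ind => [|a s c hs [F IH]]; first by exists [::]; exact: supp0.
have [i Ji hi] := SG_cell at_ hs; exists (i :: F); apply: suppD.
  by apply: suppZ; apply: supp_ub; exists i; split=> //; left.
by apply: supp_sub IH => t [j [h1 h2 h3]]; exists j; split=> //; right.
Qed.

Lemma cells_gen m c : supp (SG E m.+1) c -> supp (SG N m) (d c) ->
  exists a u v, [/\ c = cells phi w a + d u + v, supp J a, supp (SG Z m.+2) u,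
    supp (SG N m.+1) v & m <> k -> a = 0].
Proof.
move=> /supp_cell_list [F]; elim: F c => [|i F IH] c hc hdc.
  have -> : c = 0 by apply: supp_False; apply: supp_sub hc => s [i []].
  by exists 0, 0, 0; split; rewrite ?raddf0 ?addr0 //; exact: supp0.
have [Ji|nJ] := pselect (J i); last first.
  by apply: IH => //; apply: supp_sub hc => s [j [[ij|h] Jj ?]]; [case: nJ; rewrite ij|exists j].
pose c1 := restr (SG (cell i) m.+1) c; pose c2 := c - c1.
have h1 : supp (SG (cell i) m.+1) c1 by exact: supp_restrl.
have h2 : supp (fun s => exists j, [/\ List.In j F, J j, j <> i & SG (cell j) m.+1 s]) c2.
  apply: supp_sub (supp_restrC (P := SG (cell i) m.+1) hc) => s [n [j [h Jj hs]]].
  have ji : j <> i by move=> e; apply: n; rewrite -e.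
  by case: h => [e|h]; [case: ji|exists j].
have h2' : supp (SG (E `\` cell i) m.+1) c2.
  apply: supp_sub h2 => -[|n s] [j [_ Jj ji [] //]] [s1 s2 s3] sm.
  split=> //; split=> // x hx; split; first exact: (cellE at_ Jj (s3 x hx)).
  by move=> ci; apply: ji; apply: (cell_inj at_ Jj Ji (s3 x hx) ci).
have e12 : c = c1 + c2 by rewrite /c2 addrC subrK.
(* The boundaries of the two parts live in disjoint sets, so each of them separately inherits the
   support of [d c]. *)
have hd1 : supp (SG N m) (d c1).
  apply: (@SG_split _ (cell i) (E `\` cell i) N m _ (d c2)); [by move=> z ? []|exact: supp_d|exact: supp_d|].
  by rewrite -raddfD -e12.
have hd2 : supp (SG N m) (d c2) by rewrite /c2 raddfB; exact: suppB.
have [a1 [u1 [v1 [e1 hu1 hv1 ha1]]]] := cell_gen Ji h1 hd1.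
have hF : supp (fun s => exists j, [/\ List.In j F, J j & SG (cell j) m.+1 s]) c2.
  by apply: supp_sub h2 => s [j [? ? _ ?]]; exists j.
have [a2 [u2 [v2 [e2 hJ2 hu2 hv2 ha2]]]] := IH c2 hF hd2.
exists (a1 *: ub i + a2), (u1 + u2), (v1 + v2); split.
- by rewrite linearD linearZ /= cells_ub raddfD /= e12 {1}e1 {1}e2; chain.
- by apply: suppD => //; apply: suppZ; exact: supp_ub.
- exact: suppD.
- exact: suppD.
- by move=> mk; rewrite ha1 // ha2 // scale0r addr0.
Qed.

(** The relation is moved by excision into the open cells, restricted to one cell [i], and pulled
    back by [cpt] to the disk, where [hball_free] gives that the coefficient of [i] is 0. *)
Lemma cells_free a u v : supp J a -> supp (SG Z k.+2) u -> supp (SG N k.+1) v ->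
  cells phi w a = d u + v -> a = 0.
Proof.
move=> Ja hu hv e.
have cW : supp (SG E k.+1) (cells phi w a).
  apply: (supp_cells _ _ (hball_supp hw) Ja); first exact: phi_contOn.
  by move=> i x Ji hx; apply: (@cellE _ _ _ _ _ _ _ at_ i) => //; exists x.
have cdW : supp (SG N k) (d (cells phi w a)).
  rewrite d_cells; apply: (supp_cells _ _ (hball_d hw) Ja) => [i Ji|i x Ji]; last exact: phi_punct.
  by apply: contOn_sub (phi_contOn Ji) => x [].
have [j [u1 [u2 [ej h1 h2]]]] : exists j u1 u2, [/\ iter j Sd u = u1 + u2,
    supp (SG E k.+2) u1 & supp (SG N k.+2) u2].
  apply: (excision (att_cl' at_) (closed_ctr at_) _ hu) => z _ hz /(ctrE at_) [] //.
pose b := Tk j (cells phi w a) + u1.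
have hb : supp (SG E k.+2) b by apply: suppD => //; exact: supp_Tk.
(* [b] contains the subdivision homotopy and the part of the subdivided [u] in the open cells;
   everything else in the relation avoids the centres. *)
have key : supp (SG N k.+1) (cells phi w a - d b).
  have -> : cells phi w a - d b = Tk j (d (cells phi w a)) + d u2 + iter j Sd v.
    rewrite raddfD /= (d_Tk j cW).
    have -> : iter j Sd (cells phi w a) = d u1 + d u2 + iter j Sd v.
      by rewrite e SdkD -d_Sdk ej raddfD.
    by chain.
  by apply: suppD; [apply: suppD; [exact: supp_Tk|exact: supp_d]|exact: supp_Sdk].
apply: cf_ext => i; rewrite cf0.
have [Ji|nJ] := pselect (J i); last exact: (cf_supp Ja nJ).
pose b1 := restr (SG (cell i) k.+2) b; pose b2 := b - b1.
have hb1 : supp (SG (cell i) k.+2) b1 by exact: supp_restrl.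
have hb2 : supp (SG (E `\` cell i) k.+2) b2.
  apply: supp_sub (supp_restrC (P := SG (cell i) k.+2) hb) => s [n hs].
  have [j' Jj hj] := SG_cell at_ hs.
  case: s n hs hj => [|n' s] n [] // [s1 s2 s3] sm [[_ _ s4] _].
  split=> //; split=> // x hx; split; first exact: s3.
  move=> ci; apply: n; split=> //; split=> // y hy.
  by rewrite -(cell_inj at_ Jj Ji (s4 x hx) ci); exact: s4.
pose a2 := a - cf i a *: ub i.
have Ja2 : supp (fun j => J j /\ j <> i) a2.
  move=> j'; rewrite /a2 cfB cfZ cf_ub; case: asboolP => [->|ne].
    by rewrite mulr1 subrr eqxx.
  by rewrite mulr0 subr0 => /Ja; split=> // e'; apply: ne.
have hw1 : supp (SG (cell i) k.+1) (cf i a *: pushs (phi i) w).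
  apply: suppZ; apply: supp_pushs (hball_supp hw); first exact: phi_contOn.
  by move=> x hx; exists x.
have hw2 : supp (SG (E `\` cell i) k.+1) (cells phi w a2).
  apply: (supp_cells _ _ (hball_supp hw) Ja2) => [j' [Jj _]|j' x [Jj ji] hx]; first exact: phi_contOn.
  have cj : cell j' (phi j' x) by exists x.
  by split; [exact: (cellE at_ Jj cj)|move=> ci; apply: ji; exact: (cell_inj at_ Jj Ji cj ci)].
have hx1 : supp (SG (cell i) k.+1) (cf i a *: pushs (phi i) w - d b1).
  by apply: suppB => //; exact: supp_d.
have hx : supp (SG N k.+1) (cf i a *: pushs (phi i) w - d b1).
  apply: (@SG_split _ (cell i) (E `\` cell i) N _ _ (cells phi w a2 - d b2)) => //.
  - by move=> z ? [].
  - by apply: suppB => //; exact: supp_d.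
  - rewrite (_ : _ + _ = cells phi w a - d b) //.
    by rewrite /a2 /b2 !raddfB /= linearZ /= cells_ub; chain.
have [p1 p2] := push_cpt Ji hb1.
have hp := push_cpt_punct Ji hx1 hx.
apply: (hball_free hw p1 hp).
have ew : pushs (cpt J phi) (pushs (phi i) w) = w.
  rewrite pushs_comp; apply: (pushs_id _ (hball_supp hw)) => x; exact: (cptE at_ Ji).
by rewrite raddfB /= linearZ /= ew -d_pushs; chain.
Qed.

Variables z y : C_ (simp V).
Hypothesis zwy : z = w + y.
Hypothesis hdz : supp (SG (sphere k) k) (d z).
Hypothesis hy : supp (SG (disk k `\ 0) k.+1) y.

Lemma supp_cells_N a : supp J a -> supp (SG N k.+1) (cells phi y a).
Proof.
move=> Ja; apply: (supp_cells _ _ hy Ja) => [i Ji|i x Ji [hx x0]]; last exact: (phi_N at_).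
by apply: contOn_sub (att_cont at_ Ji) => x [].
Qed.

Lemma supp_dcells_Z' a : supp J a -> supp (SG Z' k) (d (cells phi z a)).
Proof.
move=> Ja; rewrite d_cells; apply: (supp_cells _ _ hdz Ja) => [i Ji|i x]; last exact: (att_sphere at_).
by apply: contOn_sub (att_cont at_ Ji); exact: sphere_sub.
Qed.

Lemma core_free a u v : supp J a -> supp (SG Z k.+2) u -> supp (SG Z' k.+1) v ->
  cells phi z a = d u + v -> a = 0.
Proof.
move=> Ja hu hv e; apply: (@cells_free a u (v - cells phi y a)) => //.
  by apply: suppB; [exact: supp_SG (Z'N at_) hv|exact: supp_cells_N].
by move: e; rewrite zwy cellsD => e; apply: (addIr (cells phi y a)); rewrite e; chain.
Qed.

(** After excision the part in the open cells is handled by [cells_gen], and the remainder [v']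
    avoids the centres. The radial homotopy [hrad] moves [v'] into [Z']; as [d v'] is already in
    [Z'], where [hrad] is stationary, the prism over it stays there. *)
Lemma core_gen m c : supp (SG Z m.+1) c -> supp (SG Z' m) (d c) ->
  exists a u v, [/\ c = cells phi z a + d u + v, supp J a, supp (SG Z m.+2) u,
    supp (SG Z' m.+1) v & m <> k -> a = 0].
Proof.
move=> hc hdc; have Z'N := Z'N at_.
have [j [c1 [c2 [ej h1 h2]]]] : exists j c1 c2, [/\ iter j Sd c = c1 + c2,
    supp (SG E m.+1) c1 & supp (SG N m.+1) c2].
  by apply: (excision (att_cl' at_) (closed_ctr at_) _ hc) => x _ hx /(ctrE at_) [].
have hd1 : supp (SG N m) (d c1).
  have -> : d c1 = iter j Sd (d c) - d c2 by rewrite -d_Sdk ej raddfD /=; chain.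
  by apply: suppB; [apply: supp_Sdk; exact: supp_SG Z'N hdc|exact: supp_d].
have [a [u1 [v1 [e1 Ja hu1 hv1 ha]]]] := cells_gen h1 hd1.
pose v' := v1 + c2 + Tk j (d c) - cells phi y a.
have ec : c = cells phi z a + d (u1 + Tk j c) + v'.
  have -> : cells phi z a = cells phi w a + cells phi y a by rewrite zwy cellsD.
  rewrite raddfD /= (d_Tk j hc) ej {1}e1 /v'.
  by rewrite [c in LHS](_ : _ = iter j Sd c + (c - iter j Sd c)) ?ej ?e1; chain.
have hv' : supp (SG N m.+1) v'.
  apply: suppB.
    by apply: suppD; [exact: suppD|apply: supp_Tk; exact: supp_SG Z'N hdc].
  have [->|/ha ->] := pselect (m = k); first exact: supp_cells_N.
  by rewrite raddf0; exact: supp0.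
have hdv' : supp (SG Z' m) (d v').
  have -> : d v' = d c - d (cells phi z a) by have -> := congr1 d ec; rewrite [in RHS]raddfD /= [in RHS]raddfD /= dd; chain.
  apply: suppB => //; have [->|/ha ->] := pselect (m = k); first exact: supp_dcells_Z'.
  by rewrite !raddf0; exact: supp0.
pose h := hrad J phi.
have hcN : contOn (N `*` I01) (fun z : (T * RR^o)%type => h z.1 z.2) := hrad_contOn at_.
have hcZ : contOn (Z' `*` I01) (fun z : (T * RR^o)%type => h z.1 z.2).
  by apply: contOn_sub hcN => -[x t] [hx ht]; split=> //; exact: Z'N.
(* The prism formula, solved for [v']. *)
exists a, (u1 + Tk j c - prism h v'), (pushs (h^~ 1) v' - prism h (d v')); split=> //.
- have e0 : pushs (h^~ 0) v' = v' by apply: (pushs_id _ hv') => x; exact: (hrad0 at_).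
  by rewrite [LHS]ec [in RHS]raddfB /= d_prism e0; chain.
- apply: suppB; first by apply: suppD => //; exact: supp_Tk.
  apply: (@supp_SG _ N); first by move=> x [].
  by apply: supp_prism hcN _ hv' => x t; exact: (hrad_N at_).
- apply: suppB.
    apply: supp_pushs hv'; last by move=> x; exact: (hrad1 at_).
    apply: (contOn_slice (B := I01) (f := fun z : (T * RR^o)%type => h z.1 z.2)) hcN.
    by rewrite /I01 /= ler01 lexx.
  by apply: supp_prism hcZ _ hdv' => x t hx _; rewrite /h (hrad_Z' at_).
Qed.

End Core.

Lemma closed_list (T : topologicalType) (I : Type) (l : seq I) (F : I -> set T) :
  (forall i, List.In i l -> closed (F i)) -> closed [set x | exists2 i, List.In i l & F i x].
Proof.
elim: l => [|i l IH] h.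
  by rewrite (_ : [set _ | _] = set0); [exact: closed0|rewrite -subset0 => x [j []]].
rewrite (_ : [set _ | _] = F i `|` [set x | exists2 i, List.In i l & F i x]).
  by apply: closedU; [apply: h; left|apply: IH => j hj; apply: h; right].
apply/seteqP; split=> x.
  by move=> [j [<-|hj] hx]; [left|right; exists j].
by move=> [hx|[j hj hx]]; [exists i => //; left|exists j => //; right].
Qed.

Lemma open_disk_dense k (A : set 'rV[RR]_k) : closed A -> open_disk k `<=` A -> disk k `<=` A.
Proof.
move=> cA oA x hx; apply: cA => U hU.
have h : continuous (fun t : RR => t *: x).
  by move=> t; apply: (@cvgZr_tmp _ _ _ (nbhs t)); exact: cvg_id.
have hU1 : nbhs (1 *: x) U by rewrite scale1r.
have h1' : nbhs (1 : RR) [set t : RR | U (t *: x)] := h 1 _ hU1.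
have /nbhs_ballP [e /= e0 he] := h1'.
pose t : RR := Num.max 0 (1 - e / 2).
have t1 : 0 <= t < 1 by rewrite le_max lexx /= gt_max ltr01 /= ltrBlDr ltrDl divr_gt0.
have [t0 t1'] := andP t1.
exists (t *: x); split; last first.
  apply: (he t); rewrite /ball /= ger0_norm ?subr_ge0 ?ltW //.
  rewrite ltrBlDr -ltrBlDl lt_max; apply/orP; right; rewrite ltrD2l ltrN2.
  by rewrite ltr_pdivrMr // ltr_pMr // ltr1n.
apply: oA; rewrite /open_disk /= -/(sqn _) sqnZ.
have s0 := sqn_ge0 x; have s1 : sqn x <= 1 := hx.
have : t ^+ 2 < 1 by rewrite expr_lt1.
by nra.
Qed.

Lemma contOn_disk_ext k (T : topologicalType) (f g : 'rV[RR]_k -> T) :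
  hausdorff_space T -> contOn (disk k) f -> contOn (disk k) g ->
  (forall x, open_disk k x -> f x = g x) -> forall x, disk k x -> f x = g x.
Proof.
move=> hT cf cg fg x hx.
suff : disk k `<=` [set x | disk k x /\ f x = g x] by move=> /(_ x hx) [].
apply: open_disk_dense; last by move=> y hy; split; [exact: open_disk_sub|exact: fg].
move=> y hy; have dy : disk k y by apply: (@closed_disk k) => W /hy [z [[hz _] Wz]]; exists z.
split=> //; apply: hT => A B hA hB.
have [z [[dz e] [Az Bz]]] := hy _ (filterI (cf y dy A hA) (cg y dy B hB)).
by exists (f z); split; [exact: Az|rewrite e; exact: Bz].
Qed.

(* The choice made by [cid] depends on the predicate only; applied to the predicate
   "lies in the orbit of [i]", it is constant on orbits. *)
Lemma cid_ext (I : Type) (P Q : I -> Prop) (p : exists x, P x) (q : exists x, Q x) :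
  P = Q -> projT1 (cid p) = projT1 (cid q).
Proof. by move=> e; subst Q; rewrite (Prop_irrelevance p q). Qed.

(** * The skeletal filtration of a G-CW complex *)

Section GCW.
Variables (gT : finGroupType) (T : topologicalType) (act : gT -> T -> T).
Variables (I : Type) (dim : I -> nat) (phi : forall i, 'rV[RR]_(dim i) -> T).
Hypothesis gcw : is_GCW act dim phi.

Local Notation e i := (open_cell (phi (i := i))).

Lemma act1 x : act 1%g x = x. Proof. by have [[]] := gcw. Qed.
Lemma actM g h x : act (g * h)%g x = act g (act h x). Proof. by have [[]] := gcw. Qed.
Lemma act_cont g : continuous (act g). Proof. by have [[]] := gcw. Qed.
Lemma actK g x : act g^-1%g (act g x) = x. Proof. by rewrite -actM mulVg act1. Qed.
Lemma haus : hausdorff_space T. Proof. by have [_ [[]]] := gcw. Qed.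
Lemma phi_cont i : contOn (disk (dim i)) (phi (i := i)).
Proof. by have [_ [[_ h] _ _ _ _] _ _] := gcw; apply/contOnP; exact: h. Qed.
Lemma phi_inj i x y : open_disk (dim i) x -> open_disk (dim i) y ->
  phi x = phi y -> x = y.
Proof.
have [_ [_ /(_ i) [h _] _ _ _] _ _] := gcw => hx hy.
by apply: h; rewrite inE.
Qed.
Lemma cell_cover x : exists i, e i x.
Proof. by have [_ [_ _ [h _] _ _] _ _] := gcw. Qed.
Lemma cell_uniq i j x : e i x -> e j x -> i = j.
Proof. by have [_ [_ _ [_ h] _ _] _ _] := gcw; exact: h. Qed.
Lemma cell_ctr i : e i (phi (0 : 'rV_(dim i))).
Proof. by exists 0 => //; exact: open_disk0. Qed.

Lemma gaP g i : exists j, act g @` e i = e j.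
Proof. by have [_ _ h _] := gcw; exact: h. Qed.
Definition ga g i := projT1 (cid (gaP g i)).
Lemma gaE g i : act g @` e i = e (ga g i). Proof. exact: projT2 (cid (gaP g i)). Qed.
Lemma ga_cell g i x : e i x -> e (ga g i) (act g x).
Proof. by rewrite -gaE => h; exists x. Qed.
Lemma ga_uniq g i j x : e i x -> e j (act g x) -> ga g i = j.
Proof. by move=> /(ga_cell g) h; exact: cell_uniq. Qed.
Lemma ga1 i : ga 1%g i = i.
Proof. by apply: (ga_uniq (cell_ctr i)); rewrite act1; exact: cell_ctr. Qed.
Lemma gaM g h i : ga (g * h)%g i = ga g (ga h i).
Proof. by apply: (ga_uniq (cell_ctr i)); rewrite actM; do 2! apply: ga_cell; exact: cell_ctr. Qed.
Lemma gaK g i : ga g^-1%g (ga g i) = i. Proof. by rewrite -gaM mulVg ga1. Qed.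
Lemma ga_fix g i x : ga g i = i -> e i x -> act g x = x.
Proof. by move=> h; have [_ _ _ hf] := gcw; apply: hf; rewrite gaE h. Qed.

(** A representative of least [dim] is taken because the cells of an orbit are not assumed to have
    the same dimension; [gdim] then assigns this least value to the whole orbit. *)
Lemma repP i : exists j, (exists g, j = ga g i) /\ forall g, (dim j <= dim (ga g i))%N.
Proof.
have : exists n, `[< exists g, dim (ga g i) = n >].
  by exists (dim i); apply/asboolP; exists 1%g; rewrite ga1.
move=> /ex_minnP [n /asboolP [g <-] h]; exists (ga g i); split; first by exists g.
by move=> g'; apply: h; apply/asboolP; exists g'.
Qed.
Definition rep i := projT1 (cid (repP i)).
Lemma repE i : exists g, rep i = ga g i. Proof. by have [] := projT2 (cid (repP i)). Qed.
Lemma rep_ga g i : rep (ga g i) = rep i.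
Proof.
apply: cid_ext; apply/funext => j; apply/propext; split=> -[[h ->] hm]; split.
- by exists (h * g)%g; rewrite gaM.
- by move=> h'; have := hm (h' * g^-1)%g; rewrite gaM gaK.
- by exists (h * g^-1)%g; rewrite gaM gaK.
- by move=> h'; rewrite -gaM; exact: hm.
Qed.
Lemma rep_rep i : rep (rep i) = rep i.
Proof. by have [g eg] := repE i; rewrite {1}eg rep_ga. Qed.
Lemma gselP i : exists g, ga g (rep i) = i.
Proof. by have [g ->] := repE i; exists g^-1%g; rewrite gaK. Qed.
Definition gsel i := projT1 (cid (gselP i)).
Lemma gselE i : ga (gsel i) (rep i) = i. Proof. exact: projT2 (cid (gselP i)). Qed.
Definition gdim i := dim (rep i).
Lemma gdim_ga g i : gdim (ga g i) = gdim i. Proof. by rewrite /gdim rep_ga. Qed.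
Lemma gdim_rep i : gdim (rep i) = gdim i. Proof. by rewrite /gdim rep_rep. Qed.
Lemma gdim_le i : (gdim i <= dim i)%N.
Proof. by have [_ /(_ 1%g)] := projT2 (cid (repP i)); rewrite ga1. Qed.

(* [conform_mx] casts a vector of length [k] to length [gdim i] when these agree;
   it makes the characteristic maps of all [k]-cells have one common source. *)
Definition gphi k i (x : 'rV[RR]_k) : T :=
  act (gsel i) (phi (conform_mx (0 : 'rV[RR]_(dim (rep i))) x)).

Lemma gphiE i x : gphi i x = act (gsel i) (phi (i := rep i) x).
Proof. by rewrite /gphi conform_mx_id. Qed.

Lemma gphi_cont i : contOn (disk (gdim i)) (gphi i).
Proof.
apply: (@contOn_eq _ _ _ (act (gsel i) \o phi (i := rep i))); first by move=> x _; rewrite gphiE.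
by apply: contOn_comp (phi_cont (i := rep i)) (contOnT (A := setT) (@act_cont _)) _.
Qed.

Lemma cell_rep i : e i = act (gsel i) @` e (rep i).
Proof. by rewrite gaE gselE. Qed.

Lemma gphi_open i x : open_disk (gdim i) x -> e i (gphi i x).
Proof.
move=> hx; rewrite gphiE cell_rep.
by exists (phi (i := rep i) x) => //; exists x.
Qed.

Lemma gphi_cell i z : e i z -> exists2 x, open_disk (gdim i) x & z = gphi i x.
Proof. by rewrite cell_rep => -[_ [x hx <-] <-]; exists x; rewrite ?gphiE. Qed.

Lemma gphi_inj i x y : open_disk (gdim i) x -> open_disk (gdim i) y ->
  gphi i x = gphi i y -> x = y.
Proof.
by move=> hx hy; rewrite !gphiE => /(congr1 (act (gsel i)^-1%g)); rewrite !actK; exact: phi_inj.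
Qed.

(** The index is one more than the dimension, so that the filtration starts with the empty set. *)
Definition skel k : set T := [set x | exists2 i, (gdim i < k)%N & e i x].

Lemma skel_act g k x : skel k x -> skel k (act g x).
Proof. by move=> [i hi hx]; exists (ga g i); [rewrite gdim_ga|exact: ga_cell]. Qed.

Lemma skel_sub k l : (k <= l)%N -> skel k `<=` skel l.
Proof. by move=> kl x [i hi hx]; exists i => //; exact: leq_trans kl. Qed.

(** Here the least dimension pays off: the boundary of the representative is covered by cells of
    smaller [dim], and [gdim] is at most [dim], so these lie in the skeleton. *)
Lemma gphi_sphere i x : sphere (gdim i) x -> skel (gdim i) (gphi i x).
Proof.
move=> hx; rewrite gphiE; apply: skel_act.
have [_ [_ _ _ h _] _ _] := gcw; have [m [J [hd hJ]]] := h (rep i).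
have [k _ hk] : (\bigcup_k open_cell (phi (i := J k))) (phi (i := rep i) x) by apply: hJ; exists x.
by exists (J k) => //; exact: leq_ltn_trans (gdim_le _) (hd k).
Qed.

Lemma gphi_disk i x : disk (gdim i) x -> skel (gdim i).+1 (gphi i x).
Proof.
move=> /disk_cases [hx|/gphi_sphere h]; last exact: skel_sub h.
by exists i => //; exact: gphi_open.
Qed.

Lemma phi_finite i : exists l : seq I, phi (i := i) @` disk (dim i) `<=`
  [set x | exists2 j, List.In j l & e j x].
Proof.
have [_ [_ _ _ h _] _ _] := gcw; have [m [J [hd hJ]]] := h i.
exists (i :: [seq J k | k <- enum 'I_m]) => _ [x /disk_cases [hx|hx] <-].
  by exists i; [left|exists x].
have [k _ hk] : (\bigcup_k open_cell (phi (i := J k))) (phi x) by apply: hJ; exists x.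
exists (J k) => //; right; apply/List.in_map_iff; exists k; split=> //.
have := mem_enum 'I_m k; elim: (enum _) => //= y s IH; rewrite !inE => /orP[/eqP ->|].
  by left.
by move=> ks; right; apply: IH.
Qed.

Lemma closed_gphi (U : set T) i : closed (disk (gdim i) `&` gphi i @^-1` U) ->
  closed (U `&` gphi i @` disk (gdim i)).
Proof.
move=> cU.
rewrite (_ : _ `&` _ = gphi i @` (disk (gdim i) `&` gphi i @^-1` U)); last first.
  apply/seteqP; split=> x; first by move=> [Ux [y hy ey]]; exists y => //; split=> //; rewrite /preimage /= ey.
  by move=> [y [hy Uy] <-]; split=> //; exists y.
apply: compact_closed; first exact: haus.
apply: continuous_compact; last first.
  by apply: subclosed_compact cU (@compact_disk _) _ => x [].
by apply/contOnP; apply: contOn_sub (@gphi_cont i) => x [].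
Qed.

Lemma closed_cell i : closed (gphi i @` disk (gdim i)).
Proof.
rewrite -[X in closed X]setTI; apply: closed_gphi; rewrite preimage_setT setIT.
exact: closed_disk.
Qed.

Lemma weak_closed (A : set T) :
  (forall i, closed (A `&` phi (i := i) @` disk (dim i))) -> closed A.
Proof.
move=> h; have [_ [_ _ _ _ hw] _ _] := gcw; apply/hw => i.
rewrite (_ : _ `&` _ = disk (dim i) `&` phi (i := i) @^-1` (A `&` phi (i := i) @` disk (dim i))).
  by apply: contOn_closed; [exact: closed_disk|exact: h|exact: phi_cont].
apply/seteqP; split=> x [hx Ax]; split=> //; last by case: Ax.
Qed.

Lemma closed_phi i : closed (phi (i := i) @` disk (dim i)).
Proof.
apply: compact_closed; first exact: haus.
apply: continuous_compact; last exact: compact_disk.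
by apply/contOnP; exact: phi_cont.
Qed.

(** The weak topology is given by the maps [phi], the skeleta are built with [gphi]. Closure
    finiteness links them: the image of a disk under [phi] meets finitely many open cells, each
    contained in the closed image of a disk under [gphi]. *)
Lemma closed_by_cells (A B : set T) (S : set I) :
  closed B -> B `<=` A -> (forall x, A x -> B x \/ exists2 i, S i & e i x) ->
  (forall i, S i -> closed (A `&` gphi i @` disk (gdim i))) -> closed A.
Proof.
move=> cB BA hA hS; apply: weak_closed => i.
have [l hl] := phi_finite i.
pose F j := if `[< S j >] then A `&` gphi j @` disk (gdim j) else set0.
rewrite (_ : _ `&` _ = phi (i := i) @` disk (dim i) `&`
    (B `|` [set x | exists2 j, List.In j l & F j x])).
  apply: closedI; first exact: closed_phi.
  apply: closedU => //; apply: closed_list => j _; rewrite /F.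
  by case: asboolP => [Sj|_]; [exact: hS|exact: closed0].
apply/seteqP; split=> x [h1 h2]; split=> //.
  case: (hA x h1) => [Bx|[j Sj hj]]; [by left|right; exists j].
    by have [j' hj' ej'] := hl _ h2; rewrite (cell_uniq hj ej').
  rewrite /F; case: asboolP => // _; split=> //.
  by have [y hy ->] := gphi_cell hj; exists y => //; exact: open_disk_sub.
case: h2 => [/BA //|[j _]]; rewrite /F; case: asboolP => // _ [] //.
Qed.

Lemma closed_skel k : closed (skel k).
Proof.
apply: (@closed_by_cells _ set0 [set i | (gdim i < k)%N]); first exact: closed0.
- by [].
- by move=> x [i hi hx]; right; exists i.
- move=> i hi; rewrite (_ : _ `&` _ = gphi i @` disk (gdim i)); first exact: closed_cell.
  apply/seteqP; split=> x; first by case.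
  by move=> h; split=> //; case: h => y hy <-; apply: skel_sub hi _ _; exact: gphi_disk.
Qed.

Definition fixs g : set T := [set x | act g x = x].

Lemma closed_fixs g : closed (fixs g).
Proof.
move=> x hx; apply: haus => A B hA hB.
have hA' : nbhs x (act g @^-1` A) := @act_cont g x A hA.
have [y [ey [Ay By]]] := hx _ (filterI hA' hB).
by exists y; split=> //; rewrite -ey.
Qed.

Lemma gphi_fix g i x : ga g i = i -> disk (gdim i) x -> act g (gphi i x) = gphi i x.
Proof.
move=> gi; apply: (contOn_disk_ext haus (f := act g \o gphi i)).
- by apply: contOn_comp (@gphi_cont i) (contOnT (A := setT) (@act_cont g)) _.
- exact: gphi_cont.
- by move=> y hy /=; apply: (ga_fix gi); exact: gphi_open.
Qed.

(** [g * gsel i] and [gsel (ga g i)] both carry the representative cell to [ga g i]; they differ by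
    an element that stabilises this cell and hence fixes it pointwise. Density extends the equality
    to the closed disk. *)
Lemma gphi_act g i x : disk (gdim i) x -> act g (gphi i x) = gphi (ga g i) x.
Proof.
have hd : gdim (ga g i) = gdim i := gdim_ga g i.
apply: (contOn_disk_ext haus (f := act g \o gphi i) (g := gphi (ga g i))).
- by apply: contOn_comp (@gphi_cont i) (contOnT (A := setT) (@act_cont g)) _.
- by have := @gphi_cont (ga g i); rewrite hd.
- move=> y hy /=; rewrite /gphi.
  move: (gselE (ga g i)); move: (gsel (ga g i)); rewrite rep_ga => h hh.
  rewrite conform_mx_id -actM.
  have hfix : act (h^-1 * (g * gsel i))%g (phi (i := rep i) y) = phi (i := rep i) y.
    apply: (@ga_fix _ (rep i)); last by exists y.
    by rewrite !gaM gselE -{1}hh gaK.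
  by rewrite -[in RHS]hfix -actM mulKVg.
Qed.

(** With [g] the identity this is the skeletal filtration itself. For general [g] it is what shows
    that the cellular boundary of a fixed cell involves fixed cells only. *)
Lemma attach_fixs g k : attach (skel k `&` fixs g) (skel k.+1 `&` fixs g)
  [set i | gdim i = k /\ ga g i = i] (@gphi k).
Proof.
split.
- by move=> x [/(skel_sub (leqnSn k))].
- by apply: closedI; [exact: closed_skel|exact: closed_fixs].
- by move=> i [hi _]; subst k; exact: gphi_cont.
- by move=> i x [hi gi]; subst k => hx; split; [exact: gphi_disk|exact: gphi_fix].
- move=> i x [hi gi]; subst k => hx; split; first exact: gphi_sphere.
  by apply: gphi_fix => //; exact: sphere_sub.
- move=> i x [hi gi]; subst k => hx [[j hj hxj] _].
  by move: hj; rewrite (cell_uniq hxj (gphi_open hx)) ltnn.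
- move=> i j x y [hi gi] [hj gj]; subst k => hx hy exy.
  have ij : i = j.
    apply: (cell_uniq (gphi_open hx)); rewrite exy; move: y hy {exy}; rewrite -hj => y hy.
    exact: gphi_open.
  by subst j; split=> //; exact: gphi_inj exy.
- move=> z [[i]]; rewrite ltnS leq_eqVlt => /orP[/eqP hi|hi] hz fz; last first.
    by left; split=> //; exists i.
  subst k; right; exists i; have [x hx ex] := gphi_cell hz; exists x; split=> //.
  by split=> //; apply: (ga_uniq hz); rewrite fz.
- move=> U hU c1 c2.
  apply: (@closed_by_cells _ (U `&` (skel k `&` fixs g)) [set i | gdim i = k /\ ga g i = i]) => //.
  + move=> x Ux; have [[i hi hx] fx] := hU x Ux.
    move: hi; rewrite ltnS leq_eqVlt => /orP[/eqP hi|hi].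
      by right; exists i => //; split=> //; apply: (ga_uniq hx); rewrite fx.
    by left; split=> //; split=> //; exists i.
  + by move=> i [hi gi]; subst k; apply: closed_gphi; exact: c2.
Qed.

Variables (Y : topologicalType) (p : T -> Y).
Hypothesis hp : is_orbit_space act p.

Lemma p_surj y : exists x, p x = y. Proof. by have [] := hp. Qed.
Lemma p_eq x x' : p x = p x' <-> exists g, act g x = x'. Proof. by have [] := hp. Qed.
Lemma p_act g x : p (act g x) = p x. Proof. by apply/esym/p_eq; exists g. Qed.
Lemma p_closed U : closed U <-> closed (p @^-1` U).
Proof.
have [_ _ h] := hp; split=> cU.
  rewrite (_ : p @^-1` U = ~` (p @^-1` (~` U))).
    by apply/open_closedC/h; exact: closed_openC.
  by apply/seteqP; split=> x; [move=> Ux; apply|exact: contrapT].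
by rewrite -[U]setCK; apply/open_closedC/h; exact: (closed_openC cU).
Qed.
Lemma p_cont : continuous p.
Proof. by apply/continuousP => U oU; have [_ _ h] := hp; apply/h. Qed.

Definition oskel k : set Y := p @` skel k.

Lemma p_oskel k x : oskel k (p x) <-> skel k x.
Proof.
split; last by exists x.
by move=> [x' hx' /p_eq [g <-]]; exact: skel_act.
Qed.

Lemma closed_oskel k : closed (oskel k).
Proof.
apply/p_closed; rewrite (_ : _ @^-1` _ = skel k); first exact: closed_skel.
by apply/seteqP; split=> x /p_oskel.
Qed.

Lemma p_gphi k i x : p (gphi (k := k) i x) = p (gphi (rep i) x).
Proof. by rewrite /gphi !p_act rep_rep. Qed.

Lemma attach_orbit k : attach (oskel k) (oskel k.+1)
  [set i | gdim i = k /\ rep i = i] (fun i => p \o @gphi k i).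
Proof.
have at1 := attach_fixs 1%g k.
have fixT : fixs 1%g = setT by apply/seteqP; split=> x // _; exact: act1.
rewrite fixT !setIT in at1.
split.
- by move=> y [x hx <-]; apply/p_oskel; exact: skel_sub (leqnSn k) _ hx.
- exact: closed_oskel.
- move=> i [hi _]; subst k; apply: contOn_comp (@gphi_cont i) (contOnT (A := setT) p_cont) _ => //.
- by move=> i x [hi _]; subst k => hx; apply/p_oskel; exact: gphi_disk.
- by move=> i x [hi _]; subst k => hx; apply/p_oskel; exact: gphi_sphere.
- by move=> i x [hi _] hx /p_oskel; apply: (att_open at1) => //; split=> //; exact: ga1.
(* A coincidence below lifts to one upstairs between [ga g i] and [j]; the two cells are then equal,
   and so are their representatives. *)
- move=> i j x y [hi ri] [hj rj] hx hy /= /p_eq [g].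
  move=> exy; have exy' : gphi (ga g i) x = gphi j y.
    by rewrite -exy; subst k; rewrite gphi_act //; exact: open_disk_sub.
  have [] := att_inj at1 _ _ hx hy exy'.
  - by split; [rewrite gdim_ga|exact: ga1].
  - by split=> //; exact: ga1.
  - by move=> gij ->; split=> //; rewrite -ri -rj -gij rep_ga.
- move=> _ [z hz <-]; case: (att_cover at1 hz) => [hz'|[i [x [[hi _] hx ->]]]].
    by left; apply/p_oskel.
  right; exists (rep i), x; split=> //; first by rewrite /= gdim_rep rep_rep.
  exact: p_gphi.
- move=> U hU c1 c2; apply/p_closed; apply: (att_closed at1).
  + by move=> x /hU /p_oskel.
  + rewrite (_ : _ `&` _ = p @^-1` (U `&` oskel k)); first by apply/p_closed.
    apply/seteqP; split=> x [h1 h2]; (split; first exact: h1).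
      exact: (iffRL (p_oskel k x) h2).
    exact: (iffLR (p_oskel k x) h2).
  + move=> i [hi _]; have := c2 (rep i); rewrite /= gdim_rep rep_rep => /(_ (conj hi erefl)).
    rewrite (_ : _ `&` _ = disk k `&` gphi i @^-1` (p @^-1` U)) //.
    by apply/seteqP; split=> x [h1 h2]; split=> //; move: h2; rewrite /preimage /= (p_gphi i x).
Qed.

Lemma gphi_act_k k g i x : gdim i = k -> disk k x ->
  act g (gphi (k := k) i x) = gphi (ga g i) x.
Proof. by move=> hi; subst k; exact: gphi_act. Qed.

Lemma skel0 : skel 0 = set0.
Proof. by rewrite -subset0 => x []. Qed.

Lemma skel_top N : (forall i, (dim i <= N)%N) -> skel N.+1 = setT.
Proof.
move=> h; apply/seteqP; split=> x // _; have [i hi] := cell_cover x.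
by exists i => //; rewrite ltnS; exact: leq_trans (gdim_le i) (h i).
Qed.

End GCW.

(** * Smith theory *)

Section Smith.
Variables (p : nat) (p_pr : prime p) (k : fieldType) (chk : p \in [pchar k]).
Variables (B : Type) (deg : B -> nat) (top : nat).
Local Notation C := (FM k B).
Variables (D : {linear C -> C}) (z : B -> B).
Hypothesis deg_top : forall b, (deg b <= top)%N.
Hypothesis zp : forall b, iter p z b = b.
Hypothesis deg_z : forall b, deg (z b) = deg b.
Implicit Types (c : C).
(** Degrees enter only through this filtration, so no graded modules are formed, and the descending
    induction starts above [top], where [S n] is zero. *)
Local Notation S n := (supp (fun b => (n <= deg b)%N)).
Hypothesis D_deg : forall n c, S n.+1 c -> S n (D c).
Hypothesis DD : forall c, D (D c) = 0.
Hypothesis D_z : forall c, D (mapf z c) = mapf z (D c).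
Hypothesis D_fix : forall b, z b = b -> supp (fun b' => z b' = b') (D (ub b)).
Hypothesis exactD : forall n c, S n c -> D c = 0 -> exists2 e, S n.+1 e & D e = c.

Let p0 : (0 < p)%N := prime_gt0 p_pr.
Let p1 : (1 < p)%N := prime_gt1 p_pr.

Definition tau (c : C) : C := c - mapf z c.
Lemma tau_linear : linear tau.
Proof. by move=> a x y; rewrite /tau linearP scalerBr opprD addrACA. Qed.
HB.instance Definition _ := GRing.isLinear.Build k C C *:%R tau tau_linear.

Definition tauk i (c : C) : C := iter i tau c.
Lemma tauk_linear i : linear (tauk i).
Proof. by elim: i => [|i IH] a x y //=; rewrite /tauk /= -!/(tauk _ _) IH linearP. Qed.
HB.instance Definition _ i := GRing.isLinear.Build k C C *:%R (tauk i) (tauk_linear i).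

Lemma taukD i j c : tauk (i + j) c = tauk i (tauk j c). Proof. exact: iterD. Qed.

Lemma D_tauk i c : D (tauk i c) = tauk i (D c).
Proof. by elim: i => //= i <-; rewrite /tau raddfB /= D_z. Qed.

Lemma S_mapz n c : S n c -> S n (mapf z c).
Proof. by apply: supp_mapf => b; rewrite deg_z. Qed.
Lemma S_tauk n i c : S n c -> S n (tauk i c).
Proof. by move=> h; elim: i => //= i IH; apply: suppB => //; exact: S_mapz. Qed.

Definition fixz b := z b = b.
Local Notation F := (supp fixz).

Lemma zK b : z (iter p.-1 z b) = b. Proof. by rewrite -iterS prednK. Qed.
Lemma z_inj : injective z.
Proof.
move=> b b' e; have := congr1 (iter p.-1 z) e.
by rewrite -!iterSr prednK // !zp.
Qed.

(** [m] is coprime to [p], so by Bezout [z] is a combination of the powers [m] and [p], both of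
    which fix [b]. Orbits thus have 1 or [p] elements. *)
Lemma iter_z_fix b m : (0 < m < p)%N -> iter m z b = b -> z b = b.
Proof.
move=> /andP[m0 mp] h.
have iter_mul j l b' : iter l z b' = b' -> iter (j * l) z b' = b'.
  by move=> hl; elim: j => // j IH; rewrite mulSn iterD IH.
have cop : coprime m p by rewrite coprime_sym prime_coprime // gtnNdvd.
have [u v e _] := egcdnP p m0; move: e; rewrite (eqP cop) => e.
have := iter_mul u m b h; rewrite e addn1 iterS (iter_mul v p) //.
Qed.

Lemma zrepP b : exists b', exists i, b' = iter i z b. Proof. by exists b, 0%N. Qed.
Definition zrep b := projT1 (cid (zrepP b)).
Lemma zrepE b : exists i, zrep b = iter i z b. Proof. exact: projT2 (cid (zrepP b)). Qed.
Lemma zrep_z b : zrep (z b) = zrep b.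
Proof.
apply: cid_ext; apply/funext => b'; apply/propext; split=> -[i ->].
  by exists i.+1; rewrite iterSr.
by exists (i + p.-1)%N; rewrite iterD -iterSr prednK // zp.
Qed.
Lemma zrep_iter i b : zrep (iter i z b) = zrep b.
Proof. by elim: i => //= i IH; rewrite zrep_z. Qed.
Lemma zrep_ltp b : exists2 i, (i < p)%N & iter i z b = zrep b.
Proof.
have [i ->] := zrepE b; exists (i %% p)%N; first by rewrite ltn_mod.
rewrite [in RHS](divn_eq i p) addnC iterD; congr (iter _ z).
by elim: (i %/ p)%N => // j IH; rewrite mulSn iterD -IH zp.
Qed.

Definition sig (c : C) : C := \sum_(i < p) mapf (iter i z) c.
Lemma sig_linear : linear sig.
Proof.
move=> a x y; rewrite /sig scaler_sumr -big_split; apply: eq_bigr => i _ /=.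
by rewrite linearP.
Qed.
HB.instance Definition _ := GRing.isLinear.Build k C C *:%R sig sig_linear.

(** Cancel [1 - 'X] from the identity of its [p]-th power with [1 - 'X ^+ p], which holds by
    Frobenius. *)
Lemma poly_tau : (1 - 'X) ^+ p.-1 = \sum_(i < p) 'X^i :> {poly k}.
Proof.
have hX : (1 - 'X : {poly k}) != 0.
  by rewrite -oppr_eq0 opprB -polyC1 polyXsubC_eq0.
apply: (mulfI hX); rewrite -exprS prednK //.
have chp : p \in [pchar {poly k}] by exact: (rmorph_pchar (@polyC k)).
have -> : (1 - 'X) ^+ p = 1 - 'X ^+ p :> {poly k}.
  by rewrite -(pFrobenius_autE chp) rmorphB /= rmorph1 pFrobenius_autE.
rewrite -opprB subrX1 -mulNr opprB; congr (_ * _); exact: eq_bigr.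
Qed.

Lemma tauk_poly n c : tauk n c =
  \sum_(i < n.+1) ((1 - 'X : {poly k}) ^+ n)`_i *: mapf (iter i z) c.
Proof.
elim: n => [|n IH].
  rewrite big_ord1 expr0 coef1 eqxx scale1r /tauk /=.
  by rewrite (@mapf_id _ _ _ (fun=> True)).
rewrite /tauk iterS -/(tauk n c) IH /tau.
set q := (1 - 'X) ^+ n; have sq : q`_n.+1 = 0.
  apply: nth_default; apply: leq_trans (size_poly_exp_leq _ _) _.
  have : (size (1 - 'X : {poly k})%R <= 2)%N.
    by rewrite -size_polyN opprB -polyC1 size_XsubC.
  by move: (size _) => [|[|[|s]]] // _; rewrite ?mul1n ?mul0n.
rewrite raddf_sum /= [in RHS]exprS.
have -> : \sum_(i < n.+2) ((1 - 'X) * q)`_i *: mapf (iter i z) c =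
    \sum_(i < n.+2) q`_i *: mapf (iter i z) c - \sum_(i < n.+2) ('X * q)`_i *: mapf (iter i z) c.
  by rewrite -sumrB; apply: eq_bigr => i _; rewrite mulrBl mul1r coefB scalerBl.
congr (_ - _).
  by rewrite [in RHS]big_ord_recr /= sq scale0r addr0.
rewrite [in RHS]big_ord_recl /= coefXM eqxx scale0r add0r; apply: eq_bigr => i _.
by rewrite linearZ /= coefXM /= mapf_comp.
Qed.

Lemma tau_sig c : tauk p.-1 c = sig c.
Proof.
rewrite tauk_poly /sig prednK //; apply: eq_bigr => i _.
rewrite poly_tau coef_sum (bigD1 i) //= coefXn eqxx big1 ?addr0 ?scale1r // => j ji.
by rewrite coefXn eq_sym -val_eqE /= in ji *; rewrite (negbTE ji).
Qed.

Lemma mapz_sig c : mapf z (sig c) = sig c.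
Proof.
rewrite /sig raddf_sum /=.
under eq_bigr do rewrite mapf_comp.
rewrite -(prednK p0) big_ord_recr [in RHS]big_ord_recl /= addrC; congr (_ + _).
by congr (mapf _ c); apply/funext => b /=; exact: zK.
Qed.

Lemma taukp i c : (p <= i)%N -> tauk i c = 0.
Proof.
move=> hi; rewrite -(subnK hi) taukD.
have -> : tauk p c = 0; last by rewrite raddf0.
by rewrite -(prednK p0) /tauk iterS -/(tauk p.-1 c) tau_sig /tau mapz_sig subrr.
Qed.

Lemma cf_mapz i b c : cf (iter i z b) (mapf (iter i z) c) = cf b c.
Proof. by apply: cf_mapf; elim: i => // i IH x y /= /z_inj /IH. Qed.

Lemma F_tau c : F c -> tau c = 0.
Proof. by move=> h; rewrite /tau (@mapf_id _ _ _ fixz) // subrr. Qed.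

Lemma restr_mapz c : restr fixz (mapf z c) = restr fixz c.
Proof.
apply: cf_ext => b; rewrite !cf_restr; case: asboolP => // fb.
by rewrite -{1}fb (cf_mapz 1).
Qed.

Lemma restr_tau i c : (0 < i)%N -> restr fixz (tauk i c) = 0.
Proof. by case: i => // i _; rewrite /tauk iterS /tau raddfB /= restr_mapz subrr. Qed.

(** The coefficients of an invariant chain are constant on orbits. Away from the fixed cells all
    orbits have [p] elements, so there the chain is the norm of its restriction [y] to one
    representative per orbit. *)
Lemma ker_tau n c : S n c -> tau c = 0 ->
  exists f y, [/\ F f, S n f, S n y & c = f + tauk p.-1 y].
Proof.
move=> hS hc.
have inv c' : tau c' = 0 -> forall i b, cf (iter i z b) c' = cf b c'.
  move=> h i b; rewrite -[in RHS](cf_mapz i); congr cf.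
  elim: i => [|i IH]; first by rewrite (@mapf_id _ _ _ (fun=> True)).
  have -> : mapf (iter i.+1 z) c' = mapf z (mapf (iter i z) c') by rewrite mapf_comp.
  by rewrite -IH; apply/eqP; rewrite -subr_eq0; apply/eqP.
pose f := restr fixz c; pose c' := c - f; pose y := restr (fun b => zrep b = b) c'.
have tc' : tau c' = 0 by rewrite /c' raddfB /= hc F_tau ?subrr //; exact: supp_restrl.
have c'0 b : fixz b -> cf b c' = 0.
  by move=> fb; rewrite /c' /f cfB cf_restr; case: asboolP => // _; rewrite subrr.
exists f, y; split; [exact: supp_restrl|exact: supp_restrr| |].
  by apply: supp_restrr; apply: suppB => //; exact: supp_restrr.
have -> : c = f + c' by rewrite /c' addrC subrK.
congr (_ + _); rewrite tau_sig; apply: cf_ext => b; rewrite /sig cf_sum.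
have e (i : 'I_p) : cf b (mapf (iter i z) y) = cf (iter (p - i) z b) y.
  by rewrite -[in RHS](cf_mapz i) -iterD subnKC ?zp // ltnW.
under eq_bigr do rewrite e /y cf_restr zrep_iter inv //.
have [fb|nfb] := pselect (fixz b).
  by rewrite c'0 // big1 // => i _; rewrite if_same.
have [j jp ej] := zrep_ltp b.
(* Exactly one translate of a moved cell is the chosen representative, so one term of the norm
   survives. For [j = 0] the index is 0, since the [p]-th power is the identity. *)
have [i0 hi0] : exists i0 : 'I_p, iter (p - i0) z b = zrep b.
  have [j0|j0] := posnP j; first by exists (Ordinal p0); rewrite subn0 zp -ej j0.
  have h : (p - j < p)%N by rewrite ltn_subrL j0.
  by exists (Ordinal h); rewrite /= subKn // ltnW.
rewrite (bigD1 i0) //= hi0; case: asboolP => // _; rewrite big1 ?addr0 // => i ii0.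
case: asboolP => // hi; case: nfb.
have hiter (i1 i2 : 'I_p) : (i1 < i2)%N -> iter (p - i1) z b = iter (p - i2) z b -> z b = b.
  move=> i12 e12; apply: (@iter_z_fix b (i2 - i1)).
    by rewrite subn_gt0 i12 /=; apply: leq_ltn_trans (leq_subr _ _) (ltn_ord i2).
  have := congr1 (iter i2 z) e12; rewrite -!iterD subnKC ?zp; last exact: ltnW.
  have -> : (i2 + (p - i1) = p + (i2 - i1))%N by have := ltn_ord i1; lia.
  by rewrite iterD zp.
have [h|h|h] := ltngtP i i0.
- by apply: (hiter i i0 h); rewrite -hi hi0.
- by apply: (hiter i0 i h); rewrite -hi hi0.
- by move: ii0; rewrite -val_eqE /= h eqxx.
Qed.

(** Apply [ker_tau] to [tauk j c], which has no fixed part, so that it is purely a norm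
    [tauk p.-1 y]; subtracting [tauk (p.-1 - j) y] from [c] gives a chain killed by [tauk j]. *)
Lemma ker_tauk n j c : (0 < j < p)%N -> S n c -> tauk j c = 0 ->
  exists f y, [/\ F f, S n f, S n y & c = f + tauk (p - j) y].
Proof.
elim: j c => // j IH c; case: (posnP j) => [-> _|j0 /andP[_ jp]] hS hc.
  by rewrite subn1; exact: ker_tau.
have [f [y [Ff Sf Sy e]]] := ker_tau (S_tauk (i := j) hS) hc.
have f0 : f = 0.
  have := congr1 (restr fixz) e; rewrite raddfD /= !restr_tau // ?addr0; last by rewrite -ltnS prednK.
  by rewrite (restr_id Ff).
have e2 : tauk j (c - tauk (p.-1 - j) y) = 0.
  rewrite raddfB /= e f0 add0r -taukD subnKC ?subrr //; by rewrite -ltnS prednK // ltnW.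
have hj : (0 < j < p)%N by rewrite j0 ltnW.
have Sc' : S n (c - tauk (p.-1 - j) y) by apply: suppB => //; exact: S_tauk.
have [f' [y' [Ff' Sf' Sy' e']]] := IH _ hj Sc' e2.
exists f', (y + tau y'); split=> //.
  by apply: suppD => //; exact: (S_tauk (i := 1)).
have -> : (p - j.+1 = p.-1 - j)%N by lia.
rewrite raddfD /= addrA [f' + _]addrC -addrA.
have -> : tauk (p.-1 - j) (tau y') = tauk (p - j) y'.
  have -> : (p - j = (p.-1 - j).+1)%N by lia.
  by rewrite /tauk iterSr.
by rewrite -e' addrC subrK.
Qed.

Lemma D_F c : F c -> F (D c).
Proof. by apply: supp_lin => b; exact: D_fix. Qed.

Lemma restr_F_tau i f x : (0 < i)%N -> F f -> restr fixz (f + tauk i x) = f.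
Proof. by move=> i0 Ff; rewrite raddfD /= restr_tau // addr0 restr_id. Qed.

(* The two Smith complexes, the image of [tauk i] and the fixed part, are exact
   together, by descending induction on the degree. *)
Lemma smith n :
  (forall i (y : C), (0 < i < p)%N -> S n y -> D (tauk i y) = 0 ->
     exists2 y', S n.+1 y' & D (tauk i y') = tauk i y) /\
  (forall c, S n c -> F c -> D c = 0 -> exists e, [/\ S n.+1 e, F e & D e = c]).
Proof.
have [m] := ubnP (top.+1 - n); elim: m n => // m IH n hm.
have [ntop|ntop] := ltnP top n.
  have S0 c : S n c -> c = 0.
    move=> h; apply: supp_False; apply: supp_sub h => b hb.
    by have := leq_trans ntop (leq_trans hb (deg_top b)); rewrite ltnn.
  split=> [i y _ /S0 -> _|c /S0 -> _ _].
    by exists 0; rewrite ?raddf0 //; exact: supp0.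
  by exists 0; split; rewrite ?raddf0 //; exact: supp0.
have [IHt IHF] := IH n.+1 ltac:(by lia).
(* Let [e] bound [c]. Then [tauk (p - i) e] is a cycle in the image of [tauk (p - i)], one degree
   up, so by induction [e] can be corrected by a boundary [D y'] to be killed by [tauk (p - i)];
   [ker_tauk] and [D] give the form claimed. *)
have key i c : (0 < i < p)%N -> S n c -> D c = 0 -> tauk (p - i) c = 0 ->
    exists f y, [/\ F f, S n.+1 f, S n.+1 y & c = D f + tauk i (D y)].
  move=> /andP[i0 ip] hS hc ht; have [e Se ee] := exactD hS hc.
  have hi : (0 < p - i < p)%N by rewrite subn_gt0 ip ltn_subrL i0.
  have [|y' Sy' ey'] := IHt (p - i)%N e hi Se; first by rewrite D_tauk ee.
  have h0 : tauk (p - i) (e - D y') = 0.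
    by rewrite raddfB /= -(D_tauk (p - i) y') ey' subrr.
  have Se' : S n.+1 (e - D y') by apply: suppB => //; exact: D_deg.
  have [f [y [Ff Sf Sy e2]]] := ker_tauk hi Se' h0.
  exists f, y; split=> //; rewrite -D_tauk -raddfD /=.
  by move: e2; rewrite subKn ?(ltnW ip) // => <-; rewrite raddfB /= DD subr0.
split.
- move=> i y hi Sy hy; have [i0 ip] := andP hi.
  have [|f [y' [Ff Sf Sy' e]]] := key i (tauk i y) hi (S_tauk (i := i) Sy) hy.
    by rewrite -taukD taukp // subnK // ltnW.
  exists y' => //; rewrite D_tauk e.
  (* Comparing fixed parts separates the summands: images of [tauk] have none, so [D f] is zero. *)
  have := congr1 (restr fixz) e; rewrite (restr_F_tau _ i0 (D_F Ff)) restr_tau // => <-.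
  by rewrite add0r.
- move=> c Sc Fc hc.
  have h1 : (0 < 1 < p)%N by [].
  have [|f [y [Ff Sf Sy e]]] := key 1%N c h1 Sc hc.
    have -> : (p - 1 = (p - 2) + 1)%N by lia.
    by rewrite taukD /tauk /= F_tau // -/(tauk _ _) raddf0.
  exists f; split=> //.
  have := congr1 (restr fixz) e; rewrite restr_F_tau //; last exact: D_F.
  by rewrite (restr_id Fc).
Qed.

Variables (Q : Type) (q : B -> Q).
Hypothesis qP : forall b b', q b = q b' <-> exists i, b' = iter i z b.

Lemma qz b : q (z b) = q b. Proof. by apply/esym/qP; exists 1%N. Qed.

Lemma q_tau c : mapf q (tau c) = 0.
Proof.
rewrite raddfB /= mapf_comp (_ : q \o z = q) ?subrr //.
by apply/funext => b; exact: qz.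
Qed.

(** The norm of a cell depends only on its orbit, so [sig] factors through the quotient by the
    linear extension of [g]. *)
Lemma q_sig c : mapf q c = 0 -> sig c = 0.
Proof.
pose g (x : Q) : C := match pselect (exists b, q b = x) with
  | left h => sig (ub (projT1 (cid h))) | right _ => 0 end.
suff h : sig c = lin g (mapf q c) by move=> e; rewrite h e raddf0.
apply: (@eq_FM _ _ _ sig (lin g \o mapf q)) => b /=; rewrite mapf_ub lin_ub /g.
case: pselect => [h|[]]; last by exists b.
have sz b0 : sig (ub (z b0)) = sig (ub b0).
  rewrite -mapf_ub -[RHS]mapz_sig /sig raddf_sum; apply: eq_bigr => j _ /=.
  by rewrite !mapf_comp; congr (mapf _ _); apply/funext => b1; rewrite /= -iterS -iterSr.
have /esym /qP [i ->] := projT2 (cid h).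
by elim: i => //= i ->; rewrite sz.
Qed.

Lemma q_F c : F c -> mapf q c = 0 -> c = 0.
Proof.
move=> Fc h; apply: cf_ext => b; rewrite cf0.
have [fb|nfb] := pselect (fixz b); last exact: (cf_supp Fc nfb).
suff -> : cf b c = cf (q b) (mapf q c) by rewrite h cf0.
move: c Fc {h}; apply: supp_ind => [|a b' c fb' IH]; first by rewrite raddf0 !cf0.
rewrite linearD linearZ /= !cfD !cfZ mapf_ub !cf_ub IH.
case: asboolP => [->|nb]; case: asboolP => // /qP [i hi]; case: nb.
by rewrite hi; elim: i {hi} => //= i <-.
Qed.

(** The norm of [D c] vanishes by [q_sig], so the norm of [c] is a cycle and bounds a norm;
    subtracting a boundary leaves [c] of the form [f + tau y']. The second term dies in the
    quotient, and the fixed chain [f] is a cycle because [q] is injective on fixed cells. *)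
Lemma smith_quotient n c : S n c -> mapf q (D c) = 0 ->
  exists2 e, S n.+1 e & mapf q (c - D e) = 0.
Proof.
move=> Sc hc; have hp : (0 < p.-1 < p)%N by have := p1; lia.
have [ht hF] := smith n.
have [|y Sy ey] := ht p.-1 c hp Sc; first by rewrite D_tauk tau_sig q_sig.
have h0 : tauk p.-1 (c - D y) = 0 by rewrite raddfB /= -D_tauk ey subrr.
have Sc' : S n (c - D y) by apply: suppB => //; exact: D_deg.
have [f [y' [Ff Sf Sy' e]]] := ker_tauk hp Sc' h0.
have ep : (p - p.-1 = 1)%N by lia.
rewrite ep in e.
have Df0 : D f = 0.
  apply: q_F; first exact: D_F.
  have -> : D f = D c - tau (D y').
    have := congr1 D e; rewrite raddfB raddfD /= DD subr0 => ->.
    have et : D (tauk 1 y') = tau (D y') := D_tauk 1 y'.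
    by rewrite et addrK.
  by rewrite raddfB /= hc q_tau subrr.
have [f' [Sf' Ff' ef']] := hF f Sf Ff Df0.
exists (y + f'); first exact: suppD.
rewrite (_ : c - D (y + f') = tau y'); first exact: q_tau.
by rewrite raddfD /= opprD addrA e ef' addrAC subrr add0r.
Qed.

End Smith.

(** * Quotients by subgroups, and transfer *)

Section Quotient.
Variables (gT : finGroupType) (B : Type) (ga : gT -> B -> B).
Hypothesis ga1 : forall b, ga 1%g b = b.
Hypothesis gaM : forall g h b, ga (g * h)%g b = ga g (ga h b).
Implicit Types (H K : {group gT}).

Lemma qrepP H b : exists b', exists2 h, h \in H & b' = ga h b.
Proof. by exists b, 1%g; rewrite ?ga1. Qed.
Definition qrep H b := projT1 (cid (qrepP H b)).
Lemma qrepE H b : exists2 h, h \in H & qrep H b = ga h b.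
Proof. exact: projT2 (cid (qrepP H b)). Qed.
Lemma qrep_ga H h b : h \in H -> qrep H (ga h b) = qrep H b.
Proof.
move=> hH; apply: cid_ext; apply/funext => b'; apply/propext; split=> -[h' h'H ->].
  by exists (h' * h)%g; rewrite ?groupM ?gaM.
by exists (h' * h^-1)%g; rewrite ?groupM ?groupV // -gaM mulgKV.
Qed.
Lemma qrep_eq H b b' : qrep H b = qrep H b' <-> exists2 h, h \in H & b' = ga h b.
Proof.
split=> [e|[h hH ->]]; last by rewrite qrep_ga.
have [h hH e1] := qrepE H b; have [h' h'H e2] := qrepE H b'.
exists (h'^-1 * h)%g; first by rewrite groupM ?groupV.
by rewrite gaM -e1 e e2 -gaM mulVg ga1.
Qed.
Lemma qrepK H b : qrep H (qrep H b) = qrep H b.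
Proof. by have [h hH e] := qrepE H b; rewrite {1}e qrep_ga. Qed.
Lemma qrep_sub H K b : H \subset K -> qrep K (qrep H b) = qrep K b.
Proof. by move=> HK; have [h hH ->] := qrepE H b; rewrite qrep_ga // (fintype.subsetP HK). Qed.
Lemma qrep1 b : qrep 1%G b = b.
Proof. by have [h] := qrepE 1%G b; rewrite inE => /eqP -> ->; rewrite ga1. Qed.

Variables (R : nzRingType) (deg : B -> nat).
Local Notation C := (FM R B).
Implicit Types (c : C).
Local Notation S n := (supp (fun b => (n <= deg b)%N)).
Variable D : {linear C -> C}.

Record gcomplex : Prop := GComplex {
  gc_deg : forall g b, deg (ga g b) = deg b;
  gc_S : forall n c, S n.+1 c -> S n (D c);
  gc_DD : forall c, D (D c) = 0;
  gc_D : forall g c, D (mapf (ga g) c) = mapf (ga g) (D c);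
  gc_fix : forall g b, ga g b = b -> supp (fun b' => ga g b' = b') (D (ub b)) }.

(** Exactness of the quotient complex by [H], expressed upstairs: its chains are the chains modulo
    the kernel of [mapf (qrep H)]. *)
Definition exact_mod H := forall n (c : C), S n c -> mapf (qrep H) (D c) = 0 ->
  exists2 e : C, S n.+1 e & mapf (qrep H) (c - D e) = 0.

Hypothesis gc : gcomplex.

Lemma qrep_deg H b : deg (qrep H b) = deg b.
Proof. by have [h _ ->] := qrepE H b; rewrite (gc_deg gc). Qed.

Lemma mapf_qrep_ga H h c : h \in H -> mapf (qrep H) (mapf (ga h) c) = mapf (qrep H) c.
Proof.
by move=> hH; rewrite mapf_comp; congr (mapf _ c); apply/funext => b; exact: qrep_ga.
Qed.

(** [D] commutes with the group, so it induces a differential on orbits, whatever representatives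
    are used. *)
Lemma mapf_qrep_D H c : mapf (qrep H) (D (mapf (qrep H) c)) = mapf (qrep H) (D c).
Proof.
apply: (@eq_FM _ _ _ (mapf (qrep H) \o (D \o mapf (qrep H))) (mapf (qrep H) \o D)) => b /=.
rewrite mapf_ub; have [h hH ->] := qrepE H b.
by rewrite -[ub (ga h b)]mapf_ub (gc_D gc) mapf_qrep_ga.
Qed.

Lemma exact_mod1 : (forall n c, S n c -> D c = 0 -> exists2 e, S n.+1 e & D e = c) ->
  exact_mod 1%G.
Proof.
have m1 c : mapf (qrep 1%G) c = c by apply: (@mapf_id _ _ _ (fun=> True)) => // b _; exact: qrep1.
move=> ex n c Sc; rewrite m1 => /(ex n c Sc) [e Se <-]; exists e => //.
by rewrite subrr raddf0.
Qed.

End Quotient.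

Section Step.
Variables (gT : finGroupType) (B : Type) (ga : gT -> B -> B).
Hypothesis ga1 : forall b, ga 1%g b = b.
Hypothesis gaM : forall g h b, ga (g * h)%g b = ga g (ga h b).
Variables (p : nat) (p_pr : prime p) (k : fieldType) (chk : p \in [pchar k]).
Variables (deg : B -> nat) (top : nat) (D : {linear FM k B -> FM k B}).
Hypothesis deg_top : forall b, (deg b <= top)%N.
Hypothesis gc : gcomplex ga deg D.
Variables (H K : {group gT}).
Hypotheses (KH : normal K H) (KHp : #|H : K|%g = p).
Local Notation q := (qrep ga1).

Let CK := {b : B | q K b = b}.
Let pi (b : B) : CK := exist _ (q K b) (qrepK ga1 gaM K b).
Let v (x : CK) : B := projT1 x.

Lemma v_inj x y : v x = v y -> x = y.
Proof. by case: x y => [b hb] [b' hb']; rewrite /v /= => e; subst b'; congr exist; exact: Prop_irrelevance. Qed.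

Lemma piv x : pi (v x) = x. Proof. by apply: v_inj; case: x. Qed.

Lemma pi_eq b b' : pi b = pi b' <-> q K b = q K b'.
Proof. by split=> [/(congr1 v)|e] //; apply: v_inj. Qed.

Lemma pi_ga h b : h \in K -> pi (ga h b) = pi b.
Proof. by move=> hK; apply/pi_eq; exact: qrep_ga. Qed.

Lemma coset_gen : exists z, [/\ z \in H, (z ^+ p)%g \in K &
  forall h, h \in H -> exists i, exists2 x, x \in K & h = (z ^+ i * x)%g].
Proof.
have sKH := normal_sub KH; have nKH := normal_norm KH.
have cHK : #|(H / K)%g| = p by rewrite card_quotient.
have /cyclicP [zb ezb] : cyclic (H / K)%g by apply: prime_cyclic; rewrite cHK.
have zbHK : zb \in (H / K)%g by rewrite ezb cycle_id.
have /morphimP [z zN zH ez] := zbHK.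
exists z; split=> //.
  apply: coset_idr; first exact: groupX.
  by rewrite morphX // -ez -cHK ezb expg_order.
move=> h hH; have hN := fintype.subsetP nKH h hH.
have : coset K h \in <[zb]>%g by rewrite -ezb mem_quotient.
move=> /cycleP [i ei]; exists i, (z ^- i * h)%g; last by rewrite mulKVg.
apply: coset_idr; first by rewrite groupM // groupV groupX.
by rewrite morphM ?morphV ?morphX ?groupV ?groupX //= -ez ei mulVg.
Qed.

(** The quotient by [K] becomes a complex on the type [CK] of [K]-representatives. There a generator
    of [H / K] acts with trivial [p]-th power, so [smith_quotient] applies, and the quotient of [CK]
    by it is the quotient by [H]. *)
Lemma step : exact_mod ga1 deg D K -> exact_mod ga1 deg D H.
Proof.
move=> exK.
have [z [zH zpK gen]] := coset_gen.
have nKH := normal_norm KH; have sKH := normal_sub KH.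
have zK h : h \in K -> exists2 h', h' \in K & (z * h)%g = (h' * z)%g.
  move=> hK; exists (z * h * z^-1)%g; last by rewrite mulgKV.
  have := memJ_norm h (fintype.subsetP nKH z^-1%g (groupVr zH)).
  by rewrite conjgE invgK mulgA => ->.
have pzpi h b : h \in K -> pi (ga z (ga h b)) = pi (ga z b).
  by move=> /zK [h' h'K e]; rewrite -gaM e gaM pi_ga.
pose zC (x : CK) := pi (ga z (v x)).
have zCpi b : zC (pi b) = pi (ga z b).
  have ev : v (pi b) = q K b by [].
  by rewrite /zC ev; have [h hK ->] := qrepE ga1 K b; rewrite pzpi.
pose DC : {linear FM k CK -> FM k CK} := lin (fun x => mapf pi (D (ub (v x)))).
have DCpi c : DC (mapf pi c) = mapf pi (D c).
  apply: (@eq_FM _ _ _ (DC \o mapf pi) (mapf pi \o D)) => b /=.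
  rewrite mapf_ub lin_ub; have -> : v (pi b) = q K b by [].
  have [h hK ->] := qrepE ga1 K b.
  rewrite -[ub (ga h b)]mapf_ub (gc_D gc) mapf_comp; congr (mapf _ _).
  by apply/funext => b'; exact: pi_ga.
have piv' c : mapf pi (mapf v c) = c.
  rewrite mapf_comp; apply: (@mapf_id _ _ _ (fun=> True)) => // x _; exact: piv.
pose degC (x : CK) := deg (v x).
have degpi b : degC (pi b) = deg b by exact: (qrep_deg ga1 gc).
pose S n := supp (fun b : B => (n <= deg b)%N) : FM k B -> Prop.
pose SC n := supp (fun x : CK => (n <= degC x)%N) : FM k CK -> Prop.
have Spi n c : S n c -> SC n (mapf pi c).
  by apply: supp_mapf => b hb; rewrite degpi.
have Sv n c : SC n c -> S n (mapf v c) by exact: supp_mapf.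
have kerpi c : mapf (q K) c = 0 <-> mapf pi c = 0.
  have ev : mapf v (mapf pi c) = mapf (q K) c by rewrite mapf_comp.
  split=> e; first by rewrite -[LHS]piv' ev e raddf0.
  by rewrite -ev e raddf0.
pose qC (x : CK) := q H (v x).
have qCpi c : mapf qC (mapf pi c) = mapf (q H) c.
  rewrite mapf_comp; congr (mapf _ c); apply/funext => b.
  exact: (qrep_sub ga1 gaM).
have zCiter i b : iter i zC (pi b) = pi (ga (z ^+ i)%g b).
  by elim: i => [|i IH]; rewrite ?expg0 ?ga1 // iterS IH zCpi -gaM -expgS.
move=> n c Sc hc.
have [e Se ee] : exists2 e, SC n.+1 e & mapf qC (mapf pi c - DC e) = 0.
  apply: (@smith_quotient p p_pr k chk CK degC top DC zC).
  - by move=> x; exact: deg_top.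
  - by move=> x; rewrite -[x]piv zCiter pi_ga.
  - by move=> x; rewrite degpi /degC (gc_deg gc).
  - move=> m x; apply: supp_lin => y hy /=; rewrite lin_ub; apply: Spi.
    by apply: (gc_S gc); exact: supp_ub.
  - move=> x; rewrite -[x]piv' !DCpi (gc_DD gc) raddf0 //.
  - move=> x; rewrite -[x]piv'.
    have e c' : mapf zC (mapf pi c') = mapf pi (mapf (ga z) c').
      by rewrite !mapf_comp; congr (mapf _ c'); apply/funext => b; exact: zCpi.
    by rewrite e !DCpi (gc_D gc) e.
  (* [z] fixes the cell only modulo [K]; some [h * z] with [h] in [K] fixes it upstairs, and
     [gc_fix] is applied to that element. *)
  - move=> x zx; have : pi (ga z (v x)) = pi (v x) by rewrite piv.
    move=> /pi_eq /(qrep_eq ga1 gaM) [h hK eh] /=.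
    have fx : ga (h * z)%g (v x) = v x by rewrite gaM -eh.
    rewrite lin_ub; move: (gc_fix gc fx); apply: supp_mapf => b hb.
    by rewrite zCpi -(pi_ga _ hK) -gaM hb.
  - move=> m x Sx hx.
    have h1 : mapf (q K) (D (mapf v x)) = 0 by apply/kerpi; rewrite -DCpi piv'.
    have [e Se /kerpi ee] := exK m (mapf v x) (Sv _ _ Sx) h1.
    exists (mapf pi e); first exact: Spi.
    by move: ee; rewrite raddfB /= piv' DCpi => /eqP; rewrite subr_eq0 => /eqP <-.
  - move=> x y; split.
      move=> /(qrep_eq ga1 gaM) [h hH eh]; have [i [x0 x0K ei]] := gen h hH.
      by exists i; rewrite -[y]piv eh ei gaM -zCiter pi_ga // piv.
    move=> [i ->]; rewrite -[x in RHS]piv zCiter /qC.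
    have -> : v (pi (ga (z ^+ i)%g (v x))) = q K (ga (z ^+ i)%g (v x)) by [].
    by rewrite (qrep_sub ga1 gaM) // (qrep_ga ga1 gaM) // groupX.
  - exact: Spi Sc.
  - by rewrite DCpi qCpi.
exists (mapf v e); first exact: Sv Se.
by rewrite -qCpi raddfB /= -DCpi piv'.
Qed.
End Step.

Section Tower.
Variables (gT : finGroupType) (B : Type) (ga : gT -> B -> B).
Hypothesis ga1 : forall b, ga 1%g b = b.
Hypothesis gaM : forall g h b, ga (g * h)%g b = ga g (ga h b).

Lemma pgroup_exact (p : nat) (p_pr : prime p) (k : fieldType) (chk : p \in [pchar k])
    (deg : B -> nat) (top : nat) (D : {linear FM k B -> FM k B}) (P : {group gT}) :
  (forall b, (deg b <= top)%N) -> gcomplex ga deg D -> pgroup p P ->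
  (forall n c, supp (fun b => (n <= deg b)%N) c -> D c = 0 ->
     exists2 e, supp (fun b => (n.+1 <= deg b)%N) e & D e = c) ->
  exact_mod ga1 deg D P.
Proof.
move=> dt gc pP ex; have [m] := ubnP #|P|; elim: m P pP => // m IH P pP hm.
have [->|[M maxM sM]] : (P = 1%G) \/ exists2 M : {group gT}, maximal M P & 1%G \subset M.
  by have [e|h] := maximal_exists (sub1G P); [left; apply/val_inj|right].
  exact: exact_mod1.
have nM := p_maximal_normal pP maxM; have iM := p_maximal_index pP maxM.
apply: (step gaM p_pr chk dt gc nM iM); apply: IH.
  by apply: pgroupS pP; exact: normal_sub nM.
rewrite ltnS in hm; apply: leq_trans hm; apply: proper_card; exact: maxgroupp maxM.
Qed.

(* The transfer sends an orbit to the sum of its [H]-orbits; followed by the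
   projection it is multiplication by the index. *)
Lemma transfer (R : comNzRingType) (deg : B -> nat) (D : {linear FM R B -> FM R B})
    (G H : {group gT}) n c : gcomplex ga deg D -> H \subset G -> exact_mod ga1 deg D H ->
  supp (fun b => (n <= deg b)%N) c -> mapf (qrep ga1 G) (D c) = 0 ->
  exists2 e, supp (fun b => (n.+1 <= deg b)%N) e &
    mapf (qrep ga1 G) (#|G : H|%g%:R *: c - D e) = 0.
Proof.
move=> gc HG exH Sc hc.
pose tr (c : FM R B) := \sum_(A in rcosets H G) mapf (ga (repr A)) c.
have reprG A : A \in rcosets H G -> exists2 x, x \in G & A = (H :* x)%g.
  by move=> /rcosetsP [x xG ->]; exists x.
have repr_in A : A \in rcosets H G -> repr A \in G.
  move=> /reprG [x xG ->]; have /rcosetP [h hH ->] := mem_repr_rcoset H x.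
  by rewrite groupM // (fintype.subsetP HG).
have trL a x y : tr (a *: x + y) = a *: tr x + tr y.
  rewrite /tr scaler_sumr -big_split; apply: eq_bigr => A _ /=; exact: linearP.
(* The transfer depends only on the [G]-orbit: replacing [b] by [ga h b] amounts to right
   multiplication by [h], which permutes the cosets. *)
have key c' : mapf (qrep ga1 G) c' = 0 -> mapf (qrep ga1 H) (tr c') = 0.
  pose g0 b := mapf (qrep ga1 H) (tr (ub b)).
  suff h : mapf (qrep ga1 H) (tr c') = lin g0 (mapf (qrep ga1 G) c').
    by move=> e; rewrite h e raddf0.
  move: c' {hc}; suff h b : g0 b = g0 (qrep ga1 G b).
    move=> c'; move: c' (@supp_all _ _ c'); apply: supp_ind => [|a b c' _ IH].
      by rewrite /tr raddf0 big1 ?raddf0 // => A _; rewrite raddf0.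
    by rewrite trL [in RHS]linearP /= [in RHS]linearP /= linearP /= IH mapf_ub lin_ub -h.
  have [h hG ->] := qrepE ga1 G b.
  pose f x : FM R B := ub (qrep ga1 H (ga x b)).
  have fH x y : x \in H -> f (x * y)%g = f y by move=> xH; rewrite /f gaM qrep_ga.
  have fr A : A \in rcosets H G -> f (repr A * h)%g = f (repr (A :* h)%g).
    move=> /reprG [x xG ->]; rewrite -rcosetM.
    have /rcosetP [u uH ->] := mem_repr_rcoset H x.
    have /rcosetP [u' u'H ->] := mem_repr_rcoset H (x * h)%g.
    by rewrite -mulgA (fH u) // (fH u').
  have e1 : g0 b = \sum_(A in rcosets H G) f (repr A).
    by rewrite /g0 /tr raddf_sum; apply: eq_bigr => A _ /=; rewrite !mapf_ub.
  have e2 : g0 (ga h b) = \sum_(A in rcosets H G) f (repr A * h)%g.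
    by rewrite /g0 /tr raddf_sum; apply: eq_bigr => A _ /=; rewrite !mapf_ub /f gaM.
  rewrite e1 e2 (reindex_inj (h := fun A : {set gT} => (A :* h)%g)); last first.
    by move=> A A' /(congr1 (fun X : {set gT} => (X :* h^-1)%g)); rewrite -!rcosetM mulgV !rcoset1.
  have hmem A : ((A :* h)%g \in rcosets H G) = (A \in rcosets H G).
    apply/rcosetsP/rcosetsP => -[x xG e].
      exists (x * h^-1)%g; first by rewrite groupM ?groupV.
      by rewrite rcosetM -e -rcosetM mulgV rcoset1.
    by exists (x * h)%g; rewrite ?groupM // e rcosetM.
  by under eq_bigl do rewrite hmem; apply: eq_bigr => A hA; rewrite fr.
have trD c' : D (tr c') = tr (D c').
  by rewrite /tr raddf_sum; apply: eq_bigr => A _ /=; rewrite (gc_D gc).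
have Str : supp (fun b => (n <= deg b)%N) (tr c).
  by apply: supp_sum => A _; move: Sc; apply: supp_mapf => b; rewrite (gc_deg gc).
have h0 : mapf (qrep ga1 H) (D (tr c)) = 0 by rewrite trD key.
have [e Se ee] := exH n (tr c) Str h0; exists e => //.
have sub c' : mapf (qrep ga1 G) (mapf (qrep ga1 H) c') = mapf (qrep ga1 G) c'.
  by rewrite mapf_comp; congr (mapf _ c'); apply/funext => b; exact: qrep_sub.
have -> : mapf (qrep ga1 G) (#|G : H|%g%:R *: c - D e) = mapf (qrep ga1 G) (tr c - D e).
  rewrite !raddfB /=; congr (_ - _); rewrite linearZ /= /tr raddf_sum /=.
  have -> : \sum_(A in rcosets H G) mapf (qrep ga1 G) (mapf (ga (repr A)) c) =
      \sum_(A in rcosets H G) mapf (qrep ga1 G) c.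
    by apply: eq_bigr => A hA; apply: mapf_qrep_ga => //; exact: repr_in.
  by rewrite sumr_const scaler_nat.
by rewrite -sub ee raddf0.
Qed.

End Tower.

(** * Reduction modulo a prime and division by it *)

Section CoefMap.
Variables (R R' : nzRingType) (K : Type).

(** The new coefficients need not depend additively on the old ones: besides reduction, this serves
    to lift residues to integers and to divide coefficients. *)
Definition recoef (c : FM R K) (f : K -> R') : FM R' K := \sum_(b <- freeg.dom c) f b *: @ub R' K b.

Lemma cf_recoef c f b : (cf b c = 0 -> f b = 0) -> cf b (recoef c f) = f b.
Proof.
move=> h; rewrite /recoef cf_sum; have [hb|hb] := boolP ((b : {classic K}) \in freeg.dom c).
  rewrite (bigD1_seq (b : {classic K})) ?uniq_dom //= cfZ cf_ub; case: asboolP => // _.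
  rewrite mulr1 big1 ?addr0 // => b' nb; rewrite cfZ cf_ub; case: asboolP => [e|_]; last by rewrite mulr0.
  by move: nb; rewrite e eqxx.
have c0 : cf b c = 0 by move: hb; rewrite mem_dom negbK => /eqP.
rewrite h // big1_seq // => b' /andP[_ hb']; rewrite cfZ cf_ub; case: asboolP => [e|_]; last by rewrite mulr0.
by move: hb; rewrite -e hb'.
Qed.

Lemma supp_recoef c f (P : K -> Prop) : (forall b, cf b c = 0 -> f b = 0) ->
  supp P c -> supp P (recoef c f).
Proof.
move=> hf h b; rewrite cf_recoef; last exact: hf.
by move=> fb; apply: h; apply: contraNneq fb => /hf ->.
Qed.

End CoefMap.

Section ModP.
Variables (p : nat) (p_pr : prime p).

Section Red.
Variable K : Type.

Definition red (c : FM int K) : FM 'F_p K := recoef c (fun b => (cf b c)%:~R).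

Lemma cf_red c b : cf b (red c) = (cf b c)%:~R.
Proof. by rewrite /red cf_recoef // => ->. Qed.

Lemma red0 : red 0 = 0. Proof. by apply: cf_ext => b; rewrite cf_red !cf0. Qed.
Lemma redD c c' : red (c + c') = red c + red c'.
Proof. by apply: cf_ext => b; rewrite cf_red !cfD !cf_red rmorphD. Qed.
Lemma redB c c' : red (c - c') = red c - red c'.
Proof. by apply: cf_ext => b; rewrite cf_red !cfB !cf_red rmorphB. Qed.
Lemma redZ a c : red (a *: c) = a%:~R *: red c.
Proof. by apply: cf_ext => b; rewrite cf_red !cfZ !cf_red rmorphM. Qed.
Lemma red_ub b : red (ub b) = ub b.
Proof. by apply: cf_ext => b'; rewrite cf_red !cf_ub; case: asboolP. Qed.

Lemma supp_red (P : K -> Prop) c : supp P c -> supp P (red c).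
Proof. by apply: supp_recoef => b ->. Qed.

Lemma red_lift (P : K -> Prop) (c : FM 'F_p K) : supp P c ->
  exists2 c', supp P c' & red c' = c.
Proof.
pose f b : int := (cf b c : nat)%:Z.
have f0 b : cf b c = 0 -> f b = 0 by rewrite /f => ->.
move=> h; exists (recoef c f); first exact: supp_recoef.
apply: cf_ext => b; rewrite cf_red cf_recoef; last exact: f0.
by rewrite /f -pmulrn natr_Zp.
Qed.

Lemma red_eq0 (P : K -> Prop) c : supp P c -> red c = 0 ->
  exists2 c', supp P c' & c = p%:R *: c'.
Proof.
move=> h hc; pose f b : int := (cf b c %/ p)%Z.
have f0 b : cf b c = 0 -> f b = 0 by rewrite /f => ->; rewrite div0z.
exists (recoef c f); first exact: supp_recoef.
apply: cf_ext => b; rewrite cfZ cf_recoef; last exact: f0.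
have dv : (p %| cf b c)%Z.
  by rewrite (dvdz_pcharf (pchar_Fp p_pr)) -cf_red hc cf0.
by rewrite mulrC /f pmulrn intz divzK.
Qed.
End Red.

Lemma red_mapf (K K' : Type) (f : K -> K') c : red (mapf f c) = mapf f (red c).
Proof.
move: c (@supp_all _ _ c); apply: supp_ind => [|a b c _ IH]; first by rewrite !(raddf0, red0).
by rewrite !linearP /= redD redZ IH redD redZ linearP /= red_ub !mapf_ub red_ub.
Qed.

Variables (gT : finGroupType) (B : Type) (ga : gT -> B -> B).
Hypothesis ga1 : forall b, ga 1%g b = b.
Hypothesis gaM : forall g h b, ga (g * h)%g b = ga g (ga h b).
Variables (deg : B -> nat) (top : nat) (D : {linear FM int B -> FM int B}).
Hypothesis deg_top : forall b, (deg b <= top)%N.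
Hypothesis gc : gcomplex ga deg D.
Local Notation S n := (supp (fun b => (n <= deg b)%N)).
Hypothesis exD : forall n (c : FM int B), S n c -> D c = 0 -> exists2 e, S n.+1 e & D e = c.

Definition Dp : FM 'F_p B -> FM 'F_p B := lin (fun b => red (D (ub b))).
HB.instance Definition _ := GRing.Linear.on Dp.

Lemma Dp_ub b : Dp (ub b) = red (D (ub b)). Proof. exact: lin_ub. Qed.

Lemma red_D c : red (D c) = Dp (red c).
Proof.
move: c (@supp_all _ _ c); apply: supp_ind => [|a b c _ IH]; first by rewrite !(raddf0, red0).
by rewrite !linearP /= redD redZ IH redD redZ linearP /= red_ub Dp_ub.
Qed.

Lemma gcomplex_Dp : gcomplex ga deg Dp.
Proof.
split; first exact: (gc_deg gc).
- move=> n c; apply: supp_lin => b hb /=; rewrite Dp_ub; apply: supp_red.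
  by apply: (gc_S gc); exact: supp_ub.
- move=> c; apply: (@eq_FM _ _ _ (Dp \o Dp) \0) => b /=.
  by rewrite Dp_ub -red_D (gc_DD gc) red0.
- move=> g c; apply: (@eq_FM _ _ _ (Dp \o mapf (ga g)) (mapf (ga g) \o Dp)) => b /=.
  by rewrite mapf_ub !Dp_ub -red_mapf -(gc_D gc) mapf_ub.
- by move=> g b hb; rewrite /= Dp_ub; apply: supp_red; exact: (gc_fix gc).
Qed.

Lemma pnz (c : FM int B) : p%:R *: c = 0 -> c = 0.
Proof.
move=> h; apply: cf_ext => b; have := congr1 (cf b) h; rewrite cfZ cf0 => /eqP.
by rewrite mulf_eq0 pnatr_eq0 gtn_eqF ?prime_gt0 //= => /eqP.
Qed.

(** A cycle modulo [p] lifts to [c1] with boundary [p] times [c2]; as [p] is not a zero divisor,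
    [c2] is a cycle and equals [D e], so [c1 - p%:R *: e] is an integral cycle with the same
    reduction. *)
Lemma exact_Dp n c : S n c -> Dp c = 0 -> exists2 e, S n.+1 e & Dp e = c.
Proof.
move=> Sc hc; have [c1 Sc1 ec1] := red_lift Sc.
(* The truncated predecessor is correct for [n = 0] as well, since [S 0] imposes no condition. *)
have [c2 Sc2 ec2] : exists2 c2, S n.-1 c2 & D c1 = p%:R *: c2.
  apply: red_eq0; last by rewrite red_D ec1.
  case: n Sc1 {Sc} => [|n] Sc1; first by [].
  exact: (gc_S gc).
have Dc2 : D c2 = 0 by apply: pnz; rewrite -linearZ /= -ec2 (gc_DD gc).
have [e Se ee] := exD Sc2 Dc2.
have Se' : S n e by case: n Sc Sc1 Sc2 Se => [|n] //.
have h0 : D (c1 - p%:R *: e) = 0 by rewrite raddfB /= linearZ /= ee -ec2 subrr.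
have [|f Sf ef] := exD (n := n) _ h0; first by apply: suppB => //; exact: suppZ.
exists (red f); first exact: supp_red.
rewrite -red_D ef redB redZ ec1.
have -> : (p%:R : int)%:~R = 0 :> 'F_p by rewrite rmorph_nat; exact: pchar_Fp_0.
by rewrite scale0r subr0.
Qed.

Lemma exact_Dp_mod (G : {group gT}) : exact_mod ga1 deg Dp G.
Proof.
move=> n c Sc hc; have chp := pchar_Fp p_pr.
have [P /and3P [sPG pP p'i]] := Sylow_exists p G.
have exP : exact_mod ga1 deg Dp P.
  exact: (pgroup_exact gaM p_pr chp deg_top gcomplex_Dp pP exact_Dp).
have [e Se ee] := transfer gaM gcomplex_Dp sPG exP Sc hc.
pose u : 'F_p := #|G : P|%g%:R.
have u0 : u != 0.
  by rewrite /u -(dvdn_pcharf chp) -p'natE.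
exists (u^-1 *: e); first exact: suppZ.
rewrite linearZ /= -[c](scalerK u0) -scalerBr linearZ /=.
by move: ee; rewrite -/u => ->; rewrite scaler0.
Qed.

(** In the quotient [D e] is [p] times [c], so [e] is a cycle modulo [p] and hence of the form
    [D f' + p x] there. Applying [D] shows that [c] and [D x] agree after multiplication by [p],
    which can be cancelled. *)
Lemma divide_p (G : {group gT}) n c e : S n c -> S n.+1 e -> mapf (qrep ga1 G) (D c) = 0 ->
  mapf (qrep ga1 G) (p%:R *: c - D e) = 0 ->
  exists2 e', S n.+1 e' & mapf (qrep ga1 G) (c - D e') = 0.
Proof.
move=> Sc Se hc he; set q := qrep ga1 G in hc he *.
have p0 : (p%:R : int)%:~R = 0 :> 'F_p by rewrite rmorph_nat; exact: pchar_Fp_0.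
have he' : mapf q (D e) = p%:R *: mapf q c.
  by move: he; rewrite raddfB /= linearZ /= => /eqP; rewrite subr_eq0 => /eqP.
have h1 : mapf q (Dp (red e)) = 0.
  by rewrite -red_D -red_mapf he' redZ p0 scale0r.
have [f Sf ef] := exact_Dp_mod (supp_red Se) h1.
have [f' Sf' ef'] := red_lift Sf; subst f.
have hS : S n.+1 (mapf q (e - D f')).
  have : S n.+1 (e - D f') by apply: suppB => //; exact: (gc_S gc).
  by apply: supp_mapf => b; rewrite (qrep_deg ga1 gc).
have hr : red (mapf q (e - D f')) = 0 by rewrite red_mapf redB red_D.
have [x Sx ex] := red_eq0 hS hr.
exists x => //; apply: pnz.
have qq c' : mapf q (mapf q c') = mapf q c'.
  by rewrite mapf_comp; congr (mapf _ c'); apply/funext => b; exact: qrepK.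
have qD c' : mapf q (D (mapf q c')) = mapf q (D c') := mapf_qrep_D ga1 gaM gc G c'.
rewrite raddfB /= scalerBr -he' -!linearZ /= -ex qD raddfB /= (gc_DD gc) subr0.
by rewrite subrr.
Qed.

End ModP.

Section IntExact.
Variables (gT : finGroupType) (B : Type) (ga : gT -> B -> B).
Hypothesis ga1 : forall b, ga 1%g b = b.
Hypothesis gaM : forall g h b, ga (g * h)%g b = ga g (ga h b).
Variables (deg : B -> nat) (top : nat) (D : {linear FM int B -> FM int B}).
Hypothesis deg_top : forall b, (deg b <= top)%N.
Hypothesis gc : gcomplex ga deg D.
Local Notation S n := (supp (fun b => (n <= deg b)%N)).
Hypothesis exD : forall n (c : FM int B), S n c -> D c = 0 -> exists2 e, S n.+1 e & D e = c.

Lemma divide (G : {group gT}) m n c e : (0 < m)%N -> S n c -> S n.+1 e ->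
  mapf (qrep ga1 G) (D c) = 0 -> mapf (qrep ga1 G) (m%:R *: c - D e) = 0 ->
  exists2 e', S n.+1 e' & mapf (qrep ga1 G) (c - D e') = 0.
Proof.
have [k] := ubnP m; elim: k m c e => // k IH m c e hm m0 Sc Se hc he.
have [m1|m1] := leqP m 1.
  have em : m = 1%N by apply/eqP; rewrite eqn_leq m1.
  by exists e => //; move: he; rewrite em scale1r.
have pp := pdiv_prime m1; have dp := pdiv_dvd m.
pose p := pdiv m; pose m' := (m %/ p)%N.
have em : m = (p * m')%N by rewrite mulnC divnK.
have m'0 : (0 < m')%N by move: m0; rewrite em muln_gt0 => /andP[].
have hc' : mapf (qrep ga1 G) (D (m'%:R *: c)) = 0 by rewrite linearZ /= linearZ /= hc scaler0.
have [|e1 Se1 ee1] := divide_p pp gaM deg_top gc exD (suppZ (a := m'%:R) Sc) Se hc'.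
  by rewrite scalerA -natrM -em.
apply: (IH m' c e1) => //.
by move: hm; rewrite em => hm; have := prime_gt1 pp; rewrite -/p; nia.
Qed.

Theorem exact_orbits (G : {group gT}) : exact_mod ga1 deg D G.
Proof.
move=> n c Sc hc.
have ex1 : exact_mod ga1 deg D 1%G by apply: exact_mod1; exact: exD.
have [e Se ee] := transfer gaM gc (sub1G G) ex1 Sc hc.
apply: (divide (m := #|G : 1%G|%g) _ Sc Se hc ee); exact: indexg_gt0.
Qed.

End IntExact.

(** * Cellular chains *)

Definition zcls k : C_ (simp 'rV[RR]_k) := projT1 (cid (disk_class k)).

Section Filtered.
Variables (T : topologicalType) (sk : nat -> set T) (I : Type) (gd : I -> nat).
Variables (J : set I) (phi : forall k, I -> 'rV[RR]_k -> T).
Hypothesis sk0 : sk 0%N = set0.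
Hypothesis at_ : forall k, attach (sk k) (sk k.+1) [set i | gd i = k /\ J i] (@phi k).

(** The extra shift makes room for the empty cell: level 0 has no simplex at all, and level 1, over
    the empty set, only the empty simplex. The filtration is abstract because it is used for the
    complex, for fixed point sets and for the orbit space. *)
Definition FS k m : simp T -> Prop := if k is k'.+1 then SG (sk k') m else fun=> False.
(* [None] is the empty cell, so the cellular complex is augmented too. *)
Definition nvb (b : option I) := if b is Some i then (gd i).+1 else 0%N.
Definition Jb (b : option I) : Prop := if b is Some i then J i else True.
Definition zeta (b : option I) : C_ (simp T) :=
  if b is Some i then pushs (@phi (gd i) i) (zcls (gd i)) else ub Emp.
Definition Zt : C_ (option I) -> C_ (simp T) := lin zeta.
HB.instance Definition _ := GRing.Linear.on Zt.
Implicit Types (c : C_ (simp T)) (a : C_ (option I)).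
Local Notation BJ k := (supp (fun b => Jb b /\ nvb b = k)).

Lemma Zt_ub b : Zt (ub b) = zeta b. Proof. exact: lin_ub. Qed.

Lemma FS_sub k l m c : (k <= l)%N -> supp (FS k m) c -> supp (FS l m) c.
Proof.
move=> kl; rewrite -(subnK kl); elim: (l - k)%N => // j IH h; rewrite addSn.
case: (j + k)%N (IH h) => [|n]; first by apply: supp_sub.
exact: supp_SG (att_sub (at_ n)).
Qed.

Lemma FS1 m c : supp (FS 1 m) c -> exists2 x, c = x *: ub Emp & m <> 0%N -> x = 0.
Proof. by rewrite /FS sk0; exact: SG_set0. Qed.

Definition uncell : C_ (option I) -> C_ I := lin (fun b => if b is Some i then ub i else 0).
HB.instance Definition _ := GRing.Linear.on uncell.

Lemma uncell_ub b : uncell (ub b) = if b is Some i then ub i else 0.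
Proof. exact: lin_ub. Qed.

Lemma Zt_cells k a : BJ k.+1 a ->
  Zt a = cells (@phi k) (zcls k) (uncell a) /\
  supp [set i | gd i = k /\ J i] (uncell a) /\ (uncell a = 0 -> a = 0).
Proof.
move=> Ba; split; last split.
- apply: (@eq_supp _ _ _ _ Zt (cells (@phi k) (zcls k) \o uncell) _ _ Ba) => -[i|] [_] //= [hi].
  by subst k; rewrite Zt_ub uncell_ub cells_ub.
- move: Ba; apply: supp_lin => -[i|] [Ji] //= [hi]; rewrite uncell_ub.
  exact: supp_ub.
- move=> h; suff -> : a = mapf Some (uncell a) by rewrite h raddf0.
  apply: (@eq_supp _ _ _ _ idfun (mapf Some \o uncell) _ _ Ba) => -[i|] [_] //= _.
  by rewrite uncell_ub mapf_ub.
Qed.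

Lemma zcls_props k : exists w y, [/\ zcls k = w + y, hball (open_disk k) w,
  supp (SG (disk k) k.+1) (zcls k) /\ supp (SG (sphere k) k) (d (zcls k)) &
  supp (SG (disk k `\ 0) k.+1) y].
Proof. exact: projT2 (cid (disk_class k)). Qed.

Lemma zeta_supp b : Jb b -> supp (FS (nvb b).+1 (nvb b)) (zeta b).
Proof.
case: b => [i|] Ji /=; last by apply: supp_ub.
have [w [y [_ _ [h _] _]]] := zcls_props (gd i).
apply: supp_pushs h; first by apply: (att_cont (at_ (gd i))).
by move=> x; apply: (att_disk (at_ (gd i))).
Qed.

Lemma zeta_d b k : Jb b -> nvb b = k.+1 -> supp (FS k.+1 k) (d (zeta b)).
Proof.
case: b => [i|] // Ji [<-] /=; rewrite d_pushs.
have [w [y [_ _ [_ h] _]]] := zcls_props (gd i).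
apply: supp_pushs h; last by move=> x; apply: (att_sphere (at_ (gd i))).
apply: contOn_sub (att_cont (at_ (gd i)) _); [exact: sphere_sub|by []].
Qed.

Lemma Zt_supp k a : BJ k a -> supp (FS k.+1 k) (Zt a).
Proof. by apply: supp_lin => b [Jb_ <-]; rewrite /= Zt_ub; exact: zeta_supp. Qed.

(** [core_gen] in augmented form: relative to the level below, the homology of a level is generated
    by its cells, in degree [k] only. *)
Lemma fb_gen k m c : supp (FS k.+1 m) c -> supp (FS k m.-1) (d c) ->
  exists a u v, [/\ BJ k a, c = Zt a + d u + v, supp (FS k.+1 m.+1) u,
    supp (FS k m) v & m <> k -> a = 0].
Proof.
case: k => [|k] hc hdc.
  have [x -> hx] := FS1 hc; exists (x *: ub None), 0, 0; split.
  - by apply: suppZ; exact: supp_ub.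
  - by rewrite linearZ /= Zt_ub /= raddf0 !addr0.
  - exact: supp0.
  - exact: supp0.
  - by move=> /hx ->; rewrite scale0r.
case: m hc hdc => [|m] hc hdc.
  (* A chain without vertices is a multiple of the empty simplex, which lies in every level but
     level 0. *)
  exists 0, 0, c; split; rewrite ?raddf0 ?add0r //; [exact: supp0|exact: supp0|].
  by move: hc; apply: supp_sub => -[|n s] [].
have [w [y [e hw [hz hdz] hy]]] := zcls_props k.
have [a [u [v [ec Ja hu hv ha]]]] := core_gen (at_ k) hw e hdz hy hc hdc.
pose a' : C_ (option I) := mapf Some a.
have Ba : BJ k.+1 a' by move: Ja; apply: supp_mapf => i [hi Ji]; split=> //=; rewrite hi.
have [e1 [_ _]] := Zt_cells Ba.
have e2 : uncell a' = a.
  apply: (@eq_FM _ _ _ (uncell \o mapf Some) idfun) => i /=.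
  by rewrite mapf_ub uncell_ub.
exists a', u, v; split=> //; first by rewrite e1 e2.
by move=> mk; rewrite /a' ha ?raddf0 // => mk'; apply: mk; rewrite mk'.
Qed.

Lemma fb_free k a u v : BJ k a -> supp (FS k.+1 k.+1) u -> supp (FS k k) v ->
  Zt a = d u + v -> a = 0.
Proof.
case: k => [|k] Ba hu hv e.
  have [x ex hx] := FS1 hu; rewrite ex hx // scale0r raddf0 add0r in e.
  rewrite (supp_False hv) in e.
  apply: cf_ext => b; rewrite cf0; case: b => [i|].
    by apply: (cf_supp Ba) => -[].
  have ea : a = cf None a *: ub None.
    apply: cf_ext => -[i|]; rewrite cfZ cf_ub; case: asboolP => // _; rewrite ?mulr1 ?mulr0 //.
    by apply: (cf_supp Ba) => -[].
  by move: e; rewrite ea linearZ /= Zt_ub /= => e; rewrite (scale_ub_eq0 e) scale0r cf0.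
have [e1 [Ja h0]] := Zt_cells Ba.
have [w [y [e2 hw [hz hdz] hy]]] := zcls_props k.
apply: h0; apply: (core_free (at_ k) hw e2 hy Ja hu hv).
by rewrite -e1.
Qed.

(** The cells of level [l] have degree less than [l], hence never degree [m]; so a cycle can be
    pushed down level by level until nothing is left. *)
Lemma fb_vanish l m c : (l <= m)%N -> supp (FS l m) c -> d c = 0 ->
  exists2 e, supp (FS l m.+1) e & d e = c.
Proof.
elim: l c => [|l IH] c lm hc dc.
  by exists 0; [exact: supp0|rewrite (supp_False hc) raddf0].
have hdc : supp (FS l m.-1) (d c) by rewrite dc; exact: supp0.
have [a [u [v [Ba ec hu hv ha]]]] := fb_gen hc hdc.
rewrite ha ?raddf0 ?add0r in ec; last by move=> e; move: lm; rewrite e ltnn.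
have [|e he ee] := IH v (ltnW lm) hv.
  by have := dc; rewrite ec raddfD /= dd add0r.
exists (u + e); first by apply: suppD => //; exact: FS_sub he.
by rewrite raddfD /= ee.
Qed.

(** The levels above [m.+1] add only cells of degree greater than [m], which contribute nothing to
    chains of degree [m]. *)
Lemma fb_down j m c : supp (FS (j + m.+1) m) c -> supp (FS m m.-1) (d c) ->
  exists c' u, [/\ supp (FS m.+1 m) c', supp (FS (j + m.+1) m.+1) u & c = c' + d u].
Proof.
elim: j c => [|j IH] c hc hdc.
  by exists c, 0; rewrite raddf0 addr0; split=> //; exact: supp0.
have hdc' : supp (FS (j + m.+1) m.-1) (d c) by apply: FS_sub hdc; lia.
have [a [u [v [Ba ec hu hv ha]]]] := fb_gen hc hdc'.
rewrite ha ?raddf0 ?add0r in ec; last by move=> e; have e1 : m = (j + m.+1)%N := e; lia.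
have [|c' [u' [h1 h2 h3]]] := IH v hv.
  by have -> : d v = d c by rewrite ec raddfD /= dd add0r.
exists c', (u + u'); split=> //.
  by apply: suppD => //; apply: FS_sub h2; lia.
by rewrite ec h3 raddfD /= addrCA.
Qed.

(** The condition [Jb b] stands inside the existential so that a choice can be made for every [b],
    as a linear extension requires. *)
Lemma fb_bd b : exists x : C_ (option I) * (C_ (simp T) * C_ (simp T)), Jb b ->
  let: (a, (u, v)) := x in
  [/\ supp (fun b' => Jb b' /\ (nvb b').+1 = nvb b) a, d (zeta b) = Zt a + d u + v,
    supp (FS (nvb b) (nvb b)) u & supp (FS (nvb b).-1 (nvb b).-1) v].
Proof.
have [hb|nb] := pselect (Jb b); last by exists (0, (0, 0)).
case e : (nvb b) => [|k].
  exists (0, (0, 0)) => _; rewrite !raddf0 !addr0; split; try exact: supp0.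
  by case: b e {hb} => //= _; rewrite d_ub.
have hd := zeta_d hb e.
have hdd : supp (FS k k.-1) (d (d (zeta b))) by rewrite dd; exact: supp0.
have [a [u [v [Ba ec hu hv _]]]] := fb_gen hd hdd.
exists (a, (u, v)) => _; split=> //.
by move: Ba; apply: supp_sub => b' [? ->].
Qed.

End Filtered.

Section CellularChains.
Variables (T : topologicalType) (sk : nat -> set T) (I : Type) (gd : I -> nat).
Variables (J : set I) (phi : forall k, I -> 'rV[RR]_k -> T).
Hypothesis sk0 : sk 0%N = set0.
Hypothesis at_ : forall k, attach (sk k) (sk k.+1) [set i | gd i = k /\ J i] (@phi k).
Implicit Types (c : C_ (simp T)) (a : C_ (option I)).
Local Notation FS := (FS sk).
Local Notation Jb := (Jb J).
Local Notation nvb := (nvb gd).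
Local Notation zeta := (zeta gd phi).
Local Notation Zt := (Zt gd phi).
Local Notation BJ k := (supp (fun b => Jb b /\ nvb b = k)).

(** The identities of the cellular boundary are all obtained from this: two cellular chains agree
    once they are cellular parts of the same singular chain. *)
Lemma fb_uniq k a a' u u' v v' : BJ k a -> BJ k a' ->
  supp (FS k.+1 k.+1) u -> supp (FS k.+1 k.+1) u' -> supp (FS k k) v -> supp (FS k k) v' ->
  Zt a + d u + v = Zt a' + d u' + v' -> a = a'.
Proof.
move=> Ba Ba' hu hu' hv hv' e; apply/eqP; rewrite -subr_eq0; apply/eqP.
apply: (fb_free sk0 at_ (k := k) (u := u' - u) (v := v' - v)); [exact: suppB|exact: suppB|exact: suppB|].
rewrite !raddfB /= -[Zt a](addrK (d u + v)) addrA e; chain.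
Qed.

(* [cD] is the cellular boundary; [cU] and [cV] are the corrections in [d_Zt]. *)
Definition cbd b := projT1 (cid (fb_bd sk0 at_ b)).
Definition cD : C_ (option I) -> C_ (option I) := lin (fun b => (cbd b).1).
HB.instance Definition _ := GRing.Linear.on cD.
Definition cU : C_ (option I) -> C_ (simp T) := lin (fun b => (cbd b).2.1).
HB.instance Definition _ := GRing.Linear.on cU.
Definition cV : C_ (option I) -> C_ (simp T) := lin (fun b => (cbd b).2.2).
HB.instance Definition _ := GRing.Linear.on cV.

Lemma cbdP b : Jb b ->
  [/\ supp (fun b' => Jb b' /\ (nvb b').+1 = nvb b) (cD (ub b)),
    d (zeta b) = Zt (cD (ub b)) + d (cU (ub b)) + cV (ub b),
    supp (FS (nvb b) (nvb b)) (cU (ub b)) & supp (FS (nvb b).-1 (nvb b).-1) (cV (ub b))].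
Proof.
move=> hb; have := projT2 (cid (fb_bd sk0 at_ b)); rewrite -/(cbd b) => /(_ hb).
by rewrite /cD /cU /cV !lin_ub; case: (cbd b) => a [u v].
Qed.

Lemma cD_supp k a : BJ k.+1 a -> BJ k (cD a).
Proof.
apply: supp_lin => b [hb hk] /=; have [+ _ _ _] := cbdP hb.
by apply: supp_sub => b' [? h]; split=> //; move: h; rewrite hk => -[].
Qed.

Lemma cD0 a : BJ 0 a -> cD a = 0.
Proof.
apply: (@eq_supp _ _ _ _ cD \0) => b [hb hk] /=; apply: supp_False.
by have [+ _ _ _] := cbdP hb; apply: supp_sub => b' []; rewrite hk.
Qed.

Lemma cU_supp k a : BJ k a -> supp (FS k k) (cU a).
Proof. by apply: supp_lin => b [hb hk] /=; have [_ _ + _] := cbdP hb; rewrite hk. Qed.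

Lemma cV_supp k a : BJ k a -> supp (FS k.-1 k.-1) (cV a).
Proof. by apply: supp_lin => b [hb hk] /=; have [_ _ _] := cbdP hb; rewrite hk. Qed.

Lemma d_Zt a : supp Jb a -> d (Zt a) = Zt (cD a) + d (cU a) + cV a.
Proof.
apply: (@eq_supp _ _ _ _ (d \o Zt) (((Zt \o cD) \+ (d \o cU)) \+ cV)) => b hb /=.
by rewrite Zt_ub; have [] := cbdP hb.
Qed.

Lemma BJ_J k a : BJ k a -> supp Jb a.
Proof. by apply: supp_sub => b []. Qed.

Lemma cDD k a : BJ k a -> cD (cD a) = 0.
Proof.
case: k => [|[|k]] Ba; first by rewrite (cD0 Ba) raddf0.
  by rewrite (cD0 (cD_supp Ba)).
have Ba1 := cD_supp Ba; have Ba2 := cD_supp Ba1.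
apply: (@fb_uniq k _ 0 (cU (cD a) + cV a) 0 (cV (cD a)) 0) => //; try exact: supp0.
- by apply: suppD; [exact: cU_supp|exact: cV_supp Ba].
- exact: cV_supp Ba1.
have := congr1 d (d_Zt (BJ_J Ba)); rewrite dd !raddfD /= dd (d_Zt (BJ_J Ba1)) => e.
by rewrite !raddf0 !addr0 [RHS]e; chain.
Qed.

(** A cellular cycle [a] is corrected to a singular cycle [w], which bounds in the whole space. The
    bounding chain is moved down to the level of the cells one degree up, and its cellular part [b]
    has boundary [a] by [fb_uniq]. *)
Lemma cD_exact k N a : sk N = setT -> acyc (setT : set T) -> BJ k a -> cD a = 0 ->
  exists2 b, BJ k.+1 b & cD b = a.
Proof.
move=> skN acT Ba Da.
have [v' hv' ev'] : exists2 v', supp (FS k k) v' & d v' = cV a.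
  have dVa : d (cV a) = 0.
    have := congr1 d (d_Zt (BJ_J Ba)); rewrite Da raddf0 add0r dd !raddfD /= dd add0r.
    by move=> ->.
  have := cV_supp Ba; case: k Ba => [|k] Ba hV; last first.
    have [v' h1 h2] := fb_vanish sk0 at_ (leqnn k) hV dVa.
    by exists v' => //; apply: (FS_sub at_) h1.
  by exists 0; [exact: supp0|rewrite (supp_False hV) raddf0].
pose w := Zt a - cU a - v'.
have hw : supp (FS k.+1 k) w.
  apply: suppB; first apply: suppB.
  - exact: (Zt_supp at_).
  - by apply: (FS_sub at_) (cU_supp Ba).
  - by apply: (FS_sub at_) hv'.
have dw : d w = 0.
  by rewrite /w !raddfB /= (d_Zt (BJ_J Ba)) Da ev' raddf0; chain.
have hT : supp (SG setT k) w by move: hw; apply: supp_SG.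
have [e0 he0 ee0] := acT _ _ hT dw.
(* Level [N.+1] is already everything; the index is enlarged to the shape that [fb_down] asks
   for. *)
have he1 : supp (FS (N + k.+2) k.+1) e0.
  have : supp (FS N.+1 k.+1) e0 by rewrite /= skN.
  by apply: (FS_sub at_); lia.
have hd : supp (FS k.+1 k) (d e0) by rewrite ee0.
have [e' [u [he' hu ee]]] := fb_down sk0 at_ he1 hd.
have de' : d e' = w by rewrite -ee0 ee raddfD /= dd addr0.
have hd' : supp (FS k.+1 k) (d e') by rewrite de'.
have [b [u1 [v1 [Bb eb hu1 hv1 _]]]] := fb_gen sk0 at_ he' hd'.
exists b => //.
apply: (@fb_uniq k _ _ (cU b + v1) 0 (cV b + v' + cU a) 0) => //; try exact: supp0.
- exact: cD_supp.
- by apply: suppD => //; exact: cU_supp.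
- by apply: suppD; [apply: suppD => //; exact: cV_supp Bb|exact: cU_supp].
have := congr1 d eb; rewrite de' !raddfD /= dd (d_Zt (BJ_J Bb)) /w raddf0 !addr0 => e.
rewrite -[Zt a](subrK (cU a)) -[Zt a - cU a](subrK v') e; chain.
Qed.

End CellularChains.

Section Graded.
Variables (B : Type) (deg : B -> nat) (top : nat) (D : {linear C_ B -> C_ B}).
Hypothesis deg_top : forall b, (deg b <= top)%N.
Hypothesis D_deg : forall k c, supp (fun b => deg b = k.+1) c -> supp (fun b => deg b = k) (D c).
Hypothesis D_deg0 : forall c, supp (fun b => deg b = 0%N) c -> D c = 0.
Local Notation S n := (supp (fun b => (n <= deg b)%N)).

Lemma graded_S n c : S n.+1 c -> S n (D c).
Proof.
apply: supp_lin => b hb; have hb' : supp (fun b' => deg b' = (deg b).-1.+1) (ub b : C_ B).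
  by apply: supp_ub; lia.
by apply: supp_sub (D_deg hb') => b' ->; lia.
Qed.

(** From homogeneous chains to the filtration of the Smith argument. The part [c1] of lowest degree
    is a cycle by itself, as its boundary has degree [n.-1] and is also the boundary of terms of
    higher degree; it is removed and [n] increases. *)
Lemma graded_exact :
  (forall k c, supp (fun b => deg b = k) c -> D c = 0 ->
     exists2 e, supp (fun b => deg b = k.+1) e & D e = c) ->
  forall n c, S n c -> D c = 0 -> exists2 e, S n.+1 e & D e = c.
Proof.
move=> ex n; have [j] := ubnP (top.+1 - n)%N; elim: j n => // j IH n hj c Sc Dc.
have [hn|hn] := ltnP top n.
  exists 0; first exact: supp0.
  rewrite raddf0; apply/esym/supp_False; apply: supp_sub Sc => b h.
  by have := deg_top b; lia.
pose c1 := restr (fun b => deg b = n) c.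
have h1 : supp (fun b => deg b = n) c1 by exact: supp_restrl.
have h2 : S n.+1 (c - c1).
  by apply: supp_sub (supp_restrC (P := fun b => deg b = n) Sc) => b [h h']; lia.
have Dc1 : D c1 = 0.
  have [n0|n0] := posnP n; first by apply: D_deg0; rewrite -n0.
  have e : D c1 = - D (c - c1) by rewrite raddfB /= Dc sub0r opprK.
  have h1' : supp (fun b => deg b = n.-1.+1) c1 by apply: supp_sub h1 => b; lia.
  apply: supp_False; have : supp (fun b => deg b = n.-1 /\ (n <= deg b)%N) (D c1).
    by apply: suppI; [exact: D_deg h1'|rewrite e; apply: suppN; exact: graded_S h2].
  by apply: supp_sub => b []; lia.
have [e1 he1 De1] := ex _ _ h1 Dc1.
have [||e2 he2 De2] := IH n.+1 _ (c - c1) h2; first by lia.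
  by rewrite raddfB /= Dc Dc1 subrr.
exists (e1 + e2); last by rewrite raddfD /= De1 De2 addrC subrK.
apply: suppD; first by apply: supp_sub he1 => b; lia.
by apply: supp_sub he2 => b; lia.
Qed.
End Graded.

(** * Cellular chains of the complex and of its orbit space *)

Section Orbit.
Variables (gT : finGroupType) (T : topologicalType) (act : gT -> T -> T).
Variables (I : Type) (dim : I -> nat) (phi : forall i, 'rV[RR]_(dim i) -> T).
Hypothesis gcw : is_GCW act dim phi.
Variable N : nat.
Hypothesis dimN : forall i, (dim i <= N)%N.
Hypothesis acT : acyc (setT : set T).

Implicit Types (c : C_ (simp T)) (a : C_ (option I)).
Local Notation sk := (skel gcw).
Local Notation gd := (gdim gcw).
Local Notation gphi := (fun k => @gphi _ _ _ _ _ _ gcw k).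
Local Notation zeta := (zeta gd gphi).
Local Notation ZtX := (Zt gd gphi).
Local Notation nvb := (nvb gd).
Local Notation BJ k := (supp (fun b => Jb setT b /\ nvb b = k)).

Lemma attach_skel k : attach (sk k) (sk k.+1) [set i | gd i = k /\ setT i] (@gphi k).
Proof.
have := attach_fixs gcw 1%g k.
have -> : fixs act 1%g = setT by apply/seteqP; split=> x // _; exact: (act1 gcw).
rewrite !setIT; congr (attach _ _ _ _); apply/seteqP; split=> i [h _]; split=> //.
exact: ga1.
Qed.

Lemma attach_fixs_sk g k :
  attach ((fun k => sk k `&` fixs act g) k) ((fun k => sk k `&` fixs act g) k.+1)
    [set i | gd i = k /\ [set i | ga gcw g i = i] i] (@gphi k).
Proof. exact: attach_fixs. Qed.

Lemma skel0_fixs g : (fun k => sk k `&` fixs act g) 0%N = set0.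
Proof. by rewrite /= skel0 set0I. Qed.

Local Notation D := (cD (skel0 gcw) attach_skel).
Local Notation U := (cU (skel0 gcw) attach_skel).
Local Notation V := (cV (skel0 gcw) attach_skel).

Definition oga g (b : option I) : option I := omap (ga gcw g) b.

Lemma oga1 b : oga 1%g b = b. Proof. by case: b => //= i; rewrite ga1. Qed.
Lemma ogaM g h b : oga (g * h)%g b = oga g (oga h b).
Proof. by case: b => //= i; rewrite gaM. Qed.
Lemma nvb_oga g b : nvb (oga g b) = nvb b.
Proof. by case: b => //= i; rewrite gdim_ga. Qed.
Lemma Jb_setT b : Jb (setT : set I) b. Proof. by case: b. Qed.

Lemma zeta_k k i : gd i = k -> zeta (Some i) = pushs (gphi k i) (zcls k).
Proof. by move=> h; subst k. Qed.

Lemma zcls_supp k : supp (SG (disk k) k.+1) (zcls k).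
Proof. by have [w [y [_ _ [] ]]] := zcls_props k. Qed.

Lemma pushs_act_zeta g b : pushs (act g) (zeta b) = zeta (oga g b).
Proof.
case: b => [i|] /=; last by rewrite pushs_ub.
rewrite pushs_comp -/(zeta (Some (ga gcw g i))) (zeta_k (k := gd i)) ?gdim_ga //.
apply: (pushs_ext (A := disk (gd i)) _ (@zcls_supp (gd i))) => x hx; exact: gphi_act_k.
Qed.

Lemma pushs_act_Zt g a : pushs (act g) (ZtX a) = ZtX (mapf (oga g) a).
Proof.
apply: (@eq_FM _ _ _ (pushs (act g) \o ZtX) (ZtX \o mapf (oga g))) => b /=.
by rewrite mapf_ub !Zt_ub pushs_act_zeta.
Qed.

Lemma FS_act g k m c : supp (FS sk k m) c -> supp (FS sk k m) (pushs (act g) c).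
Proof.
case: k => [|k] /=; first by move=> /supp_False ->; rewrite raddf0; exact: supp0.
apply: supp_pushs; first by apply: contOnT; exact: (act_cont gcw).
by move=> x; exact: skel_act.
Qed.

Lemma BJ_ub b : BJ (nvb b) (ub b : C_ (option I)).
Proof. by apply: supp_ub; split=> //; exact: Jb_setT. Qed.

Lemma BJ_mapf g k a : BJ k a -> BJ k (mapf (oga g) a).
Proof.
by apply: supp_mapf => b [_ <-]; split; [exact: Jb_setT|exact: nvb_oga].
Qed.

(** Translating the decomposition of the boundary of [b] by [g] gives one for [oga g b], and
    cellular parts are unique. *)
Lemma D_oga g a : D (mapf (oga g) a) = mapf (oga g) (D a).
Proof.
apply: (@eq_FM _ _ _ (D \o mapf (oga g)) (mapf (oga g) \o D)) => b /=.
rewrite mapf_ub; have Bb := @BJ_ub b; have Bg := @BJ_ub (oga g b); rewrite nvb_oga in Bg.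
case e : (nvb b) Bb Bg => [|k] Bb Bg.
  by rewrite (cD0 _ _ Bb) (cD0 _ _ Bg) raddf0.
apply: (fb_uniq (skel0 gcw) attach_skel (k := k)
  (u := U (ub (oga g b))) (u' := pushs (act g) (U (ub b)))
  (v := V (ub (oga g b))) (v' := pushs (act g) (V (ub b)))).
- exact: cD_supp.
- by apply: BJ_mapf; exact: cD_supp.
- exact: cU_supp Bg.
- by apply: FS_act; exact: cU_supp Bb.
- exact: cV_supp Bg.
- by apply: FS_act; exact: cV_supp Bb.
rewrite -(d_Zt (skel0 gcw) attach_skel (BJ_J Bg)) Zt_ub -pushs_act_zeta d_pushs -Zt_ub (d_Zt (skel0 gcw) attach_skel (BJ_J Bb)).
by rewrite !raddfD /= pushs_act_Zt -d_pushs.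
Qed.

(** The boundary of a fixed cell can be decomposed inside the fixed point set of [g], where only
    fixed cells are available; by uniqueness the outcome is [D (ub b)]. *)
Lemma D_fix g b : oga g b = b -> supp (fun b' => oga g b' = b') (D (ub b)).
Proof.
move=> hb; have Bb := @BJ_ub b.
case e : (nvb b) Bb => [|k] Bb; first by rewrite (cD0 _ _ Bb); exact: supp0.
have Jgb : Jb [set i | ga gcw g i = i] b by case: b hb {e Bb} => //= i [].
have JP b' : Jb [set i | ga gcw g i = i] b' -> oga g b' = b'.
  by case: b' => //= i ->.
have [[a [u v]] /(_ Jgb) [ha ea hu hv]] := fb_bd (skel0_fixs g) (attach_fixs_sk g) b.
have FSs k' m c : supp (FS (fun k => sk k `&` fixs act g) k' m) c -> supp (FS sk k' m) c.
  by case: k' => // k'; apply: supp_SG => x [].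
suff -> : D (ub b) = a by apply: supp_sub ha => b' [] /JP.
rewrite e in ha hu hv.
apply: (fb_uniq (skel0 gcw) attach_skel (k := k)
  (u := U (ub b)) (u' := u) (v := V (ub b)) (v' := v)) => //.
- exact: cD_supp.
- by apply: supp_sub ha => b' [_ []]; split=> //; exact: Jb_setT.
- exact: cU_supp Bb.
- exact: FSs hu.
- exact: cV_supp Bb.
- exact: FSs hv.
by rewrite -(d_Zt (skel0 gcw) attach_skel (BJ_J Bb)) Zt_ub.
Qed.

Lemma D_gcomplex : gcomplex oga nvb D.
Proof.
have Bk k a : supp (fun b => nvb b = k) a -> BJ k a.
  by apply: supp_sub => b; split=> //; exact: Jb_setT.
split=> //.
- exact: nvb_oga.
- apply: graded_S => [k c /Bk h].
  by have := @cD_supp _ _ _ _ _ _ (skel0 gcw) attach_skel _ _ h; apply: supp_sub => b [].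
- move=> c; apply: (@eq_FM _ _ _ (D \o D) \0) => b /=; exact: cDD (@BJ_ub b).
- exact: D_oga.
- exact: D_fix.
Qed.

Lemma nvb_top b : (nvb b <= N.+1)%N.
Proof. by case: b => //= i; rewrite ltnS; exact: leq_trans (gdim_le gcw i) (dimN i). Qed.

Lemma D_exact n (c : C_ (option I)) : supp (fun b => (n <= nvb b)%N) c -> D c = 0 ->
  exists2 e, supp (fun b => (n.+1 <= nvb b)%N) e & D e = c.
Proof.
have Bk k a : supp (fun b => nvb b = k) a -> BJ k a.
  by apply: supp_sub => b; split=> //; exact: Jb_setT.
have kB k a : BJ k a -> supp (fun b => nvb b = k) a by apply: supp_sub => b [].
apply: (graded_exact nvb_top).
- by move=> k a /Bk h; apply: kB; exact: cD_supp.
- by move=> a /Bk; exact: cD0.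
- move=> k a /Bk h Da.
  have [e he ee] := cD_exact (skel_top gcw dimN) acT h Da.
  by exists e => //; exact: kB.
Qed.

Variables (Y : topologicalType) (p : T -> Y).
Hypothesis hp : is_orbit_space act p.

Local Notation skY := (oskel gcw p).
Local Notation phiY := (fun k i => p \o @gphi k i).
Local Notation JY := [set i | rep gcw i = i].
Local Notation ZtY := (Zt gd phiY).

Definition orep (b : option I) : option I := omap (rep gcw) b.

Lemma oskel0 : skY 0%N = set0.
Proof. by rewrite /oskel skel0 image_set0. Qed.

Lemma attach_oskel k : attach (skY k) (skY k.+1) [set i | gd i = k /\ JY i] (@phiY k).
Proof. exact: attach_orbit. Qed.

Lemma nvb_orep b : nvb (orep b) = nvb b.
Proof. by case: b => //= i; rewrite gdim_rep. Qed.

Lemma Jb_orep b : Jb JY (orep b).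
Proof. by case: b => //= i; rewrite rep_rep. Qed.

Lemma pushs_p_Zt a : pushs p (ZtX a) = ZtY (mapf orep a).
Proof.
apply: (@eq_FM _ _ _ (pushs p \o ZtX) (ZtY \o mapf orep)) => b /=.
rewrite mapf_ub !Zt_ub; case: b => [i|] /=; last by rewrite pushs_ub.
rewrite pushs_comp gdim_rep.
by apply: (pushs_ext (A := disk (gd i)) _ (@zcls_supp (gd i))) => x hx; exact: (p_gphi gcw hp).
Qed.

Lemma FS_p k m c : supp (FS sk k m) c -> supp (FS skY k m) (pushs p c).
Proof.
case: k => [|k] /=; first by move=> /supp_False ->; rewrite raddf0; exact: supp0.
apply: supp_pushs; first by apply: contOnT; exact: (p_cont hp).
by move=> x hx; exact/(p_oskel gcw hp).
Qed.

Lemma BJ_orep k a : BJ k a -> supp (fun b => Jb JY b /\ nvb b = k) (mapf orep a).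
Proof.
by apply: supp_mapf => b [_ <-]; split; [exact: Jb_orep|exact: nvb_orep].
Qed.

(** [orep] and [qrep] for the whole group choose possibly different representatives of the same
    orbits, so they have the same kernel; the other inclusion is [hq] in [orep_exact]. *)
Lemma orep_qrep a : mapf (qrep oga1 [set: gT]%G) a = 0 -> mapf orep a = 0.
Proof.
move=> /(congr1 (mapf orep)); rewrite raddf0 mapf_comp => <-; congr (mapf _ a).
apply/funext => b /=; have [g _ ->] := qrepE oga1 [set: gT]%G b.
by case: b => //= i; rewrite rep_ga.
Qed.

Lemma orep_exact k a : BJ k a -> mapf orep (D a) = 0 ->
  exists2 e, BJ k.+1 e & mapf orep (a - D e) = 0.
Proof.
move=> Ba hD.
have hq : mapf (qrep oga1 [set: gT]%G) (D a) = 0.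
  move: hD => /(congr1 (mapf (qrep oga1 [set: gT]%G))); rewrite raddf0 mapf_comp => <-.
  congr (mapf _ (D a)); apply/funext => -[i|] //=; have [g ->] := repE gcw i.
  by rewrite -[Some (ga _ _ _)]/(oga g (Some i)) qrep_ga ?inE //; exact: ogaM.
have Sa : supp (fun b => (k <= nvb b)%N) a by apply: supp_sub Ba => b [_ ->].
have [e Se /orep_qrep ee] := exact_orbits ogaM nvb_top D_gcomplex D_exact Sa hq.
pose e1 := restr (fun b => nvb b = k.+1) e.
have Be : BJ k.+1 e1.
  by apply: supp_sub (@supp_restrl _ _ (fun b => nvb b = k.+1) e) => b; split=> //; exact: Jb_setT.
have Se2 : supp (fun b => (k.+2 <= nvb b)%N) (e - e1).
  by apply: supp_sub (supp_restrC (P := fun b => nvb b = k.+1) Se) => b [h h']; lia.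
exists e1 => //.
(* On orbits, [a - D e1] has degree [k], but it also equals the boundary of terms of degree at least
   [k.+2]; so it vanishes. *)
have eq : mapf orep (a - D e1) = mapf orep (D (e - e1)).
  rewrite -[LHS]subr0 -ee -raddfB /=; congr (mapf _ _); rewrite raddfB /=; chain.
apply: supp_False; have : supp (fun b => nvb b = k /\ (k.+1 <= nvb b)%N) (mapf orep (a - D e1)).
  apply: suppI.
    apply: (supp_mapf (P := fun b => nvb b = k)) => [b <-|]; first exact: nvb_orep.
    apply: suppB; first by apply: supp_sub Ba => b [].
    by have := @cD_supp _ _ _ _ _ _ (skel0 gcw) attach_skel _ _ Be; apply: supp_sub => b [].
  rewrite eq; apply: (supp_mapf (P := fun b => (k.+1 <= nvb b)%N)) => [b|]; first by rewrite nvb_orep.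
  exact: (gc_S D_gcomplex).
by apply: supp_sub => b []; lia.
Qed.

(** Cellular chains below are supported on representatives, so they lift to cellular chains
    upstairs, and [dP] computes boundaries below from [D]. A cycle reduces to its cellular part [a];
    by [orep_exact] this is the image of a boundary, and what is left lies in a level too low to
    carry homology in its degree. *)
Lemma acyc_orbit : acyc (setT : set Y).
Proof.
move=> m c hc dc.
have skYN : skY N.+1 = setT.
  by apply/seteqP; split=> y // _; have [x <-] := p_surj hp y; exists x; rewrite ?(skel_top gcw dimN).
have hc1 : supp (FS skY (N.+1 + m.+1) m) c.
  have : supp (FS skY N.+2 m) c by rewrite /= skYN.
  by apply: (FS_sub attach_oskel); lia.
have hd0 : supp (FS skY m m.-1) (d c) by rewrite dc; exact: supp0.
have [c' [u0 [hc' hu0 ec]]] := fb_down oskel0 attach_oskel hc1 hd0.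
have dc' : d c' = 0 by rewrite -dc ec raddfD /= dd addr0.
have hd' : supp (FS skY m m.-1) (d c') by rewrite dc'; exact: supp0.
have [a [u [v [Ba ec' hu hv _]]]] := fb_gen oskel0 attach_oskel hc' hd'.
have Ba' : BJ m a by apply: supp_sub Ba => b [_ <-]; split=> //; exact: Jb_setT.
have ra : mapf orep a = a by apply: mapf_id Ba => -[i|] //= [-> _].
have eZ : ZtY a = pushs p (ZtX a) by rewrite pushs_p_Zt ra.
have dP (b : C_ (option I)) k : BJ k b ->
    d (pushs p (ZtX b)) = ZtY (mapf orep (D b)) + d (pushs p (U b)) + pushs p (V b).
  by move=> Bb; rewrite d_pushs (d_Zt (skel0 gcw) attach_skel (BJ_J Bb)) !raddfD /= pushs_p_Zt d_pushs.
(* Uniqueness of cellular parts below, applied to the vanishing chain [d c']. *)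
have rD : mapf orep (D a) = 0.
  case: m Ba' {hc dc hc1 hd0 hc' hu0 hd' Ba hu} hv => [|m] Ba' hv.
    by rewrite (cD0 _ _ Ba') raddf0.
  apply: (fb_uniq oskel0 attach_oskel (k := m) (a' := 0) (u := pushs p (U a) + v) (u' := 0)
    (v := pushs p (V a)) (v' := 0)); try exact: supp0.
  - by apply: BJ_orep; exact: cD_supp.
  - by apply: suppD => //; apply: FS_p; exact: cU_supp Ba'.
  - by apply: FS_p; exact: cV_supp Ba'.
  have := congr1 d ec'; rewrite dc' !raddfD /= dd eZ (dP _ _ Ba') => e.
  by rewrite !raddf0 !addr0 [RHS]e; chain.
have [e Be ee] := orep_exact Ba' rD.
have reD : mapf orep (D e) = a.
  by have := ee; rewrite raddfB /= ra => /subr0_eq ->.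
have hv' : supp (FS skY m m) (v - pushs p (V e)).
  by apply: suppB => //; apply: FS_p; exact: cV_supp Be.
have ecc : c' = d (pushs p (ZtX e) - pushs p (U e) + u) + (v - pushs p (V e)).
  by rewrite ec' !raddfD raddfN /= (dP _ _ Be) reD; chain.
have dv' : d (v - pushs p (V e)) = 0.
  by have := dc'; rewrite {1}ecc raddfD /= dd add0r.
have [w hw ew] := fb_vanish oskel0 attach_oskel (leqnn m) hv' dv'.
have FT k l (x : C_ (simp Y)) : supp (FS skY k l) x -> supp (SG setT l) x.
  by case: k => [|k] /=; [apply: supp_sub|apply: supp_SG].
exists (u0 + (pushs p (ZtX e) - pushs p (U e) + u) + w); last first.
  by rewrite !raddfD /= ew [RHS]ec [X in _ = X + _]ecc !raddfD /=; chain.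
apply: suppD; last exact: FT hw.
apply: suppD; first exact: FT hu0.
apply: suppD; last exact: FT hu.
apply: suppB; apply: FT; apply: FS_p; last exact: cU_supp Be.
exact: (Zt_supp attach_skel Be).
Qed.

End Orbit.

(** * Chains of simplices as in the statement *)

Lemma dlbE (E : Type) (l : seq E) :
  dlb l = \sum_(j < size l) ((-1) ^+ j : int) *: ub (take j l ++ drop j.+1 l).
Proof.
elim: l => [|x l IH]; first by rewrite big_ord0.
rewrite /= big_ord_recl /= expr0 scale1r ?take0 ?drop0; congr (_ + _).
rewrite IH raddf_sum -sumrN; apply: eq_bigr => j _ /=.
by rewrite linearZ /= /consl mapf_ub -scaleNr exprS mulN1r.
Qed.

Section Face.
Variable n : nat.
Implicit Types (j : 'I_n.+2) (x : 'rV[RR]_n.+1).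

Lemma face_std j x : stdsimplex n x -> stdsimplex n.+1 (face j x).
Proof.
move=> [x0 x1]; split=> [i|]; first by rewrite mxE; case: unlift.
rewrite (bigD1_ord j) //= mxE unlift_none add0r -[RHS]x1; apply: eq_bigr => i _.
by rewrite mxE liftK.
Qed.

Lemma aff_face j x : aff (take j (std n.+1) ++ drop j.+1 (std n.+1)) x = face j x.
Proof.
have nthE (k : 'I_n.+1) :
    nth 0 (take j (std n.+1) ++ drop j.+1 (std n.+1)) k = vtx (lift j k).
  have hj : (j < size (std n.+1))%N by rewrite size_std.
  rewrite -nth_std nth_cat size_take hj nth_drop /= /bump.
  case: leqP => h; last by rewrite nth_take.
  by congr nth; lia.
rewrite /aff; apply/rowP => i; rewrite summxE mxE.
under eq_bigr do rewrite nthE !mxE eqxx /=.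
case: unliftP => [k ->|->].
  rewrite (bigD1 k) //= eqxx mulr1 big1 ?addr0 // => k' kk'.
  by rewrite (inj_eq (@lift_inj _ j)) eq_sym (negbTE kk') mulr0.
by rewrite big1 // => k _; rewrite (negbTE (neq_lift j k)) mulr0.
Qed.
End Face.

Section Translation.
Variable T : topologicalType.

Definition sx n (s : 'rV[RR]_n.+1 -> T) : simp T := Sx (s \o @rn n).

Definition tr n (ch : chain T n) : C_ (simp T) := \sum_(p <- ch) p.1 *: ub (sx p.2).

Lemma sx_eq n (s s' : 'rV[RR]_n.+1 -> T) :
  sx s = sx s' <-> forall x, stdsimplex n x -> s x = s' x.
Proof.
split=> [[h] x hx|h].
  (* Injectivity of [Sx] in its dependent argument, by decidable equality of dimensions. *)
  have e := Eqdep_dec.inj_pair2_eq_dec nat (@eq_comparable nat)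
    (fun n : nat => 'rV[RR]_n.+1 -> T) n _ _ h.
  by have := congr1 (fun f => f x) e; rewrite /= rn_id.
by congr Sx; apply/funext => x /=; apply: h; exact: rn_std.
Qed.

Lemma coefE n (ch : chain T n) s : coef ch s = cf (sx s) (tr ch).
Proof.
rewrite /coef /tr cf_sum; apply: eq_bigr => p _; rewrite cfZ cf_ub.
have -> : `[< sx p.2 = sx s >] = `[< forall x, stdsimplex n x -> p.2 x = s x >].
  by apply: asbool_equiv_eq; exact: sx_eq.
by case: asboolP => _; rewrite ?mulr1 ?mulr0.
Qed.

Lemma eq_tr n (ch ch' : chain T n) : (forall s, coef ch s = coef ch' s) <-> tr ch = tr ch'.
Proof.
split=> [h|h s]; last by rewrite !coefE h.
have hs (ch1 : chain T n) : supp (fun t => exists s, t = @sx n s) (tr ch1).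
  by apply: supp_sum => p _; apply: suppZ; apply: supp_ub; exists p.2.
apply: cf_ext => t; have [[s ->]|nt] := pselect (exists s, t = @sx n s).
  by rewrite -!coefE.
by rewrite !(cf_supp (hs _) nt).
Qed.

Lemma tr_singular n (ch : chain T n) : singular_chain ch -> supp (SG setT n.+1) (tr ch).
Proof.
rewrite /tr; elim: ch => [|p ch IH] h; first by rewrite big_nil; exact: supp0.
rewrite big_cons; apply: suppD; last by apply: IH => q hq; apply: h; right.
apply: suppZ; apply: supp_ub; split=> //; split=> //.
  by apply/funext => x /=; rewrite (rn_id (rn_std x)).
apply: (contOn_eq (f := p.2)) => [x hx /=|]; first by rewrite rn_id.
by apply/contOnP; apply: h; left.
Qed.

Lemma tr_surj n c : supp (SG setT n.+1) c ->
  exists2 ch : chain T n, singular_chain ch & tr ch = c.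
Proof.
move: c; apply: supp_ind => [|a t c [ht nt] [ch hch <-]].
  by exists [::] => //; rewrite /tr big_nil.
case: t ht nt => // m s [es cs _] [mn]; subst m.
exists ((a, s) :: ch); last by rewrite /tr big_cons /sx /= -es.
by move=> q [<-|/hch] //; apply/contOnP.
Qed.

Lemma d_sx0 (s : 'rV[RR]_1 -> T) : d (ub (sx s)) = ub Emp.
Proof.
by rewrite d_ub /= dlbE size_std big_ord1 expr0 scale1r pushl_ub /= take0 drop_oversize ?size_std.
Qed.

Lemma d_sx n (s : 'rV[RR]_n.+2 -> T) :
  d (ub (sx s)) = \sum_(j < n.+2) ((-1) ^+ j : int) *: ub (sx (s \o face j)).
Proof.
rewrite d_ub /= dlbE size_std raddf_sum; apply: eq_bigr => j _ /=.
rewrite linearZ /= pushl_ub (@simplE _ _ _ _ n); last first.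
  by rewrite size_cat size_take size_drop size_std ltn_ord; have := ltn_ord j; lia.
congr (_ *: ub (Sx _)); apply/funext => y /=.
by rewrite aff_face rn_id //; apply: face_std; exact: rn_std.
Qed.

Lemma tr_boundary n (ch : chain T n.+1) : tr (boundary ch) = d (tr ch).
Proof.
rewrite /tr raddf_sum big_flatten /= big_map; apply: eq_bigr => p _.
rewrite big_map linearZ /= d_sx scaler_sumr big_enum /=; apply: eq_bigr => j _.
by rewrite scalerA mulrC.
Qed.

Lemma d_tr0 (ch : chain T 0) : d (tr ch) = augmentation ch *: ub Emp.
Proof.
rewrite /tr raddf_sum /augmentation scaler_suml; apply: eq_bigr => p _.
by rewrite /= linearZ /= d_sx0.
Qed.

(** With vertices counted, degree 0 is the nonemptiness of [T], degree 1 the clause with the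
    augmentation, and degree [n.+2] the clause for chains of dimension [n.+1]. *)
Lemma acyclic_acyc : acyclic T -> acyc (setT : set T).
Proof.
move=> [[x _] h0 h1] [|[|n]] c hc dc.
- have [a ->] : exists a, c = a *: ub Emp.
    move: c hc {dc}; apply: supp_ind => [|a t c [_ nt] [b ->]]; first by exists 0; rewrite scale0r.
    by case: t nt => // _; exists (a + b); rewrite scalerDl.
  have hx : singular_chain [:: (1 : int, (fun=> x) : 'rV[RR]_1 -> T)].
    by move=> p [<-|//]; apply/contOnP; move=> y _ U hU; apply: filterE => z _; exact: nbhs_singleton hU.
  exists (a *: tr [:: (1 : int, (fun=> x) : 'rV[RR]_1 -> T)]).
    by apply: suppZ; exact: tr_singular.
  by rewrite linearZ /= d_tr0 /augmentation big_seq1 scale1r.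
- have [ch hch ec] := tr_surj hc; rewrite -ec in dc *.
  have [|e [he /eq_tr ee]] := h0 ch hch; first by move: dc; rewrite d_tr0 => e; exact: scale_ub_eq0 e.
  by exists (tr e); [exact: tr_singular|rewrite -tr_boundary].
- have [ch hch ec] := tr_surj hc; rewrite -ec in dc *.
  have [|e [he /eq_tr ee]] := h1 n ch hch; first by move=> s; rewrite coefE tr_boundary dc cf0.
  by exists (tr e); [exact: tr_singular|rewrite -tr_boundary].
Qed.

Lemma acyc_acyclic : acyc (setT : set T) -> acyclic T.
Proof.
move=> acT; split.
- have [||e he de] := acT 0%N (ub Emp); [exact: supp_ub|by rewrite d_ub|].
  apply: contrapT => nT; suff e0 : e = 0.
    by have := de; rewrite e0 raddf0 -[ub Emp]scale1r => /esym h; have := scale_ub_eq0 h.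
  apply: supp_False; apply: supp_sub he => -[|n s] [] // _ _.
  by apply: nT; exists (s 0).
- move=> c hc ac; have dc : d (tr c) = 0 by rewrite d_tr0 ac scale0r.
  have [e he ee] := acT 1%N _ (tr_singular hc) dc.
  have [ch hch ech] := tr_surj he; exists ch; split=> //.
  by apply/eq_tr; rewrite tr_boundary ech.
- move=> n c hc bc; have dc : d (tr c) = 0.
    have e : tr (boundary c) = tr ([::] : chain T n).
      by apply/eq_tr => s; rewrite bc /coef big_nil.
    by rewrite -tr_boundary e /tr big_nil.
  have [e he ee] := acT _ _ (tr_singular hc) dc.
  have [ch hch ech] := tr_surj he; exists ch; split=> //.
  by apply/eq_tr; rewrite tr_boundary ech.
Qed.

End Translation.

Theorem theorem2p15 (gT : finGroupType) (T : topologicalType)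
  (act : gT -> T -> T) (I : Type) (dim : I -> nat)
  (phi : forall i, 'rV[RR]_(dim i) -> T) :
  is_GCW act dim phi -> finite_dimensional dim -> acyclic T ->
  forall (Y : topologicalType) (p : T -> Y),
    is_orbit_space act p -> acyclic Y.
Proof.
move=> gcw [N dimN] acT Y p hp; apply: acyc_acyclic.
exact: (acyc_orbit gcw dimN (acyclic_acyc acT) hp).
Qed.
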